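(* Let $g:\Omega\times\Delta[0,\infty)\times\mathbb{R}^m\times\mathbb{R}^{m\times d}\times\mathbb{R}^{m\times d}\to\mathbb{R}^m$ satisfy Assumption (B) (with Lipschitz functions $K_{g,y},K_{g,z_1},K_{g,z_2}$; see context), and let $\eta,\lambda\in\mathbb{R}$ satisfy $$[K_{g,y}]_1(\eta+\lambda)+[K_{g,z_1}]_2(\lambda)+[K_{g,z_2}]_2(\eta+\lambda)<1.$$ Let $\psi(\cdot)\in L^{2,\eta}_{\mathcal{F}_\infty}(0,\infty;\mathbb{R}^m)$, and let $(Y,Z)\in\mathcal{M}^{2,\eta}_{\mathbb{F}}(0,\infty;\mathbb{R}^m\times\mathbb{R}^{m\times d})$ be the adapted M-solution of $$Y(t)=\psi(t)+\int_t^\infty e^{-\lambda(s-t)}g(t,s,Y(s),Z(t,s),Z(s,t))\,ds-\int_t^\infty Z(t,s)\,dW(s),\quad t\ge0.$$ For each $T>0$ put $\psi_T(t):=\mathbb{E}_T[\psi(t)]\mathbf{1}_{[0,T]}(t)$, let $(\tilde Y_T,\tilde Z_T)$ be the adapted M-solution on $[0,T]$ of the finite horizon equation $$\tilde Y_T(t)=\psi_T(t)+\int_t^Te^{-\lambda(s-t)}g(t,s,\tilde Y_T(s),\tilde Z_T(t,s),\tilde Z_T(s,t))\,ds-\int_t^T\tilde Z_T(t,s)\,dW(s),\quad t\in[0,T],$$ and define $Y_T(t):=\tilde Y_T(t)\mathbf{1}_{[0,T]}(t)$ for $t\ge0$ and $Z_T(t,s):=\tilde Z_T(t,s)\mathbf{1}_{[0,T]^2}(t,s)$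 for $(t,s)\in[0,\infty)^2$. Then $$\lim_{T\to\infty}\mathbb{E}\Bigl[\int_0^\infty e^{2\eta t}|Y(t)-Y_T(t)|^2\,dt+\int_0^\infty e^{2\eta t}\int_0^\infty|Z(t,s)-Z_T(t,s)|^2\,ds\,dt\Bigr]=0.$$
   Context: $(\Omega,\mathcal{F},\mathbb{P})$ is a complete probability space with a $d$-dimensional Brownian motion $W$; $\mathbb{F}=(\mathcal{F}_t)_{t\ge0}$ is the $\mathbb{P}$-augmented filtration generated by $W$; $\mathcal{F}_\infty=\bigvee_{t\ge0}\mathcal{F}_t$; $\mathbb{E}_T[\cdot]=\mathbb{E}[\cdot|\mathcal{F}_T]$. Matrices carry the Frobenius norm $|\cdot|$. For $z$ with values in $\mathbb{R}^{m\times d}$ with columns $z^1,\dots,z^d$, $\int z\,dW=\sum_{k=1}^d\int z^k\,dW_k$. $\Delta[0,\infty)=\{(t,s):0\le t\le s<\infty\}$. For $p\in\{1,2\}$, $L^{p,*}(0,\infty;\mathbb{R}_+)$ is the set of measurable $f:[0,\infty)\to\mathbb{R}_+$ such that $\int_0^\infty e^{p\beta t}f(t)^p\,dt<\infty$ for some $\beta\in\mathbb{R}$; for such $f$ and $\rho\in\mathbb{R}$, $[f]_p(\rho):=\bigl(\int_0^\infty e^{-p\rho t}f(t)^p\,dt\bigr)^{1/p}\in[0,\infty]$. For $\beta\in\mathbb{R}$: $L^{2,\beta}_{\mathcal{F}_\infty}(0,\infty;\mathbb{R}^m)$ is the set of $\mathcal{F}_\infty\otimes\mathcal{B}([0,\infty))$-measurable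 $f:\Omega\times[0,\infty)\to\mathbb{R}^m$ (not necessarily adapted) with $\mathbb{E}\int_0^\infty e^{2\beta t}|f(t)|^2dt<\infty$; $L^{2,\beta}_{\mathbb{F}}(0,\infty;\mathbb{R}^m)$ is its subset of adapted processes; $\mathscr{L}^{2,\beta}_{\mathbb{F}}(0,\infty;\mathbb{R}^{m\times d})$ is the set of $\mathcal{F}\otimes\mathcal{B}([0,\infty)^2)$-measurable $f:\Omega\times[0,\infty)^2\to\mathbb{R}^{m\times d}$ such that $f(t,\cdot)$ is adapted for a.e. $t\ge0$ and $\mathbb{E}\int_0^\infty e^{2\beta t}\int_0^\infty|f(t,s)|^2\,ds\,dt<\infty$. $\mathcal{M}^{2,\beta}_{\mathbb{F}}(0,\infty;\mathbb{R}^m\times\mathbb{R}^{m\times d})$ is the set of $(y,z)\in L^{2,\beta}_{\mathbb{F}}(0,\infty;\mathbb{R}^m)\times\mathscr{L}^{2,\beta}_{\mathbb{F}}(0,\infty;\mathbb{R}^{m\times d})$ with $y(t)=\mathbb{E}[y(t)]+\int_0^tz(t,s)\,dW(s)$ for a.e. $t\ge0$, a.s. Adapted M-solution (infinite horizon): a pair in $\bigcup_{\beta\in\mathbb{R}}\mathcal{M}^{2,\beta}_{\mathbb{F}}$ satisfying the equation for a.e. $t\ge0$, a.s.; under the hypotheses of the claim it exists and is unique in $\mathcal{M}^{2,\eta}_{\mathbb{F}}$. Adapted M-solution on $[0,T]$: a pair of (jointly measurable) processes $(\tilde Y(t))_{t\in[0,T]}$, $(\tilde Z(t,s))_{(t,s)\in[0,T]^2}$,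 with $\tilde Y$ adapted and $\tilde Z(t,\cdot)$ adapted for a.e. $t\in[0,T]$, $\mathbb{E}\bigl[\int_0^T|\tilde Y(t)|^2dt+\int_0^T\int_0^T|\tilde Z(t,s)|^2ds\,dt\bigr]<\infty$, $\tilde Y(t)=\mathbb{E}[\tilde Y(t)]+\int_0^t\tilde Z(t,s)\,dW(s)$ for a.e. $t\in[0,T]$, a.s., satisfying the finite horizon equation for a.e. $t\in[0,T]$, a.s.; it exists and is unique. Assumption (B): (i) $g$ is measurable; (ii) $(g(t,s,y,z_1,z_2))_{s\in[t,\infty)}$ is adapted for each $t\ge0$ and $(y,z_1,z_2)$; (iii) there exist $K_{g,y}\in L^{1,*}(0,\infty;\mathbb{R}_+)$ and $K_{g,z_1},K_{g,z_2}\in L^{2,*}(0,\infty;\mathbb{R}_+)$ such that $|g(t,s,y,z_1,z_2)-g(t,s,y',z_1',z_2')|\le K_{g,y}(s-t)|y-y'|+K_{g,z_1}(s-t)|z_1-z_1'|+K_{g,z_2}(s-t)|z_2-z_2'|$ for all $(y,z_1,z_2),(y',z_1',z_2')$, for a.e. $(t,s)\in\Delta[0,\infty)$, a.s.; (iv) $g(t,s,0,0,0)=0$ for a.e. $(t,s)\in\Delta[0,\infty)$, a.s. *)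

(* Defs.v *)
From HB Require Import structures.
From mathcomp Require Import all_boot all_order all_algebra.
From mathcomp Require Import all_classical all_reals all_analysis.
Set Implicit Arguments.
Unset Strict Implicit.
Unset Printing Implicit Defensive.
Import Order.TTheory GRing.Theory Num.Theory numFieldNormedType.Exports.
Local Open Scope classical_set_scope.
Local Open Scope ring_scope.

(** Processes are functions [f : Omega -> R -> _] (outcome first, then time),
    of interest for nonnegative times only; their values at other times are
    irrelevant. *)

Section matrices.
Context {R : realType}.

Definition frob m n (A : 'M[R]_(m, n)) : R :=
  Num.sqrt (\sum_i \sum_j A i j ^+ 2).

Definition mx_cylinder m n : set (set 'M[R]_(m, n)) :=
  \bigcup_(ij in [set: 'I_m * 'I_n])
    preimage_set_system setT (fun A : 'M[R]_(m, n) => A ij.1 ij.2)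
      (@measurable _ (R)).

End matrices.

(** The product sigma-algebra of the [m * n] copies of the Borel sigma-algebra
    of [R], which is the Borel sigma-algebra of the space of matrices. *)
Definition mxB (R : realType) m n := g_sigma_algebraType (@mx_cylinder R m n).

Section kernels.
Context {R : realType}.
Local Notation mu := (@lebesgue_measure R).

Definition Lpstar (p : nat) (f : R -> R) : Prop :=
  [/\ measurable_fun (`[0, +oo[ : set R) f,
      forall t, 0 <= t -> 0 <= f t &
      exists beta : R,
        (\int[mu]_(t in `[0%R, +oo[)
           (expR (p%:R * beta * t) * f t ^+ p)%:E < +oo)%E].

Definition bracket (p : nat) (f : R -> R) (rho : R) : \bar R :=
  ((\int[mu]_(t in `[0%R, +oo[) (expR (- (p%:R * rho * t)) * f t ^+ p)%:E)
     `^ (p%:R^-1))%E.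

(** [a, b], to be read as [a, +oo[ if [b = +oo]. *)
Definition time_range (a : R) (b : \bar R) : set R :=
  [set s | a <= s /\ (s%:E <= b)%E].

End kernels.

Section conditional_expectation.
Context {R : realType} {disp : measure_display} {Omega : measurableType disp}.
Variable P : probability Omega R.

(** [Y] is a version of [E[X | G]], for [X] integrable. *)
Definition is_condexp (G : set (set Omega)) (X Y : Omega -> R) : Prop :=
  [/\ P.-integrable setT (EFin \o X),
      measurable_fun setT (Y : g_sigma_algebraType G -> R),
      P.-integrable setT (EFin \o Y) &
      forall A, G A ->
        (\int[P]_(w in A) (Y w)%:E = \int[P]_(w in A) (X w)%:E)%E].

Definition mean m (X : Omega -> 'cV[R]_m) : 'cV[R]_m :=
  \col_i fine ('E_P[fun w => X w i ord0])%E.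

End conditional_expectation.

Section brownian.
Context {R : realType} {disp : measure_display} {Omega : measurableType disp}.
Variables (P : probability Omega R) (d : nat) (W : Omega -> R -> 'cV[R]_d).

Definition brownian_events (t : R) : set (set Omega) :=
  [set A | exists u k (B : set (R)),
     [/\ 0 <= u <= t, measurable B & A = [set w | B (W w u k ord0)]]].

(** The increments are compared with [sigma(W(u), u <= s)]; for [A = setT] the
    last clause is the mutual independence of the coordinates. *)
Definition is_brownian : Prop :=
  [/\ forall t, 0 <= t -> measurable_fun setT (W ^~ t : Omega -> mxB R d 1),
      {ae P, forall w, W w 0 = 0},
      {ae P, forall w, {within `[0%R, +oo[, continuous (W w)}},
      forall s t k (B : set (R)), 0 <= s < t -> measurable B ->
        P [set w | B (W w t k ord0 - W w s k ord0)] =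
        normal_prob 0 (Num.sqrt (t - s)) B &
      forall s t A (B : 'I_d -> set (R)), 0 <= s < t ->
        <<s brownian_events s >> A -> (forall k, measurable (B k)) ->
        P (A `&` [set w | forall k, B k (W w t k ord0 - W w s k ord0)]) =
        (P A * \prod_(k < d)
           P [set w | B k (W w t k ord0 - W w s k ord0)%R])%E].

Definition filt (t : R) : set (set Omega) :=
  <<s brownian_events t `|` [set N | P.-negligible N] >>.

Definition filt_oo : set (set Omega) :=
  <<s \bigcup_(t in [set t | 0 <= t]) filt t >>.

Definition adapted (D : set R) m n (f : Omega -> R -> 'M[R]_(m, n)) : Prop :=
  forall t, D t ->
    measurable_fun setT (f ^~ t : g_sigma_algebraType (filt t) -> mxB R m n).

End brownian.

Section ito_integral.
Context {R : realType} {disp : measure_display} {Omega : measurableType disp}.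
Variables (P : probability Omega R) (d : nat) (W : Omega -> R -> 'cV[R]_d).
Local Notation mu := (@lebesgue_measure R).

(** [sum_(j < n) xi_j 1_(]t_j, t_(j+1)])]. *)
Record simple_process := SimpleProcess {
  sp_size : nat;
  sp_time : nat -> R;
  sp_coef : nat -> Omega -> R }.

Definition is_simple (a : R) (b : \bar R) (h : simple_process) : Prop :=
  [/\ a <= sp_time h 0, ((sp_time h (sp_size h))%:E <= b)%E,
      forall j, (j < sp_size h)%N -> sp_time h j <= sp_time h j.+1,
      forall j, (j < sp_size h)%N ->
        measurable_fun setT
          (sp_coef h j : g_sigma_algebraType (filt P W (sp_time h j)) ->
                         R) &
      exists M : R, forall j w, (j < sp_size h)%N -> `|sp_coef h j w| <= M].

Definition sp_val (h : simple_process) (w : Omega) (s : R) : R :=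
  \sum_(j < sp_size h)
    sp_coef h j w * \1_(`]sp_time h j, sp_time h j.+1] : set R) s.

Definition sp_integral (k : 'I_d) (h : simple_process) (w : Omega) : R :=
  \sum_(j < sp_size h)
    sp_coef h j w * (W w (sp_time h j.+1) k ord0 - W w (sp_time h j) k ord0).

(** [I] is a version of [\int_a^b z dW_k]: the L2-limit of the integrals of
    simple processes that converge to [z] in [L2(Omega x [a, b])]. Such
    processes exist whenever [z] is measurable, adapted and square integrable,
    and [I] is then unique up to a null set. *)
Definition is_ito1 (k : 'I_d) (a : R) (b : \bar R) (z : Omega -> R -> R)
    (I : Omega -> R) : Prop :=
  measurable_fun setT (I : Omega -> R) /\
  exists h : nat -> simple_process,
    [/\ forall n, is_simple a b (h n),
        (\int[P]_w \int[mu]_(s in time_range a b)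
           ((sp_val (h n) w s - z w s) ^+ 2)%:E)%E @[n --> \oo] --> 0%E &
        (\int[P]_w ((sp_integral k (h n) w - I w) ^+ 2)%:E)%E
          @[n --> \oo] --> 0%E].

Definition is_ito m (a : R) (b : \bar R) (z : Omega -> R -> 'M[R]_(m, d))
    (I : Omega -> 'cV[R]_m) : Prop :=
  exists2 J : 'I_d -> Omega -> 'cV[R]_m,
    (forall k i, is_ito1 k a b (fun w s => z w s i k) (fun w => J k w i ord0)) &
    forall w, I w = \sum_(k < d) J k w.

End ito_integral.

Section spaces.
Context {R : realType} {disp : measure_display} {Omega : measurableType disp}.
Variables (P : probability Omega R) (d : nat) (W : Omega -> R -> 'cV[R]_d).
Variable m : nat.
Local Notation mu := (@lebesgue_measure R).
Implicit Types (y : Omega -> R -> 'cV[R]_m) (z : Omega -> R -> R -> 'M[R]_(m, d)).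

Definition L2_Foo (beta : R) (f : Omega -> R -> 'cV[R]_m) : Prop :=
  measurable_fun (setT `*` (`[0, +oo[ : set R))
    ((fun x => f x.1 x.2) :
       g_sigma_algebraType (filt_oo P W) * R -> mxB R m 1) /\
  (\int[P]_w \int[mu]_(t in `[0%R, +oo[)
     (expR (2 * beta * t) * frob (f w t) ^+ 2)%:E < +oo)%E.

Definition L2_F (beta : R) (f : Omega -> R -> 'cV[R]_m) : Prop :=
  L2_Foo beta f /\ adapted P W `[0%R, +oo[ f.

Definition scrL2_F (beta : R) (f : Omega -> R -> R -> 'M[R]_(m, d)) : Prop :=
  [/\ measurable_fun (setT `*` ((`[0, +oo[ : set R) `*` (`[0, +oo[ : set R)))
        ((fun x => f x.1 x.2.1 x.2.2) :
           Omega * (R * R) -> mxB R m d),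
      {ae mu, forall t, 0 <= t ->
        adapted P W `[0%R, +oo[ (fun w s => f w t s)} &
      (\int[P]_w \int[mu]_(t in `[0%R, +oo[) ((expR (2 * beta * t))%:E *
         \int[mu]_(s in `[0%R, +oo[) (frob (f w t s) ^+ 2)%:E) < +oo)%E].

(** [y(t) = E[y(t)] + \int_0^t z(t,s) dW(s)] a.s. *)
Definition M_relation y z (t : R) : Prop :=
  exists2 I, is_ito P W 0 t%:E (fun w s => z w t s) I &
    {ae P, forall w, y w t = mean P (y ^~ t) + I w}.

Definition M2_F (beta : R) y z : Prop :=
  [/\ L2_F beta y, scrL2_F beta z &
      {ae mu, forall t, 0 <= t -> M_relation y z t}].

Definition M2_finite (T : R) y z : Prop :=
  [/\ measurable_fun (setT `*` (`[0, T] : set R))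
        ((fun x => y x.1 x.2) : Omega * R -> mxB R m 1) /\
      measurable_fun (setT `*` ((`[0, T] : set R) `*` (`[0, T] : set R)))
        ((fun x => z x.1 x.2.1 x.2.2) :
           Omega * (R * R) -> mxB R m d),
      adapted P W `[0%R, T] y,
      {ae mu, forall t, 0 <= t <= T ->
        adapted P W `[0%R, T] (fun w s => z w t s)},
      (\int[P]_w (\int[mu]_(t in `[0%R, T]) (frob (y w t) ^+ 2)%:E +
         \int[mu]_(t in `[0%R, T]) \int[mu]_(s in `[0%R, T])
           (frob (z w t s) ^+ 2)%:E) < +oo)%E &
      {ae mu, forall t, 0 <= t <= T -> M_relation y z t}].

End spaces.

Section bsvie.
Context {R : realType} {disp : measure_display} {Omega : measurableType disp}.
Variables (P : probability Omega R) (d : nat) (W : Omega -> R -> 'cV[R]_d).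
Variable m : nat.
Local Notation mu := (@lebesgue_measure R).
Variable g :
  Omega -> R -> R -> 'cV[R]_m -> 'M[R]_(m, d) -> 'M[R]_(m, d) -> 'cV[R]_m.

(** In the last two clauses the exceptional null sets do not depend on the
    arguments [y], [z1], [z2]. *)
Definition assumption_B (Ky Kz1 Kz2 : R -> R) : Prop :=
  [/\ measurable_fun
        [set x : (Omega * (R * R)) *
                 (mxB R m 1 * (mxB R m d * mxB R m d)) |
           0 <= x.1.2.1 <= x.1.2.2]
        ((fun x => g x.1.1 x.1.2.1 x.1.2.2 x.2.1 x.2.2.1 x.2.2.2) :
           _ -> mxB R m 1),
      forall t y z1 z2, 0 <= t ->
        adapted P W `[t, +oo[ (fun w s => g w t s y z1 z2),
      [/\ Lpstar 1 Ky, Lpstar 2 Kz1 & Lpstar 2 Kz2],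
      {ae (mu \x mu)%E, forall ts, 0 <= ts.1 <= ts.2 ->
        {ae P, forall w, forall y y' z1 z1' z2 z2',
          frob (g w ts.1 ts.2 y z1 z2 - g w ts.1 ts.2 y' z1' z2') <=
          Ky (ts.2 - ts.1) * frob (y - y') +
          Kz1 (ts.2 - ts.1) * frob (z1 - z1') +
          Kz2 (ts.2 - ts.1) * frob (z2 - z2')}} &
      {ae (mu \x mu)%E, forall ts, 0 <= ts.1 <= ts.2 ->
        {ae P, forall w, g w ts.1 ts.2 0 0 0 = 0}}].

(** The equation with horizon [b] (a time, or [+oo]), for a.e. [t], a.s.; it
    includes that the Lebesgue integral is a genuine one. *)
Definition solves_bsvie (lambda : R) (b : \bar R) (psi : Omega -> R -> 'cV[R]_m)
    (Y : Omega -> R -> 'cV[R]_m) (Z : Omega -> R -> R -> 'M[R]_(m, d)) : Prop :=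
  let f w t s i :=
    expR (- (lambda * (s - t))) * g w t s (Y w s) (Z w t s) (Z w s t) i ord0 in
  {ae mu, forall t, time_range 0 b t ->
    exists2 I, is_ito P W t b (fun w s => Z w t s) I &
      {ae P, forall w,
        (forall i, mu.-integrable (time_range t b) (fun s => (f w t s i)%:E)) /\
        Y w t = psi w t + \col_i (\int[mu]_(s in time_range t b) f w t s i)%R
                - I w}}.

End bsvie.

(* Main.v *)
(** Extended by zero, the solution with horizon [T] solves the infinite horizon
    equation with free term [psi_T], because [g(t, s, 0, 0, 0) = 0]. So the claim
    follows from a stability estimate for the infinite horizon equation, with a
    constant independent of the free terms, and from [psi_T -> psi] in the weighted
    L2 space: this is L2 martingale convergence for a.e. [t], followed by dominated
    convergence in [t].

    Stability. Let [dY], [dZ], [dpsi], [dg] be the differences for two solutions, and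
    [kappa < 1] the (slightly enlarged) sum of the three kernel norms. By the Ito
    isometry on [[t, +oo[],
      [E|dY(t)|^2 + E \int_t^oo |dZ(t,s)|^2 ds = E|dpsi(t) + \int_t^oo dg ds|^2].
    The square is split with the weights [1 - kappa] and [kappa], and the driver is
    estimated by a weighted AM-GM inequality. After integration against
    [e^(2 eta t)] the three kernels contribute at most [kappa] times the left-hand
    side: the contribution of [dZ(s,t)] is controlled because the relation defining
    M-solutions gives [E \int_0^t |dZ(t,s)|^2 ds <= E|dY(t)|^2]. Hence the driver is
    absorbed. *)
Require Import Defs.
From HB Require Import structures.
From mathcomp Require Import all_boot all_order all_algebra.
From mathcomp Require Import all_classical all_reals all_analysis.
From mathcomp Require Import measurable_realfun ring lra.
Set Implicit Arguments.
Unset Strict Implicit.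
Unset Printing Implicit Defensive.
Import Order.TTheory GRing.Theory Num.Theory numFieldNormedType.Exports.
Local Open Scope classical_set_scope.
Local Open Scope ring_scope.

(** * Square integrable functions *)

(** The weight explains the hypothesis on the brackets. Since e^(eta t) e^(-lambda (s-t)) =
    e^(-(eta+lambda)(s-t)) e^(eta s), the differences dY(s) and dZ(s,t), measured with e^(eta s),
    meet their kernels at eta + lambda, whereas dZ(t,s), measured with e^(eta t), meets its kernel
    at lambda. The driver is estimated for fixed t and outcome, before expectations are taken. So
    what holds for a.e. (t,s), a.s., must first be turned into a statement for a.e. t, a.s., for
    a.e. s. Absorption is legitimate only if the left-hand side is finite. Finite weighted energies
    are therefore part of [msol], and must be checked for the extensions by zero, whose square
    integrability is given without weight. The stability constant is 2 (1 - kappa)^-2: one power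
    comes from splitting the square, one from absorption, and the 2 pays for Z below the diagonal.
    Stochastic integrals and conditional expectations are given by characterizing properties, so
    each fact about them is proved for arbitrary versions. Dominated convergence is about sequences;
    the limit over real T is reached by contradiction along a sequence. *)

Section square_integrable.
Context {R : realType} {d : measure_display} {T : measurableType d}.
Variable mu : {measure set T -> \bar R}.
Implicit Types f g h : T -> R.

Definition sqint f : Prop :=
  measurable_fun setT f /\ (\int[mu]_x (f x ^+ 2)%:E < +oo)%E.

(** Real-valued, so that bilinear identities are in reach of [ring] and [lra]. It is meaningful only
    for square integrable arguments, an infinite integral being read as 0; [ipE] leads back to
    extended reals. *)
Definition ip f g : R := \int[mu]_x (f x * g x).

Lemma integrable_EFinD f g : mu.-integrable setT (EFin \o f) ->
  mu.-integrable setT (EFin \o g) ->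
  mu.-integrable setT (EFin \o (fun x => f x + g x)).
Proof. by move=> fi gi; exact: (integrableD measurableT fi gi). Qed.

Lemma sqint_integrable_mul f g : sqint f -> sqint g ->
  mu.-integrable setT (EFin \o (fun x => f x * g x)).
Proof.
move=> [mf f2] [mg g2].
apply: (@le_integrable _ _ _ mu setT measurableT _
  (EFin \o (fun x => f x ^+ 2 + g x ^+ 2))) => [|x _|].
- by apply/measurable_EFinP; exact: measurable_funM.
- rewrite /= lee_fin normrM [leRHS]ger0_norm ?addr_ge0 ?sqr_ge0//.
  rewrite -[in leRHS](real_normK (num_real (f x))).
  rewrite -[in leRHS](real_normK (num_real (g x))).
  have := sqr_ge0 (`|f x| - `|g x|); have := normr_ge0 (f x).
  have := normr_ge0 (g x); nra.
- apply/integrableP; split.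
    by apply/measurable_EFinP; apply: measurable_funD; exact: measurable_funX.
  under eq_integral => x _ do
    rewrite /= ger0_norm ?addr_ge0 ?sqr_ge0// EFinD.
  rewrite ge0_integralD//.
  - exact: lte_add_pinfty.
  - by move=> x _; rewrite lee_fin sqr_ge0.
  - by apply/measurable_EFinP; exact: measurable_funX.
  - by move=> x _; rewrite lee_fin sqr_ge0.
  - by apply/measurable_EFinP; exact: measurable_funX.
Qed.

Lemma integrable_mul_sqint f : measurable_fun setT f ->
  mu.-integrable setT (EFin \o (fun x => f x * f x)) -> sqint f.
Proof.
move=> mf fi; split => //; under eq_integral do rewrite expr2.
exact: (integrable_lty measurableT fi).
Qed.

Lemma sqint_le f g : measurable_fun setT f -> sqint g ->
  (forall x, `|f x| <= `|g x|) -> sqint f.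
Proof.
move=> mf [mg g2] fg; split => //; apply: le_lt_trans g2.
apply: ge0_le_integral => //.
- by move=> x _; rewrite lee_fin sqr_ge0.
- by apply/measurable_EFinP; exact: measurable_funX.
- by apply/measurable_EFinP; exact: measurable_funX.
- move=> x _; rewrite lee_fin -[leLHS](real_normK (num_real _)).
  by rewrite -[leRHS](real_normK (num_real _)) lerXn2r ?nnegrE.
Qed.

Lemma sqint0 : sqint (cst 0).
Proof.
by split => //; under eq_integral do rewrite /= expr0n/=; rewrite integral0 ltry.
Qed.

Lemma sqintZ k f : sqint f -> sqint (fun x => k * f x).
Proof.
move=> sf; have mf := sf.1.
apply: integrable_mul_sqint; first exact: measurable_funM.
have := integrableZl measurableT (k ^+ 2) (sqint_integrable_mul sf sf).
apply: eq_integrable => // x _ /=; rewrite -EFinM; congr EFin; ring.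
Qed.

Lemma sqintD f g : sqint f -> sqint g -> sqint (fun x => f x + g x).
Proof.
move=> sf sg; have [mf mg] := (sf.1, sg.1).
apply: integrable_mul_sqint; first exact: measurable_funD.
have ff := sqint_integrable_mul sf sf; have gg := sqint_integrable_mul sg sg.
have fg := integrableZl measurableT 2 (sqint_integrable_mul sf sg).
apply: eq_integrable (integrableD measurableT (integrableD measurableT ff gg) fg) => //.
by move=> x _ /=; rewrite -EFinM -!EFinD; congr EFin; ring.
Qed.

Lemma sqintN f : sqint f -> sqint (fun x => - f x).
Proof.
by move=> /(sqintZ (-1)); under eq_fun do rewrite mulN1r.
Qed.

Lemma sqintB f g : sqint f -> sqint g -> sqint (fun x => f x - g x).
Proof. by move=> sf /sqintN; exact: sqintD. Qed.

Lemma sqint_sum I (s : seq I) (F : I -> T -> R) : (forall i, sqint (F i)) ->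
  sqint (fun x => \sum_(i <- s) F i x).
Proof.
move=> sF; elim: s => [|i s ih].
  by under eq_fun do rewrite big_nil; exact: sqint0.
by under eq_fun do rewrite big_cons; exact: sqintD.
Qed.

Lemma ipC f g : ip f g = ip g f.
Proof. by apply: eq_Rintegral => x _; rewrite mulrC. Qed.

Lemma ipDl f g h : sqint f -> sqint g -> sqint h ->
  ip (fun x => f x + g x) h = ip f h + ip g h.
Proof.
move=> sf sg sh; rewrite /ip -RintegralD//; last 2 first.
- exact: sqint_integrable_mul.
- exact: sqint_integrable_mul.
by apply: eq_Rintegral => x _; rewrite mulrDl.
Qed.

Lemma ipZl k f g : sqint f -> sqint g -> ip (fun x => k * f x) g = k * ip f g.
Proof.
move=> sf sg; rewrite /ip -RintegralZl//; last exact: sqint_integrable_mul.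
by apply: eq_Rintegral => x _; rewrite mulrA.
Qed.

Lemma ipZr k f g : sqint f -> sqint g -> ip f (fun x => k * g x) = k * ip f g.
Proof. by move=> sf sg; rewrite ipC ipZl// ipC. Qed.

Lemma ipNl f g : sqint f -> sqint g -> ip (fun x => - f x) g = - ip f g.
Proof.
move=> sf sg; rewrite -mulN1r -ipZl//.
by apply: eq_Rintegral => x _; rewrite mulN1r.
Qed.

Lemma ipBl f g h : sqint f -> sqint g -> sqint h ->
  ip (fun x => f x - g x) h = ip f h - ip g h.
Proof. by move=> sf sg sh; rewrite ipDl ?ipNl//; exact: sqintN. Qed.

Lemma ipDr f g h : sqint f -> sqint g -> sqint h ->
  ip h (fun x => f x + g x) = ip h f + ip h g.
Proof. by move=> *; rewrite ipC ipDl// !(ipC h). Qed.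

Lemma ipBr f g h : sqint f -> sqint g -> sqint h ->
  ip h (fun x => f x - g x) = ip h f - ip h g.
Proof. by move=> *; rewrite ipC ipBl// !(ipC h). Qed.

Lemma Rintegral_eq0 f : (forall x, f x = 0) -> \int[mu]_x f x = 0.
Proof.
by move=> f0; rewrite /Rintegral integral0_eq// => x _; rewrite f0.
Qed.

Lemma ipBB f g f' g' : sqint f -> sqint g -> sqint f' -> sqint g' ->
  ip (fun x => f x - g x) (fun x => f' x - g' x) =
  ip f f' - ip f g' - ip g f' + ip g g'.
Proof.
move=> sf sg sf' sg'; rewrite ipBl ?(ipBr _ _ (h := f)) ?(ipBr _ _ (h := g))//.
  ring.
exact: sqintB.
Qed.

Lemma ip0l f : ip (cst 0) f = 0.
Proof. by apply: Rintegral_eq0 => x; rewrite mul0r. Qed.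

Lemma ip_suml I (s : seq I) (F : I -> T -> R) h : (forall i, sqint (F i)) ->
  sqint h -> ip (fun x => \sum_(i <- s) F i x) h = \sum_(i <- s) ip (F i) h.
Proof.
move=> sF sh; elim: s => [|i s ih].
  by rewrite big_nil; under eq_fun do rewrite big_nil; exact: ip0l.
rewrite big_cons -ih; under eq_fun do rewrite big_cons.
by rewrite ipDl//; exact: sqint_sum.
Qed.

Lemma ip_sumr I (s : seq I) (F : I -> T -> R) h : (forall i, sqint (F i)) ->
  sqint h -> ip h (fun x => \sum_(i <- s) F i x) = \sum_(i <- s) ip h (F i).
Proof.
by move=> sF sh; rewrite ipC ip_suml//; apply: eq_bigr => i _; rewrite ipC.
Qed.

Lemma ip_ge0 f : 0 <= ip f f.
Proof. by apply: Rintegral_ge0 => x _; rewrite -expr2 sqr_ge0. Qed.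

Lemma ipE f : sqint f -> (ip f f)%:E = (\int[mu]_x (f x ^+ 2)%:E)%E.
Proof.
move=> sf; rewrite /ip /Rintegral fineK; last first.
  exact: integrable_fin_num (sqint_integrable_mul sf sf).
by apply: eq_integral => x _; rewrite expr2.
Qed.

(* The discriminant of the nonnegative quadratic [t |-> ip (f + t g) (f + t g)]. *)
Lemma ip_CauchySchwarz f g : sqint f -> sqint g ->
  ip f g ^+ 2 <= ip f f * ip g g.
Proof.
move=> sf sg.
have q t : 0 <= ip f f + 2 * t * ip f g + t ^+ 2 * ip g g.
  have := ip_ge0 (fun x => f x + t * g x).
  have sh := sqintZ t sg; have sfh := sqintD sf sh.
  rewrite ipDl// !ipDr// !(ipZr, ipZl)// (ipC g f); nra.
have := ip_ge0 g; rewrite le_eqVlt => /predU1P[/esym g0|g0].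
  rewrite g0 mulr0; have [->|fg0] := eqVneq (ip f g) 0; first by rewrite expr0n.
  (* With [ip g g = 0] the quadratic is affine; if its slope were nonzero, it would take the value
     -1 here. *)
  have := q (- (ip f f + 1) / (2 * ip f g)); rewrite g0 mulr0 addr0.
  rewrite [2 * _]mulrC -mulrA -mulrA (mulrC _ (2 * _)) -/(_ / _).
  by rewrite divff ?mulf_neq0//; lra.
have := q (- ip f g / ip g g).
have -> : ip f f + 2 * (- ip f g / ip g g) * ip f g +
    (- ip f g / ip g g) ^+ 2 * ip g g = ip f f - ip f g ^+ 2 / ip g g.
  by field; exact: lt0r_neq0.
by rewrite subr_ge0 ler_pdivrMr.
Qed.

(** Expanding around the limits leaves three terms that contain a vanishing factor, which
    Cauchy-Schwarz controls. This carries the Ito isometry from simple processes to general ones. *)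
Lemma ip_cvg f g (f_ g_ : nat -> T -> R) : sqint f -> sqint g ->
  (forall n, sqint (f_ n)) -> (forall n, sqint (g_ n)) ->
  ip (fun x => f_ n x - f x) (fun x => f_ n x - f x) @[n --> \oo] --> 0 ->
  ip (fun x => g_ n x - g x) (fun x => g_ n x - g x) @[n --> \oo] --> 0 ->
  ip (f_ n) (g_ n) @[n --> \oo] --> ip f g.
Proof.
move=> sf sg sf_ sg_ cf cg.
have E n : ip (f_ n) (g_ n) =
    ip (fun x => f_ n x - f x) (fun x => g_ n x - g x) +
    ip (fun x => f_ n x - f x) g + ip (fun x => g_ n x - g x) f + ip f g.
  have ? := sqintB (sf_ n) sf; have ? := sqintB (sg_ n) sg.
  rewrite ipBl// !ipBr// ipBl// ipBl// (ipC (g_ n)) (ipC g f); ring.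
(* Only the product of the limits of the squared norms must vanish, so one of the two sequences may
   be constant. *)
have lim0 (a b : nat -> T -> R) (l l' : R) : (forall n, sqint (a n)) ->
    (forall n, sqint (b n)) ->
    ip (a n) (a n) @[n --> \oo] --> l -> ip (b n) (b n) @[n --> \oo] --> l' ->
    l * l' = 0 -> ip (a n) (b n) @[n --> \oo] --> 0.
  move=> sa sb ca cb l0; apply/norm_cvg0P.
  apply: (@squeeze_cvgr _ _ _ _ (cst 0)
    (fun n => Num.sqrt (ip (a n) (a n) * ip (b n) (b n)))).
  - near=> n; rewrite /= normr_ge0/= -sqrtr_sqr ler_sqrt ?mulr_ge0 ?ip_ge0//.
    exact: ip_CauchySchwarz.
  - exact: cvg_cst.
  - rewrite -(sqrtr0 R) -l0; apply: continuous_cvg; first exact: sqrt_continuous.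
    exact: cvgM.
have fB n := sqintB (sf_ n) sf; have gB n := sqintB (sg_ n) sg.
rewrite (funext E).
suff : ip (fun x => f_ n x - f x) (fun x => g_ n x - g x) +
    ip (fun x => f_ n x - f x) g + ip (fun x => g_ n x - g x) f + ip f g
    @[n --> \oo] --> 0 + 0 + 0 + ip f g by rewrite !add0r.
apply: cvgD; last exact: cvg_cst.
apply: cvgD; last first.
  by apply: lim0 (fun=> sf) cg (cvg_cst _) _; rewrite ?mul0r.
apply: cvgD; first by apply: lim0 cf cg _; rewrite ?mul0r.
by apply: lim0 (fun=> sg) cf (cvg_cst _) _; rewrite ?mul0r.
Unshelve. all: by end_near. Qed.

Lemma sqint_lim f (f_ : nat -> T -> R) : measurable_fun setT f ->
  (forall n, sqint (f_ n)) ->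
  (\int[mu]_x ((f_ n x - f x) ^+ 2)%:E)%E @[n --> \oo] --> 0%E ->
  sqint f /\
  ip (fun x => f_ n x - f x) (fun x => f_ n x - f x) @[n --> \oo] --> 0.
Proof.
move=> mf sf_ c.
have sf : sqint f.
  (* Convergence to 0 makes the integral finite from some [N] on, and f = f_N - (f_N - f). *)
  move/fine_cvgP : c => [[N _ /(_ N (leqnn N))/= HN] _].
  have sB : sqint (fun x => f_ N x - f x).
    split; first by apply: measurable_funB => //; exact: (sf_ N).1.
    by move: HN; rewrite fin_numElt => /andP[].
  have := sqintB (sf_ N) sB; under eq_fun do rewrite subKr.
  exact.
split => //; apply: cvg_trans (fine_cvg c); apply: near_eq_cvg.
near=> n; rewrite /= -ipE//; exact: sqintB.
Unshelve. all: by end_near. Qed.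

Lemma sqint_dominated f g (f_ : nat -> T -> R) : measurable_fun setT f ->
  (forall n, measurable_fun setT (f_ n)) ->
  (forall x, f_ n x @[n --> \oo] --> f x) ->
  sqint g -> (forall n x, `|f_ n x - f x| <= `|g x|) ->
  (\int[mu]_x ((f_ n x - f x) ^+ 2)%:E)%E @[n --> \oo] --> 0%E.
Proof.
move=> mf mf_ cf sg le_g.
have := @dominated_convergence _ _ _ mu setT measurableT
  (fun n x => ((f_ n x - f x) ^+ 2)%:E) (cst 0%E) (fun x => (g x * g x)%:E).
rewrite integral0 => -[] //.
- move=> n; apply/measurable_EFinP/measurable_funX; exact: measurable_funB.
- apply: aeW => x _; apply/cvg_EFin; first by near=> n.
  suff : (f_ n x - f x) ^+ 2 @[n --> \oo] --> (f x - f x) ^+ 2.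
    by rewrite subrr expr0n.
  apply: (@cvg_comp _ _ _ (fun n => f_ n x - f x) (fun y => y ^+ 2)).
    by apply: cvgB => //; exact: cvg_cst.
  exact: exprn_continuous.
- exact: sqint_integrable_mul.
- apply: aeW => x n _ /=; rewrite lee_fin ger0_norm ?sqr_ge0//.
  rewrite -expr2 -[leLHS](real_normK (num_real _)).
  by rewrite -[leRHS](real_normK (num_real _)) lerXn2r ?nnegrE.
Unshelve. all: by end_near. Qed.

End square_integrable.

(** * Moments of the normal distribution *)

Lemma measurable_set_le {R : realType} d (T : measurableType d) (f g : T -> R) :
  measurable_fun setT f -> measurable_fun setT g ->
  measurable [set x | f x <= g x].
Proof.
move=> mf mg; rewrite (_ : mkset _ = (fun x => g x - f x) @^-1` `[0, +oo[).
  by rewrite -[X in measurable X]setTI; apply: (measurable_funB mg mf).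
by apply/seteqP; split => x /=; rewrite in_itv/= andbT subr_ge0.
Qed.

Lemma ge0_integralT_opp {R : realType} (f : R -> \bar R) :
  measurable_fun setT f -> (forall x, 0 <= f x)%E ->
  (\int[lebesgue_measure]_x f (- x)%R = \int[lebesgue_measure]_x f x)%E.
Proof.
move=> mf f0.
have mopp : measurable_fun setT (-%R : measurableTypeR R -> measurableTypeR R).
  exact: oppr_measurable.
transitivity
  (\int[pushforward lebesgue_measure (-%R : _ -> measurableTypeR R)]_x f x)%E.
  by rewrite ge0_integral_pushforward.
by apply: eq_measure_integral => A mA _; exact: lebesgue_measureN.
Qed.

Section normal_moments.
Context {R : realType}.
Variable s : R.
Hypothesis s0 : 0 < s.
Local Notation mu := (@lebesgue_measure R).
Local Notation p := (normal_pdf 0 s).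
Let s_neq0 : s != 0. Proof. by rewrite gt_eqF. Qed.

Let pE x : p x = normal_peak s * expR (- x ^+ 2 / (s ^+ 2 *+ 2)).
Proof. by rewrite normal_pdfE// /normal_fun subr0. Qed.

Let c := s ^+ 2 *+ 2.
Let c0 : 0 < c. Proof. by rewrite /c pmulrn_lgt0// exprn_gt0. Qed.

(** The Radon-Nikodym derivative of [normal_prob] is a.e. the explicit density, since both have the
    same integral over every measurable set. *)
Lemma ge0_integral_normal_prob (f : R -> \bar R) : measurable_fun setT f ->
  (forall x, 0 <= f x)%E ->
  (\int[normal_prob 0 s]_x f x = \int[mu]_x (f x * (p x)%:E))%E.
Proof.
move=> mf f0; have dom := normal_prob_dominates 0 s.
rewrite -(Radon_Nikodym_SigmaFinite.change_of_variables dom)//.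
apply: ae_eq_integral => //.
- apply: emeasurable_funM => //.
  exact: measurable_int (Radon_Nikodym_SigmaFinite.f_integrable dom).
- apply: emeasurable_funM => //; apply/measurable_EFinP.
  exact: measurable_normal_pdf.
- apply: ae_eqe_mul2l; apply: integral_ae_eq => //.
  + exact: Radon_Nikodym_SigmaFinite.f_integrable.
  + by apply/measurable_EFinP; exact: measurable_normal_pdf.
  + by move=> E _ mE; rewrite -Radon_Nikodym_SigmaFinite.f_integral.
Qed.

Let is_derive_p (x : R) : is_derive x 1 p (- (x / s ^+ 2) * p x).
Proof.
have -> : p = (fun x => normal_peak s * expR (- x ^+ 2 / c)).
  by apply/funext => y; rewrite pE.
apply: is_derive_eq; rewrite -!/(GRing.scale _ _) /GRing.scale/= /c.
by field.
Qed.

Let p_cvg0 : p x @[x --> +oo] --> (0 : R).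
Proof.
have -> : p = (fun x => normal_peak s * gauss_fun ((Num.sqrt c)^-1 * x)).
  apply/funext => y; rewrite pE /gauss_fun exprMn exprVn sqr_sqrtr ?ltW//.
  by rewrite mulNr (mulrC c^-1).
rewrite -[X in _ --> X](mulr0 (normal_peak s)).
apply: cvgM; first exact: cvg_cst.
apply: (cvg_comp (fun x => (Num.sqrt c)^-1 * x) (@gauss_fun R)); last first.
  exact: cvg_gauss_fun.
by apply: gt0_cvgMry; [rewrite invr_gt0 sqrtr_gt0|exact: cvg_id].
Qed.

(** From p' = - (x / s^2) p, a primitive of x p is - s^2 p, which vanishes at infinity. *)
Lemma integral_normal_tail u : 0 <= u ->
  (\int[mu]_(x in `[u, +oo[) (x * p x)%:E = (s ^+ 2 * p u)%:E)%E.
Proof.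
move=> u0.
have dF (x : R) : is_derive x 1 (fun x => - (s ^+ 2 * p x)) (x * p x).
  apply: (is_derive_eq (is_deriveN (is_deriveZ (s ^+ 2) (is_derive_p x)))).
  by rewrite /GRing.scale/=; field.
have cp := @continuous_normal_pdf R 0 s s_neq0.
rewrite (@ge0_continuous_FTC2y _ _ (fun x => - (s ^+ 2 * p x)) u 0).
- by rewrite sub0e -EFinN opprK.
- by move=> x ux; rewrite mulr_ge0 ?normal_pdf_ge0// (le_trans u0).
- apply: continuous_subspaceT => x; apply: continuousM => //; exact: cp.
- suff : - (s ^+ 2 * p x) @[x --> +oo] --> - (s ^+ 2 * 0 : R).
    by rewrite mulr0 oppr0.
  by apply: cvgN; apply: cvgM => //; exact: cvg_cst.
- by move=> x _; case: (dF x).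
- apply: cvg_at_right_filter; apply: cvgN; apply: cvgM; last exact: cp.
  exact: cvg_cst.
- by move=> x _; rewrite derive1E; case: (dF x).
Qed.

(* Tonelli, with [x = \int_0^x du]. *)
Let second_moment_half :
  (\int[mu]_(x in `[0%R, +oo[) (x ^+ 2 * p x)%:E =
   \int[mu]_(u in `[0%R, +oo[) (s ^+ 2 * p u)%:E)%E.
Proof.
pose A := [set x : R * R | 0 <= x.2] `&` [set x : R * R | x.2 <= x.1].
have mA : measurable A.
  by apply: measurableI; apply: measurable_set_le.
pose h (x : R * R) := (x.1 * p x.1 * \1_A x)%:E.
have mp := @measurable_normal_pdf R 0 s.
have mh : measurable_fun setT h.
  apply/measurable_EFinP; apply: measurable_funM => //.
  apply: measurable_funM => //; apply: measurableT_comp => //.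
have h0 x : (0 <= h x)%E.
  rewrite lee_fin /h indicE; case: (boolP (x \in A)) => [|_].
    rewrite inE => -[/= ? ?]; rewrite mulr1 mulr_ge0 ?normal_pdf_ge0//.
    exact: le_trans _ (_ : x.2 <= _).
  by rewrite mulr0.
have := @fubini_tonelli _ _ _ _ _ mu mu h mh h0.
have -> : (\int[mu]_x fubini_F mu h x =
    \int[mu]_(x in `[0%R, +oo[) (x ^+ 2 * p x)%:E)%E.
  rewrite [RHS]integral_mkcond; apply: eq_integral => x _.
  rewrite /fubini_F patchE; have [x0|x0] := leP 0 x.
    rewrite mem_set/= ?in_itv/= ?x0//.
    transitivity (\int[mu]_y ((x * p x)%:E * (\1_`[0, x] y)%:E))%E.
      apply: eq_integral => y _; rewrite /h -EFinM; congr (_ * _)%:E.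
      rewrite !indicE; congr (nat_of_bool _)%:R.
      apply/idP/idP => /set_mem/=.
        by move=> [/= y0 yx]; apply/mem_set; rewrite /= in_itv/= y0.
      by rewrite in_itv/= => /andP[y0 yx]; apply/mem_set.
    rewrite ge0_integralZl//; last 2 first.
    - by apply/measurable_EFinP.
    - by rewrite lee_fin mulr_ge0 ?normal_pdf_ge0.
    rewrite integral_indic//= setIT lebesgue_measure_itv/= lte_fin.
    case: ltgtP x0 => // [x0 _|<- _]; last by rewrite mule0 expr0n mul0r.
    by rewrite oppr0 adde0 -EFinM; congr EFin; ring.
  rewrite memNset/= ?in_itv/= ?leNgt ?x0//.
  apply: integral0_eq => y _; rewrite /h indicE memNset ?mulr0//.
  by move=> [/= y0 yx]; move: x0; rewrite ltNge (le_trans y0 yx).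
have -> : (\int[mu]_x fubini_G mu h x =
    \int[mu]_(u in `[0%R, +oo[) (s ^+ 2 * p u)%:E)%E => //.
rewrite [RHS]integral_mkcond; apply: eq_integral => u _.
rewrite /fubini_G patchE; have [u0|u0] := leP 0 u.
  rewrite mem_set/= ?in_itv/= ?u0//.
  rewrite -integral_normal_tail// [RHS]integral_mkcond.
  apply: eq_integral => x _; rewrite /h patchE indicE.
  have [ux|ux] := leP u x.
    by rewrite !mem_set/= ?in_itv/= ?ux ?mulr1.
  rewrite !memNset/= ?in_itv/= ?leNgt ?ux ?mulr0// => -[/= _].
  by rewrite leNgt ux.
rewrite memNset/= ?in_itv/= ?leNgt ?u0//.
by apply: integral0_eq => x _; rewrite /h indicE memNset ?mulr0// => -[/=]; rewrite leNgt u0.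
Qed.

Let symmetric_half (k : R -> R) : continuous k -> (forall x, 0 <= k x) ->
  (forall x, k (- x) = k x) -> (\int[mu]_x (k x * p x)%:E =
  2%:E * \int[mu]_(x in `[0%R, +oo[) (k x * p x)%:E)%E.
Proof.
move=> ck k0 kN; rewrite set_itvcy; apply: ge0_symfun_integralT.
- by move=> x; rewrite mulr_ge0 ?normal_pdf_ge0.
- by move=> x; apply: continuousM; [exact: ck|exact: continuous_normal_pdf].
- by move=> x /=; rewrite kN !pE sqrrN.
Qed.

Lemma normal_second_moment :
  (\int[normal_prob 0 s]_x (x ^+ 2)%:E = (s ^+ 2)%:E)%E.
Proof.
rewrite ge0_integral_normal_prob; last 2 first.
- by apply/measurable_EFinP; exact: measurable_funX.
- by move=> x; rewrite lee_fin sqr_ge0.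
rewrite (@symmetric_half (fun x => x ^+ 2)).
(* On the half line x^2 p and s^2 p have the same integral; read backwards, symmetry then gives s^2
   times the total mass 1. *)
- rewrite second_moment_half -(@symmetric_half (cst (s ^+ 2))).
  + under eq_integral do rewrite /= EFinM.
    rewrite ge0_integralZl//.
    * by rewrite integral_normal_pdf mule1.
    * by apply/measurable_EFinP; exact: measurable_normal_pdf.
    * by move=> x _; rewrite lee_fin normal_pdf_ge0.
    * by rewrite lee_fin sqr_ge0.
  + by move=> x; exact: cvg_cst.
  + by move=> x; rewrite sqr_ge0.
  + by [].
- exact: exprn_continuous.
- by move=> x; rewrite sqr_ge0.
- by move=> x; rewrite sqrrN.
Qed.

Let pushforward_normal d (T : measurableType d) (P : {measure set T -> \bar R})
    (X : T -> R) : measurable_fun setT X ->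
  (forall B, measurable B -> P (X @^-1` B) = normal_prob 0 s B) ->
  forall f : R -> \bar R, measurable_fun setT f -> (forall x, 0 <= f x)%E ->
  (\int[P]_w f (X w) = \int[normal_prob 0 s]_x f x)%E.
Proof.
move=> mX XE f mf f0.
have mX' : measurable_fun setT (X : T -> measurableTypeR R) := mX.
transitivity (\int[pushforward P (X : T -> measurableTypeR R)]_x f x)%E.
  by rewrite (ge0_integral_pushforward mX') ?preimage_setT//.
by apply: eq_measure_integral => A mA _; exact: XE.
Qed.

Lemma normal_moments d (T : measurableType d) (P : {measure set T -> \bar R})
    (X : T -> R) : measurable_fun setT X ->
  (forall B, measurable B -> P (X @^-1` B) = normal_prob 0 s B) ->
  [/\ sqint P X, ip P X X = s ^+ 2, P.-integrable setT (EFin \o X) &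
      \int[P]_w X w = 0].
Proof.
move=> mX XE; have pf := pushforward_normal mX XE.
have X2 : (\int[P]_w (X w ^+ 2)%:E = (s ^+ 2)%:E)%E.
  rewrite -normal_second_moment -(pf (fun x => (x ^+ 2)%:E))//.
    by apply/measurable_EFinP; exact: measurable_funX.
  by move=> x; rewrite lee_fin sqr_ge0.
have sX : sqint P X by split => //; rewrite X2 ltry.
have P1 : P setT = 1%E.
  by rewrite -[in LHS](preimage_setT X) XE// /normal_prob integral_normal_pdf.
have iX : P.-integrable setT (EFin \o X).
  have s1 : sqint P (cst 1).
    split => //; under eq_integral do rewrite /= expr1n.
    by rewrite integral_cst// P1 mul1e ltry.
  have := sqint_integrable_mul sX s1.
  by apply: eq_integrable => // x _; rewrite /= mulr1.
split => //; first by apply: EFin_inj; rewrite ipE.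
pose f (x : R) : \bar R := (Num.max x 0)%:E.
have mf : measurable_fun setT f.
  by apply/measurable_EFinP; exact: measurable_maxr.
have f0 x : (0 <= f x)%E by rewrite lee_fin le_max lexx orbT.
have mfN : measurable_fun setT (fun x : R => f (- x)%R).
  by apply: (measurableT_comp mf); exact: oppr_measurable.
(* The mean vanishes because the density is even: positive and negative parts have equal
   integrals. *)
have iN : (\int[normal_prob 0 s]_x f (- x)%R = \int[normal_prob 0 s]_x f x)%E.
  rewrite !ge0_integral_normal_prob//.
  rewrite -[RHS](@ge0_integralT_opp _ (fun x => f x * (p x)%:E)%E).
  - by apply: eq_integral => x _; rewrite !pE sqrrN.
  - apply: emeasurable_funM => //; apply/measurable_EFinP.
    exact: measurable_normal_pdf.
  - by move=> x; rewrite mule_ge0// lee_fin normal_pdf_ge0.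
rewrite /Rintegral integralE.
have -> : (\int[P]_w (EFin \o X)^\- w = \int[P]_w (EFin \o X)^\+ w)%E.
  transitivity (\int[P]_w f (- X w)%R)%E.
    by apply: eq_integral => w _; rewrite funenegE /f EFin_max.
  rewrite (pf (fun x => f (- x)%R))//.
  by rewrite iN -pf//; apply: eq_integral => w _; rewrite funeposE /f EFin_max.
rewrite subee//; exact: integrable_pos_fin_num iX.
Qed.

End normal_moments.

(** * Random matrices and independence *)

Section matrix_measurability.
Context {R : realType} {d : measure_display} {T : measurableType d}.

Lemma measurable_mxBP m n (D : set T) (f : T -> mxB R m n) : measurable D ->
  measurable_fun D f <-> forall i j, measurable_fun D (fun x => f x i j).
Proof.
move=> mD; split=> [mf i j|mf].
  move=> _ B mB; apply: (mf mD [set A : mxB R m n | B (A i j)]).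
  apply: sub_sigma_algebra; exists (i, j) => //=.
  by exists B => //; rewrite setTI.
apply: (@measurability _ _ T (mxB R m n) D f (@mx_cylinder R m n)) => //.
move=> _ [_ [[i j] _ [B mB <-]] <-]; rewrite setTI.
exact: mf.
Qed.

Lemma measurable_frob m n (D : set T) (f : T -> mxB R m n) : measurable D ->
  measurable_fun D f -> measurable_fun D (fun x => frob (f x)).
Proof.
move=> mD /(measurable_mxBP _ mD) mf.
apply: (@measurableT_comp _ _ _ _ _ _ (@Num.sqrt R)).
  exact: continuous_measurable_fun (@sqrt_continuous R).
apply: measurable_sum => i; apply: measurable_sum => j.
exact: measurable_funX.
Qed.

End matrix_measurability.

Section product_of_integrals.
Context {R : realType} d1 d2 (T1 : measurableType d1) (T2 : measurableType d2).
Variables (m1 : {sigma_finite_measure set T1 -> \bar R})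
  (m2 : {sigma_finite_measure set T2 -> \bar R}) (f : T1 -> R) (g : T2 -> R).
Hypotheses (fi : m1.-integrable setT (EFin \o f))
  (gi : m2.-integrable setT (EFin \o g)).

Let fg (z : T1 * T2) : \bar R := (f z.1 * g z.2)%:E.

Lemma integrable_prod_mul : (m1 \x m2)%E.-integrable setT fg.
Proof.
have /measurable_EFinP mf := measurable_int _ fi.
have /measurable_EFinP mg := measurable_int _ gi.
have mfg : measurable_fun setT fg.
  apply/measurable_EFinP; apply: measurable_funM.
    exact: measurableT_comp mf measurable_fst.
  exact: measurableT_comp mg measurable_snd.
have /integrableP[_ fi1] := fi; have /integrableP[_ gi1] := gi.
apply/integrable12ltyP => //.
rewrite (eq_integral (fun x => `|(f x)%:E| * \int[m2]_y `|(g y)%:E|)%E).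
  rewrite ge0_integralZr//.
  - rewrite lte_mul_pinfty//; first exact: integral_ge0.
    by rewrite ge0_fin_numE// integral_ge0.
  - by apply: measurableT_comp => //; exact/measurable_EFinP.
  - exact: integral_ge0.
move=> x _; rewrite -ge0_integralZl//.
- by apply: eq_integral => y _; rewrite /fg EFinM abseM.
- by apply: measurableT_comp => //; exact/measurable_EFinP.
Qed.

Lemma Rintegral_prod_mul :
  \int[(m1 \x m2)%E]_z (f z.1 * g z.2) = \int[m1]_x f x * \int[m2]_y g y.
Proof.
rewrite [LHS]/Rintegral -(integral12_prod_meas1 integrable_prod_mul).
rewrite (eq_integral (fun x => (f x)%:E * (\int[m2]_y g y)%:E)%E).
  rewrite integralZr// fineM//; exact: integrable_fin_num.
move=> x _; rewrite /Rintegral fineK; last exact: integrable_fin_num.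
by rewrite -integralZl.
Qed.

End product_of_integrals.

Section independence.
Context {R : realType} {d : measure_display} {T : measurableType d}.
Variable P : probability T R.

Definition indep (X Y : T -> R) : Prop := forall A B : set R,
  measurable A -> measurable B ->
  P (X @^-1` A `&` Y @^-1` B) = (P (X @^-1` A) * P (Y @^-1` B))%E.

(** Rectangles form an intersection-stable generator of the product sigma-algebra, and the finite
    total mass lets the constant sequence [setT] serve as exhaustion. *)
Lemma measure_rectangle_unique d1 d2 (T1 : measurableType d1)
    (T2 : measurableType d2) (m1 m2 : {measure set (T1 * T2) -> \bar R}) :
  (m1 setT < +oo)%E ->
  (forall A B, measurable A -> measurable B ->
    m1 (A `*` B) = m2 (A `*` B)) ->
  forall C, measurable C -> m1 C = m2 C.
Proof.
move=> m1oo m12 C mC.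
apply: (@measure_unique _ R _
  [set A `*` B | A in @measurable _ T1 & B in @measurable _ T2]
  (fun=> setT)) => //.
- exact: measurable_prod_measurableType.
- move=> _ _ [A mA [B mB <-]] [A' mA' [B' mB' <-]].
  exists (A `&` A'); first exact: measurableI.
  by exists (B `&` B'); [exact: measurableI|rewrite setXI].
- by move=> _; exists setT => //; exists setT => //; rewrite setXTT.
- by rewrite bigcup_const//; exists 0%N.
- by move=> _ [A mA [B mB <-]]; exact: m12.
Qed.

Section independent_rv.
Variables X Y : {RV P >-> R}.
Hypothesis XY : indep X Y.
Local Notation J := (pushforward P (fun w => (X w, Y w))).
Let mJ : measurable_fun setT (fun w => (X w, Y w)).
Proof. exact: measurable_fun_pair. Qed.

(** Independence is exactly agreement of the joint law with the product of the laws on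
    rectangles. *)
Let JE C : measurable C -> J C = (distribution P X \x distribution P Y)%E C.
Proof.
apply: measure_rectangle_unique.
  by rewrite [ltLHS](_ : _ = P setT)// probability_setT ltry.
move=> A B mA mB; rewrite /= product_measure1E//.
by rewrite [LHS](_ : _ = P (X @^-1` A `&` Y @^-1` B))// XY.
Qed.

Let distribution_integrable (Z : {RV P >-> R}) :
  P.-integrable setT (EFin \o Z) ->
  (distribution P Z).-integrable setT (EFin \o @idfun R).
Proof.
move=> /integrableP[_ iZ].
have mid : measurable_fun setT (EFin \o @idfun R) by apply/measurable_EFinP; exact: measurable_id.
apply/integrableP; split => //.
rewrite (ge0_integral_distribution Z (f := fun x => `|(EFin \o @idfun R) x|%E))//.
by apply: measurableT_comp.
Qed.

Hypotheses (iX : P.-integrable setT (EFin \o X))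
           (iY : P.-integrable setT (EFin \o Y)).

Let iJ := integrable_prod_mul (distribution_integrable iX) (distribution_integrable iY).

Lemma indep_integrable_RV :
  P.-integrable setT (EFin \o (fun w => X w * Y w)).
Proof.
have /integrableP[mxy xyi] := iJ; apply/integrableP; split.
  by apply/measurable_EFinP; exact: measurable_funM.
rewrite [ltLHS](_ : _ = \int[J]_z `|(z.1 * z.2)%:E|)%E.
  rewrite (@eq_measure_integral _ _ _ _ (distribution P X \x distribution P Y)%E)//.
  by move=> A mA _; exact: JE.
rewrite ge0_integral_pushforward//; exact: measurableT_comp.
Qed.

Lemma indep_Rintegral_RV : \int[P]_w (X w * Y w) = \int[P]_w X w * \int[P]_w Y w.
Proof.
have E (Z : {RV P >-> R}) : P.-integrable setT (EFin \o Z) ->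
    \int[distribution P Z]_x x = \int[P]_w Z w.
  by move=> iZ; rewrite /Rintegral integral_distribution.
rewrite -!E// -Rintegral_prod_mul; [|exact: distribution_integrable..].
rewrite [LHS](_ : _ = \int[J]_z (z.1 * z.2)).
  congr fine; apply: eq_measure_integral => A mA _; exact: JE.
rewrite /Rintegral integral_pushforward//; last exact: indep_integrable_RV.
exact: measurable_int iJ.
Qed.

End independent_rv.

Lemma indep_integrable (X Y : T -> R) : indep X Y ->
  P.-integrable setT (EFin \o X) -> P.-integrable setT (EFin \o Y) ->
  P.-integrable setT (EFin \o (fun w => X w * Y w)).
Proof.
move=> XY iX iY.
have /measurable_EFinP mX := measurable_int _ iX.
have /measurable_EFinP mY := measurable_int _ iY.
exact: (@indep_integrable_RV (mfun_Sub (mem_set mX)) (mfun_Sub (mem_set mY))).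
Qed.

Lemma indep_Rintegral (X Y : T -> R) : indep X Y ->
  P.-integrable setT (EFin \o X) -> P.-integrable setT (EFin \o Y) ->
  \int[P]_w (X w * Y w) = \int[P]_w X w * \int[P]_w Y w.
Proof.
move=> XY iX iY.
have /measurable_EFinP mX := measurable_int _ iX.
have /measurable_EFinP mY := measurable_int _ iY.
exact: (@indep_Rintegral_RV (mfun_Sub (mem_set mX)) (mfun_Sub (mem_set mY))).
Qed.

(** Used with [X] a coefficient and [Y], [Z] increments of two different coordinates: the product of
    the first two is a function of the pair, and the pair is independent of [Z]. *)
Lemma indep_mul (X Y Z : T -> R) : measurable_fun setT X ->
  measurable_fun setT Y -> measurable_fun setT Z ->
  (forall A B C, measurable A -> measurable B -> measurable C ->
    P (X @^-1` A `&` Y @^-1` B `&` Z @^-1` C) =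
    (P (X @^-1` A `&` Y @^-1` B) * P (Z @^-1` C))%E) ->
  indep (fun w => X w * Y w) Z.
Proof.
move=> mX mY mZ XYZ A C mA mC.
have mZC : measurable (Z @^-1` C) by rewrite -[X in measurable X]setTI; exact: mZ.
have mXY : measurable_fun setT (fun w => (X w, Y w)) by exact: measurable_fun_pair.
have PC : P (Z @^-1` C) \is a fin_num by exact: fin_num_measure.
pose c := NngNum (fine_ge0 (measure_ge0 P (Z @^-1` C))).
have cE : c%:num%:E = P (Z @^-1` C) by rewrite /= fineK.
have mM : measurable [set z : R * R | A (z.1 * z.2)].
  rewrite -[X in measurable X]setTI.
  by apply: (measurable_funM measurable_fst measurable_snd).
(* Two finite measures on the plane are compared: the law of the pair restricted to the event that
   [Z] lies in [C], and the full law of the pair multiplied by the probability of that event. *)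
have := @measure_rectangle_unique _ _ _ _
  (pushforward (mrestr P mZC) (fun w => (X w, Y w)))
  (mscale c (pushforward P (fun w => (X w, Y w)))) _ _ _ mM.
rewrite /pushforward/= /mrestr /mscale/= fineK// [in X in _ -> X]muleC; apply.
- by [].
- by [].
- rewrite [ltLHS](_ : _ = P (setT `&` Z @^-1` C))// setTI.
  by rewrite ltey_eq PC.
- move=> A' B' mA' mB'; rewrite muleC.
  exact: XYZ.
Qed.

End independence.

(** * The Brownian filtration *)

Section brownian_filtration.
Context {R : realType} {disp : measure_display} {Omega : measurableType disp}.
Variables (P : probability Omega R) (d : nat) (W : Omega -> R -> 'cV[R]_d).
Hypothesis P_complete : measure_is_complete P.
Hypothesis W_brownian : is_brownian P W.

Definition increment (k : 'I_d) (s t : R) (w : Omega) : R :=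
  W w t k ord0 - W w s k ord0.

Lemma measurable_brownian t k : 0 <= t -> measurable_fun setT (fun w => W w t k ord0).
Proof.
by case: W_brownian => mW _ _ _ _ /mW /(measurable_mxBP _ measurableT); exact.
Qed.

Lemma measurable_increment k s t : 0 <= s -> 0 <= t -> measurable_fun setT (increment k s t).
Proof. by move=> s0 t0; apply: measurable_funB; exact: measurable_brownian. Qed.

Lemma measurable_brownian_events t A : brownian_events W t A -> measurable A.
Proof.
move=> [u [k [B [/andP[u0 _] mB ->]]]]; rewrite -[X in measurable X]setTI.
exact: measurable_brownian.
Qed.

Lemma measurable_filt t A : filt P W t A -> measurable A.
Proof.
apply: smallest_sub; first exact: sigma_algebra_measurable.
by move=> B [/measurable_brownian_events//|]; exact: P_complete.
Qed.

Lemma filt_mono s t : s <= t -> filt P W s `<=` filt P W t.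
Proof.
move=> st; apply: sub_sigma_algebra2 => A [[u [k [B [/andP[u0 us] mB ->]]]]|N].
  by left; exists u, k, B; split => //; rewrite u0 (le_trans us).
by right.
Qed.

Lemma measurable_filt_oo A : filt_oo P W A -> measurable A.
Proof.
apply: smallest_sub; first exact: sigma_algebra_measurable.
by move=> B [t _]; exact: measurable_filt.
Qed.

Lemma sub_sigma_measurable_fun d2 (T2 : measurableType d2) (G : set (set Omega))
    (f : Omega -> T2) : G `<=` measurable ->
  measurable_fun setT (f : g_sigma_algebraType G -> T2) -> measurable_fun setT f.
Proof.
move=> Gm mf _ B mB; have : <<s G >> (setT `&` f @^-1` B) by exact: mf.
by apply: smallest_sub => //; exact: sigma_algebra_measurable.
Qed.

Lemma filt_sigma_algebra t : <<s filt P W t >> = filt P W t.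
Proof. by apply: sigma_algebra_id; exact: smallest_sigma_algebra. Qed.

Lemma filt_preimage t d2 (T2 : measurableType d2) (f : Omega -> T2) B :
  measurable_fun setT (f : g_sigma_algebraType (filt P W t) -> T2) ->
  measurable B -> filt P W t (f @^-1` B).
Proof.
by move=> mf mB; rewrite -filt_sigma_algebra -[X in <<s _ >> X]setTI; exact: mf.
Qed.

Lemma filt_fun_mono s t d2 (T2 : measurableType d2) (f : Omega -> T2) : s <= t ->
  measurable_fun setT (f : g_sigma_algebraType (filt P W s) -> T2) ->
  measurable_fun setT (f : g_sigma_algebraType (filt P W t) -> T2).
Proof.
move=> st mf _ B mB; rewrite setTI.
by apply: sub_sigma_algebra; apply: (filt_mono st); exact: filt_preimage.
Qed.

Lemma filt_fun_measurable t d2 (T2 : measurableType d2) (f : Omega -> T2) :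
  measurable_fun setT (f : g_sigma_algebraType (filt P W t) -> T2) ->
  measurable_fun setT f.
Proof. by apply: sub_sigma_measurable_fun => A; exact: measurable_filt. Qed.

(* Augmentation by null sets only changes events by null sets. *)
Lemma filt_unaugmented t A : filt P W t A ->
  exists2 A', <<s brownian_events W t >> A' &
    P.-negligible (A `\` A') /\ P.-negligible (A' `\` A).
Proof.
pose C := [set A | exists2 A', <<s brownian_events W t >> A' &
    P.-negligible (A `\` A') /\ P.-negligible (A' `\` A)].
suff : filt P W t `<=` C by exact.
pose S := smallest_sigma_algebra setT (brownian_events W t).
apply: smallest_sub.
  split.
  - exists set0; first exact: sigma_algebra0.
    by rewrite setD0; split; exact: negligible_set0.
  - move=> B [B' sB' [n1 n2]]; exists (setT `\` B').
      exact: sigma_algebraCD.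
    split; first by apply: negligibleS n2 => x [[_ Bx] B'x]; split => //;
      apply: contrapT => ?; exact: B'x.
    by apply: negligibleS n1 => x [[_ Bx] B'x]; split => //;
      apply: contrapT => ?; exact: B'x.
  - move=> F CF.
    have F' n : {B' | <<s brownian_events W t >> B' &
        P.-negligible (F n `\` B') /\ P.-negligible (B' `\` F n)}.
      exact/cid2/CF.
    pose G n := s2val (F' n).
    have sG n : <<s brownian_events W t >> (G n) by rewrite /G; case: (F' n).
    have nG n : P.-negligible (F n `\` G n) /\ P.-negligible (G n `\` F n).
      by rewrite /G; case: (F' n).
    exists (\bigcup_n G n); first exact: sigma_algebra_bigcup.
    split.
    + apply: (@negligibleS _ _ _ _ (\bigcup_n (F n `\` G n))).
        by move=> x [[n _ Fx] Gx]; exists n => //; split => // Gn; apply: Gx; exists n.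
      by apply: negligible_bigcup => n; case: (nG n).
    + apply: (@negligibleS _ _ _ _ (\bigcup_n (G n `\` F n))).
        by move=> x [[n _ Fx] Gx]; exists n => //; split => // Gn; apply: Gx; exists n.
      by apply: negligible_bigcup => n; case: (nG n).
move=> B [eB|nB].
  exists B; first exact: sub_sigma_algebra.
  by rewrite setDv; split; exact: negligible_set0.
exists set0; first exact: sigma_algebra0.
by rewrite setD0 set0D; split => //; exact: negligible_set0.
Qed.

Lemma le_measure_negligible (A B : set Omega) : measurable A -> measurable B ->
  P.-negligible (A `\` B) -> (P A <= P B)%E.
Proof.
move=> mA mB n; have mAB : measurable (A `\` B) by exact: measurableD.
have AB0 : P (A `\` B) = 0%E by apply/negligibleP.
apply: (@le_trans _ _ (P (B `|` A `\` B))).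
  apply: le_measure; rewrite ?inE//; first exact: measurableU.
  by move=> x Ax; have [|] := pselect (B x); [left|right].
apply: (@le_trans _ _ (P B + P (A `\` B))%E); first exact: measureU2.
by rewrite AB0 adde0.
Qed.

(** [is_brownian] speaks of the raw sigma-algebra. An event of the augmented one differs from a raw
    event by null sets, and exchanging the two alters neither side. *)
Lemma increment_indep s t A (B : 'I_d -> set R) : 0 <= s < t -> filt P W s A ->
  (forall k, measurable (B k)) ->
  P (A `&` [set w | forall k, B k (increment k s t w)]) =
  (P A * \prod_(k < d) P (increment k s t @^-1` B k))%E.
Proof.
move=> st fA mB; have [A' sA' [n1 n2]] := filt_unaugmented fA.
have mA' : measurable A'.
  move: sA'; apply: smallest_sub; first exact: sigma_algebra_measurable.
  by move=> ?; exact: measurable_brownian_events.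
have mA := measurable_filt fA.
have E C : measurable C -> P (A `&` C) = P (A' `&` C).
  move=> mC; apply/eqP; rewrite eq_le; apply/andP; split.
    apply: le_measure_negligible; [exact: measurableI|exact: measurableI|].
    by apply: negligibleS n1 => x [[Ax Cx] nA]; split => // A'x; exact: nA.
  apply: le_measure_negligible; [exact: measurableI|exact: measurableI|].
  by apply: negligibleS n2 => x [[Ax Cx] nA]; split => // A'x; exact: nA.
have /andP[s0 /ltW st'] := st.
have mC : measurable [set w | forall k, B k (increment k s t w)].
  rewrite (_ : mkset _ = \bigcap_(k in [set: 'I_d]) (increment k s t @^-1` B k)).
    apply: fin_bigcap_measurable => // k _; rewrite -[X in measurable X]setTI.
    by apply: measurable_increment => //; exact: le_trans st'.
  by apply/seteqP; split => [x Hx k _|x Hx k]; [exact: Hx|exact: (Hx k I)].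
rewrite E// -[A]setIT E// setIT.
by case: W_brownian => _ _ _ _; apply.
Qed.

Lemma increment_indep2 s t A k l (B C : set R) : 0 <= s < t -> filt P W s A ->
  k != l -> measurable B -> measurable C ->
  P (A `&` increment k s t @^-1` B `&` increment l s t @^-1` C) =
  (P A * P (increment k s t @^-1` B) * P (increment l s t @^-1` C))%E.
Proof.
move=> st fA kl mB mC.
pose D j := if j == k then B else if j == l then C else setT.
have mD j : measurable (D j) by rewrite /D; case: ifP => // _; case: ifP.
have := increment_indep st fA mD.
rewrite (bigD1 k)//= (bigD1 l)/=; last by rewrite eq_sym.
rewrite big1 => [|j /andP[jk jl]]; last first.
  by rewrite /D (negbTE jk) (negbTE jl) preimage_setT probability_setT.
rewrite {2 3}/D eqxx eq_sym (negbTE kl) eqxx mule1 muleA => <-.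
congr (P _); apply/seteqP; split => [x [[Ax Bx] Cx]|x [Ax Dx]].
  by split => // j; rewrite /D; case: ifP => [/eqP->//|_]; case: ifP => [/eqP->|].
split; [split => //|].
  by have := Dx k; rewrite /D eqxx.
by have := Dx l; rewrite /D eq_sym (negbTE kl) eqxx.
Qed.

Lemma increment_indep1 s t A k (B : set R) : 0 <= s < t -> filt P W s A ->
  measurable B -> P (A `&` increment k s t @^-1` B) = (P A * P (increment k s t @^-1` B))%E.
Proof.
move=> st fA mB.
pose D j := if j == k then B else setT.
have mD j : measurable (D j) by rewrite /D; case: ifP.
have := increment_indep st fA mD.
rewrite (bigD1 k)//= big1 => [|j jk]; last first.
  by rewrite /D (negbTE jk) preimage_setT probability_setT.
rewrite {2}/D eqxx mule1 => <-.
congr (P _); apply/seteqP; split => [x [Ax Bx]|x [Ax Dx]].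
  by split => // j; rewrite /D; case: ifP => [/eqP->//|_].
by split => //; have := Dx k; rewrite /D eqxx.
Qed.

Lemma increment_moments s t k : 0 <= s < t ->
  [/\ sqint P (increment k s t), ip P (increment k s t) (increment k s t) = t - s,
      P.-integrable setT (EFin \o increment k s t) &
      \int[P]_w increment k s t w = 0].
Proof.
move=> st; have /andP[s0 st'] := st.
have r0 : 0 < Num.sqrt (t - s) by rewrite sqrtr_gt0 subr_gt0.
have := @normal_moments _ _ r0 _ _ P (increment k s t).
rewrite sqr_sqrtr ?subr_ge0 ?ltW//; apply.
  by apply: measurable_increment => //; rewrite (le_trans s0) ?ltW.
by move=> B mB; case: W_brownian => _ _ _ + _; apply.
Qed.

Lemma indep_filt_increment s t k (xi : Omega -> R) : 0 <= s < t ->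
  measurable_fun setT (xi : g_sigma_algebraType (filt P W s) -> R) ->
  indep P xi (increment k s t).
Proof.
by move=> st mxi A B mA mB; apply: increment_indep1 => //; exact: filt_preimage.
Qed.

Lemma integrable_filt_increment s t k (xi : Omega -> R) : 0 <= s <= t ->
  measurable_fun setT (xi : g_sigma_algebraType (filt P W s) -> R) ->
  P.-integrable setT (EFin \o xi) ->
  P.-integrable setT (EFin \o (fun w => xi w * increment k s t w)) /\
  \int[P]_w (xi w * increment k s t w) = 0.
Proof.
(* The law of an increment is prescribed for [s < t] only; for [s = t] the increment is identically
   0. *)
move=> /andP[s0]; rewrite le_eqVlt => /predU1P[<-|st] mxi ixi.
  have E w : xi w * increment k s s w = 0 by rewrite /increment subrr mulr0.
  split; first by apply: eq_integrable (integrable0 P setT) => // w _; rewrite /= E.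
  exact: Rintegral_eq0.
have {}st : 0 <= s < t by rewrite s0.
have [_ _ iI I0] := increment_moments k st; have xiI := indep_filt_increment k st mxi.
by split; [exact: indep_integrable|rewrite indep_Rintegral// I0 mulr0].
Qed.

(** For [k != l] one increment is independent of the rest and has mean 0; for [k = l] the
    coefficient is independent of the squared increment, whose mean is the length of the
    interval. *)
Lemma integrable_filt_increment2 s t k l (xi : Omega -> R) : 0 <= s <= t ->
  measurable_fun setT (xi : g_sigma_algebraType (filt P W s) -> R) ->
  P.-integrable setT (EFin \o xi) ->
  P.-integrable setT (EFin \o (fun w => xi w * increment k s t w * increment l s t w)) /\
  \int[P]_w (xi w * increment k s t w * increment l s t w) =
    (k == l)%:R * (t - s) * \int[P]_w xi w.
Proof.
move=> /andP[s0]; rewrite le_eqVlt => /predU1P[<-|st] mxi ixi.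
  have E w : xi w * increment k s s w * increment l s s w = 0.
    by rewrite /increment !subrr mulr0.
  split; first by apply: eq_integrable (integrable0 P setT) => // w _; rewrite /= E.
  by rewrite Rintegral_eq0// subrr mulr0 mul0r.
have t0 : 0 <= t by rewrite (le_trans s0) ?ltW.
have {}st : 0 <= s < t by rewrite s0.
have [kl|kl] := eqVneq k l; last first.
  have [iI I0] := integrable_filt_increment k (introT andP (conj s0 (ltW (proj2 (andP st))))) mxi ixi.
  have [_ _ iL L0] := increment_moments l st.
  have ind : indep P (fun w => xi w * increment k s t w) (increment l s t).
    apply: indep_mul; [exact: filt_fun_measurable mxi|exact: measurable_increment|
      exact: measurable_increment|].
    move=> A B C mA mB mC; have fA := filt_preimage mxi mA.
    by rewrite increment_indep2// -increment_indep1.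
  by split; [exact: indep_integrable|rewrite indep_Rintegral// I0 !mul0r].
subst l; have [sI I2 _ _] := increment_moments k st.
have ind : indep P xi (fun w => increment k s t w * increment k s t w).
  move=> A B mA mB; have fA := filt_preimage mxi mA.
  (* An event about the square is an event about the increment itself. *)
  apply: (@increment_indep1 s t _ k [set x | B (x * x)]) => //.
  by rewrite -[X in measurable X]setTI; exact: (measurable_funM (@measurable_id _ R setT) (@measurable_id _ R setT)).
have ii := sqint_integrable_mul sI sI.
split.
  apply: eq_integrable (indep_integrable ind ixi ii) => // w _ /=.
  by rewrite mulrA.
under eq_Rintegral do rewrite -mulrA.
by rewrite indep_Rintegral// -/(ip _ _ _) I2 mul1r mulrC.
Qed.

End brownian_filtration.

(** * Ito isometry *)

Section simple_integrals.
Context {R : realType} {disp : measure_display} {Omega : measurableType disp}.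
Variables (P : probability Omega R) (d : nat) (W : Omega -> R -> 'cV[R]_d).
Hypothesis P_complete : measure_is_complete P.
Hypothesis W_brownian : is_brownian P W.
Local Notation mu := (@lebesgue_measure R).
Local Notation incr := (increment W).
Local Notation Fmeas t xi :=
  (measurable_fun setT (xi : g_sigma_algebraType (filt P W t) -> R)).
Local Notation bounded xi := (exists M : R, forall w : Omega, `|xi w| <= M).

Lemma measurable_increment_filt s t u k : 0 <= s <= u -> 0 <= t <= u ->
  Fmeas u (incr k s t).
Proof.
move=> su tu.
have mW r : 0 <= r <= u -> Fmeas u (fun w => W w r k ord0).
  move=> ru _ B mB; rewrite setTI; apply: sub_sigma_algebra.
  by apply: sub_sigma_algebra; left; exists r, k, B.
by apply: measurable_funB; exact: mW.
Qed.

Lemma sqint_bounded (xi : Omega -> R) : measurable_fun setT xi -> bounded xi ->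
  sqint P xi.
Proof.
move=> mxi [M xiM]; apply: (@sqint_le _ _ _ P xi (cst M)) => //.
  split => //; rewrite (integral_cst P measurableT (M ^+ 2)%:E).
  by rewrite [X in (_ * X)%E]probability_setT mule1 ltry.
by move=> w; rewrite (le_trans (xiM w))// ler_norm.
Qed.

Lemma sqint_mul_bounded (xi X : Omega -> R) : measurable_fun setT xi ->
  bounded xi -> sqint P X -> sqint P (fun w => xi w * X w).
Proof.
move=> mxi [M xiM] sX.
apply: (sqint_le _ (sqintZ M sX)); first exact: measurable_funM mxi sX.1.
by move=> w; rewrite !normrM ler_wpM2r// (le_trans (xiM w))// ler_norm.
Qed.

Lemma boundedM (xi xi' : Omega -> R) : bounded xi -> bounded xi' ->
  bounded (fun w => xi w * xi' w).
Proof.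
move=> [M xiM] [N xiN]; exists (M * N) => w.
by rewrite normrM ler_pM.
Qed.

Lemma sqint_increment s t k : 0 <= s <= t -> sqint P (incr k s t).
Proof.
move=> /andP[s0]; rewrite le_eqVlt => /predU1P[<-|st].
  rewrite (_ : incr k s s = cst 0); first exact: sqint0.
  by apply/funext => w; rewrite /increment subrr.
have st' : 0 <= s < t by rewrite s0.
by case: (increment_moments W_brownian k st').
Qed.

Lemma integrable_indic_oc (a b : R) : mu.-integrable setT (EFin \o \1_`]a, b]).
Proof. exact: integrable_indic_itv. Qed.

Section elementary.
Variables (xi xi' : Omega -> R) (a b a' b' : R) (k l : 'I_d).
Hypotheses (mxi : Fmeas a xi) (mxi' : Fmeas a' xi').
Hypotheses (bxi : bounded xi) (bxi' : bounded xi').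
Hypotheses (ab : 0 <= a <= b) (ab' : 0 <= a' <= b').

Let mx := filt_fun_measurable P_complete W_brownian mxi.
Let mx' := filt_fun_measurable P_complete W_brownian mxi'.

Lemma sqint_elementary : sqint P (fun w => xi w * incr k a b w).
Proof. by apply: sqint_mul_bounded => //; exact: sqint_increment. Qed.

Lemma sqint_elementary_prod :
  sqint (P \x mu)%E (fun x => xi x.1 * \1_`]a, b] x.2).
Proof.
apply: integrable_mul_sqint.
  apply: measurable_funM; first exact: measurableT_comp mx measurable_fst.
  exact: measurableT_comp (measurable_indic _) measurable_snd.
have xx := sqint_integrable_mul (sqint_bounded mx bxi) (sqint_bounded mx bxi).
have := integrable_prod_mul xx (integrable_indic_oc a b).
apply: eq_integrable => // x _ /=; congr EFin.
rewrite mulrACA; congr (_ * _).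
by rewrite indicE; case: (_ \in _); rewrite !(mulr1, mulr0).
Qed.

Lemma ip_elementary_prod :
  ip (P \x mu)%E (fun x => xi x.1 * \1_`]a, b] x.2)
     (fun x => xi' x.1 * \1_`]a', b'] x.2) =
  Num.max (Num.min b b' - Num.max a a') 0 * \int[P]_w (xi w * xi' w).
Proof.
have xx := sqint_integrable_mul (sqint_bounded mx bxi) (sqint_bounded mx' bxi').
have E : (fun x : Omega * R => xi x.1 * \1_`]a, b] x.2 * (xi' x.1 * \1_`]a', b'] x.2)) =
    (fun x => (xi x.1 * xi' x.1) * \1_`]Num.max a a', Num.min b b'] x.2).
  apply/funext => x; rewrite mulrACA; congr (_ * _).
  rewrite !indicE !mem_setE/= !in_itv/= gt_max le_min -natrM mulnb.
  by congr (nat_of_bool _)%:R; case: (a < _); case: (a' < _); case: (_ <= b) => /=; case: (_ <= b').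
rewrite /ip E (Rintegral_prod_mul xx (integrable_indic_oc _ _)) mulrC.
congr (_ * _); rewrite /Rintegral integral_indic// setIT.
rewrite [fine _](_ : _ = fine (lebesgue_measure `]Num.max a a', Num.min b b']%classic))//.
rewrite lebesgue_measure_itv/= lte_fin; case: ltP => [lt|ge]/=.
  by rewrite [Num.max (_ - _) 0]max_l// subr_ge0 ltW.
by rewrite [Num.max (_ - _) 0]max_r// subr_le0.
Qed.

Let Zfilt c eta j u : Fmeas c eta -> P.-integrable setT (EFin \o eta) ->
  0 <= c <= u -> \int[P]_w (eta w * incr j c u w) = 0.
Proof.
by move=> me ie cu; have [] := integrable_filt_increment P_complete W_brownian j cu me ie.
Qed.

(** Cutting at [a'] and at [c = min b b'] makes the pieces equal or successive. Successive pieces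
    contribute 0, the later increment being centred given the earlier time; only the common interval
    from [a'] to [c] survives. *)
Lemma ip_elementary_le : a <= a' ->
  ip P (fun w => xi w * incr k a b w) (fun w => xi' w * incr l a' b' w) =
  (k == l)%:R * Num.max (Num.min b b' - a') 0 * \int[P]_w (xi w * xi' w).
Proof.
move=> aa'; have /andP[a0 ab0] := ab; have /andP[a'0 ab'0] := ab'.
have mxia' : Fmeas a' xi by exact: filt_fun_mono mxi.
have bxx := boundedM bxi bxi'.
have mxx : Fmeas a' (fun w => xi w * xi' w) by exact: measurable_funM.
have mxx0 := filt_fun_measurable P_complete W_brownian mxx.
have sxx : sqint P (fun w => xi w * xi' w) by exact: sqint_bounded.
have int1 j s t : 0 <= s <= t ->
    P.-integrable setT (EFin \o (fun w => xi w * xi' w * incr j s t w)).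
  by move=> st; apply: sqint_integrable_mul => //; exact: sqint_increment.
have int2 i j s t u v : 0 <= s <= t -> 0 <= u <= v -> P.-integrable setT
    (EFin \o (fun w => xi w * xi' w * incr i s t w * incr j u v w)).
  move=> st uv; apply: sqint_integrable_mul; last exact: sqint_increment.
  by apply: sqint_mul_bounded => //; exact: sqint_increment.
have ipE : ip P (fun w => xi w * incr k a b w) (fun w => xi' w * incr l a' b' w) =
    \int[P]_w (xi w * xi' w * incr k a b w * incr l a' b' w).
  by apply: eq_Rintegral => w _; rewrite [LHS]mulrACA mulrA.
rewrite ipE; have [ba'|a'b] := leP b a'.
  rewrite max_r ?mulr0 ?mul0r; last first.
    by rewrite subr_le0 ge_min ba'.
  apply: Zfilt => //; last exact: int1.
  by apply: measurable_funM => //; apply: measurable_increment_filt; rewrite ?a0//= ?ba' ?(le_trans a0).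
pose c := Num.min b b'.
have a'c : a' <= c by rewrite le_min ab'0 ltW.
have c0 : 0 <= c by exact: le_trans a'c.
have mxxc : Fmeas c (fun w => xi w * xi' w) by exact: filt_fun_mono mxx.
have [cb cb'] : c <= b /\ c <= b' by rewrite !ge_min !lexx orbT.
(* One of the two intervals beyond [c] is degenerate, so this product drops out of the expansion. *)
have zero w : incr k c b w * incr l c b' w = 0.
  rewrite /increment /c; case: leP => _; first by rewrite subrr mul0r.
  by rewrite subrr mulr0.
have E : (fun w => xi w * xi' w * incr k a b w * incr l a' b' w) =
    (fun w => xi w * xi' w * incr k a a' w * incr l a' b' w +
      (xi w * xi' w * incr k a' c w * incr l a' c w +
      (xi w * xi' w * incr k a' c w * incr l c b' w +
       xi w * xi' w * incr l a' c w * incr k c b w))).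
  apply/funext => w; have := zero w; rewrite /increment => z.
  transitivity (xi w * xi' w * (W w b k ord0 - W w a k ord0) *
    (W w b' l ord0 - W w a' l ord0) - xi w * xi' w *
    ((W w b k ord0 - W w c k ord0) * (W w b' l ord0 - W w c l ord0))).
    by rewrite z mulr0 subr0.
  ring.
have i1 : P.-integrable setT (EFin \o
    (fun w => xi w * xi' w * incr k a a' w * incr l a' b' w)).
  by apply: int2 => //; rewrite a0.
have i2 : P.-integrable setT (EFin \o
    (fun w => xi w * xi' w * incr k a' c w * incr l a' c w)).
  by apply: int2; rewrite a'0.
have i3 : P.-integrable setT (EFin \o
    (fun w => xi w * xi' w * incr k a' c w * incr l c b' w)).
  by apply: int2; rewrite ?a'0 ?c0.
have i4 : P.-integrable setT (EFin \o
    (fun w => xi w * xi' w * incr l a' c w * incr k c b w)).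
  by apply: int2; rewrite ?a'0 ?c0.
have a'c0 : 0 <= a' <= c by rewrite a'0.
have ii : P.-integrable setT (EFin \o (fun w => xi w * xi' w)).
  exact: sqint_integrable_mul (sqint_bounded _ _) (sqint_bounded _ _).
rewrite E RintegralD//; last by do 2!apply: integrable_EFinD => //.
rewrite RintegralD//; last exact: integrable_EFinD.
rewrite RintegralD//.
rewrite Zfilt//; last 2 first.
- by apply: measurable_funM => //; apply: measurable_increment_filt; rewrite ?a0 ?a'0/= ?aa'.
- by apply: int1; rewrite a0.
have mc j : Fmeas c (fun w => xi w * xi' w * incr j a' c w).
  by apply: measurable_funM => //; apply: measurable_increment_filt; rewrite ?a'0 ?c0/=.
rewrite (Zfilt l (mc k) (int1 _ _ _ a'c0)) ?c0//.
rewrite (Zfilt k (mc l) (int1 _ _ _ a'c0)) ?c0//.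
rewrite add0r !addr0.
have [_ ->] := integrable_filt_increment2 P_complete W_brownian k l a'c0 mxx ii.
by rewrite max_l ?subr_ge0.
Qed.

End elementary.

Lemma ip_elementary (xi xi' : Omega -> R) (a b a' b' : R) (k l : 'I_d) :
  Fmeas a xi -> Fmeas a' xi' -> bounded xi -> bounded xi' ->
  0 <= a <= b -> 0 <= a' <= b' ->
  ip P (fun w => xi w * incr k a b w) (fun w => xi' w * incr l a' b' w) =
  (k == l)%:R * ip (P \x mu)%E (fun x => xi x.1 * \1_`]a, b] x.2)
     (fun x => xi' x.1 * \1_`]a', b'] x.2).
Proof.
move=> mx mx' bx bx' ab ab'; rewrite ip_elementary_prod//.
have [aa'|/ltW aa'] := leP a a'.
  by rewrite ip_elementary_le// mulrA.
rewrite ipC ip_elementary_le// eq_sym minC mulrA; congr (_ * _).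
by apply: eq_Rintegral => w _; rewrite mulrC.
Qed.

Section simple_process.
Variables (a : R) (b : \bar R).
Hypothesis a0 : 0 <= a.

Lemma simple_time_ge0 h j : is_simple P W a b h -> (j <= sp_size h)%N ->
  a <= sp_time h j.
Proof.
move=> [ah _ mono _ _]; elim: j => // j ih jh.
by apply: le_trans (mono _ jh); apply: ih; exact: ltnW.
Qed.

Lemma simple_time h j : is_simple P W a b h -> (j < sp_size h)%N ->
  0 <= sp_time h j <= sp_time h j.+1.
Proof.
move=> sh jh; have [_ _ mono _ _] := sh; rewrite mono// andbT.
by rewrite (le_trans a0)// (simple_time_ge0 sh)// ltnW.
Qed.

Lemma simple_coef h j : is_simple P W a b h -> (j < sp_size h)%N ->
  Fmeas (sp_time h j) (sp_coef h j) /\ bounded (sp_coef h j).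
Proof.
by move=> [_ _ _ mc [M hM]] jh; split; [exact: mc|exists M => w; exact: hM].
Qed.

Lemma sqint_simple_integral h k : is_simple P W a b h ->
  sqint P (sp_integral W k h).
Proof.
move=> sh; apply: sqint_sum => j.
have [mc bc] := simple_coef sh (ltn_ord j).
by apply: sqint_elementary => //; exact: simple_time.
Qed.

Lemma sqint_simple_val h : is_simple P W a b h ->
  sqint (P \x mu)%E (fun x => sp_val h x.1 x.2).
Proof.
move=> sh; apply: sqint_sum => j.
have [mc bc] := simple_coef sh (ltn_ord j).
exact: (sqint_elementary_prod _ mc bc).
Qed.

(** Since [ip_elementary] treats two arbitrary intervals, bilinearity suffices and the partitions
    need no common refinement. The factor [(k == l)] records that integrals along different
    coordinates are orthogonal. *)
Lemma simple_isometry h h' k l : is_simple P W a b h -> is_simple P W a b h' ->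
  ip P (sp_integral W k h) (sp_integral W l h') =
  (k == l)%:R *
  ip (P \x mu)%E (fun x => sp_val h x.1 x.2) (fun x => sp_val h' x.1 x.2).
Proof.
move=> sh sh'.
rewrite ip_suml; last 2 first.
- move=> j; have [mc bc] := simple_coef sh (ltn_ord j).
  by apply: sqint_elementary => //; exact: simple_time.
- exact: sqint_simple_integral.
rewrite ip_suml; last 2 first.
- move=> j; have [mc bc] := simple_coef sh (ltn_ord j).
  exact: (sqint_elementary_prod _ mc bc).
- exact: sqint_simple_val.
rewrite mulr_sumr; apply: eq_bigr => i _.
have [mi bi] := simple_coef sh (ltn_ord i); have ti := simple_time sh (ltn_ord i).
rewrite ip_sumr; last 2 first.
- move=> j; have [mc bc] := simple_coef sh' (ltn_ord j).
  by apply: sqint_elementary => //; exact: simple_time.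
- exact: sqint_elementary.
rewrite ip_sumr; last 2 first.
- move=> j; have [mc bc] := simple_coef sh' (ltn_ord j).
  exact: (sqint_elementary_prod _ mc bc).
- exact: (sqint_elementary_prod _ mi bi).
rewrite mulr_sumr; apply: eq_bigr => j _.
have [mj bj] := simple_coef sh' (ltn_ord j); have tj := simple_time sh' (ltn_ord j).
exact: ip_elementary.
Qed.

(** All steps start at or after [a], so [xi] times a coefficient is still known when its step
    begins, and the increment of that step is centred. *)
Lemma simple_orthogonal h k (xi : Omega -> R) : is_simple P W a b h ->
  Fmeas a xi -> sqint P xi -> ip P xi (sp_integral W k h) = 0.
Proof.
move=> sh mxi sxi; rewrite ip_sumr//; last first.
  move=> j; have [mc bc] := simple_coef sh (ltn_ord j).
  by apply: sqint_elementary => //; exact: simple_time.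
rewrite big1// => j _; have [mc bc] := simple_coef sh (ltn_ord j).
have tj := simple_time sh (ltn_ord j).
have mc0 := filt_fun_measurable P_complete W_brownian mc.
have mx : Fmeas (sp_time h j) (fun w => xi w * sp_coef h j w).
  apply: measurable_funM => //; apply: filt_fun_mono mxi.
  by apply: (simple_time_ge0 sh); exact: ltnW.
have ix : P.-integrable setT (EFin \o (fun w => xi w * sp_coef h j w)).
  by apply: sqint_integrable_mul => //; exact: sqint_bounded.
have [_ <-] := integrable_filt_increment P_complete W_brownian k tj mx ix.
by apply: eq_Rintegral => w _; rewrite mulrA.
Qed.

End simple_process.

End simple_integrals.

Lemma frob_sqr {R : realType} m n (A : 'M[R]_(m, n)) :
  frob A ^+ 2 = \sum_i \sum_j A i j ^+ 2.
Proof.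
by rewrite sqr_sqrtr//; do 2![apply: sumr_ge0 => ? _]; exact: sqr_ge0.
Qed.

Lemma integral_frob_sqr {R : realType} {disp : measure_display}
    {Omega : measurableType disp} (P : probability Omega R) m (V : Omega -> 'cV[R]_m) :
  (forall i, measurable_fun setT (fun w => V w i ord0)) ->
  (\int[P]_w (frob (V w) ^+ 2)%:E = \sum_i \int[P]_w (V w i ord0 ^+ 2)%:E)%E.
Proof.
move=> mV; rewrite -ge0_integral_sum//.
- apply: eq_integral => w _; rewrite frob_sqr sumEFin; congr EFin.
  by apply: eq_bigr => i _; rewrite big_ord1.
- by move=> i; apply/measurable_EFinP; exact: measurable_funX.
- by move=> i w _; rewrite lee_fin sqr_ge0.
Qed.

Lemma measurable_time_range {R : realType} (a : R) b : measurable (time_range a b).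
Proof.
case: b => [b| |].
- rewrite (_ : time_range a _ = `[a, b]%classic)//.
  apply/seteqP; split => x; rewrite /time_range/= in_itv/=.
    by rewrite lee_fin => -[-> ->].
  by rewrite lee_fin => /andP.
- rewrite (_ : time_range a _ = `[a, +oo[%classic)//.
  apply/seteqP; split => x; rewrite /time_range/= in_itv/= andbT; first by case.
  by rewrite leey.
- rewrite (_ : time_range a _ = set0)//.
  by apply/seteqP; split => x //; rewrite /time_range/= leeNy_eq => -[].
Qed.

(** * Stochastic integrals as L2 limits *)

Section ito.
Context {R : realType} {disp : measure_display} {Omega : measurableType disp}.
Variables (P : probability Omega R) (d : nat) (W : Omega -> R -> 'cV[R]_d).
Hypothesis P_complete : measure_is_complete P.
Hypothesis W_brownian : is_brownian P W.
Local Notation mu := (@lebesgue_measure R).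
Local Notation Fmeas t xi :=
  (measurable_fun setT (xi : g_sigma_algebraType (filt P W t) -> R)).
Variables (a : R) (b : \bar R).
Hypothesis a0 : 0 <= a.

(** Extension by zero turns the L2 space over the time range into the one of the full product
    measure, where [ip] and its limit theorem are available. *)
Definition cutoff (z : Omega -> R -> R) (x : Omega * measurableTypeR R) : R :=
  z x.1 x.2 * \1_(time_range a b) x.2.

Lemma simple_time_le h j : is_simple P W a b h -> (j <= sp_size h)%N ->
  ((sp_time h j)%:E <= b)%E.
Proof.
move=> [_ hb mono _ _] jh; apply: le_trans hb; rewrite lee_fin.
have mon n : (j + n <= sp_size h)%N -> sp_time h j <= sp_time h (j + n).
  elim: n => [|n ih jn]; first by rewrite addn0.
  rewrite addnS in jn *; apply: le_trans (ih (ltnW jn)) (mono _ jn).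
by have := mon (sp_size h - j)%N; rewrite subnKC//; apply.
Qed.

Lemma simple_val_cutoff h : is_simple P W a b h ->
  cutoff (sp_val h) = (fun x => sp_val h x.1 x.2).
Proof.
move=> sh; apply/funext => x; rewrite /cutoff mulr_suml.
apply: eq_bigr => j _; rewrite -mulrA; congr (_ * _).
rewrite !indicE; have [|_] := boolP (x.2 \in `]_, _]%classic); last by rewrite mul0r.
rewrite inE/= in_itv/= => /andP[lt le]; rewrite mem_set ?mulr1//; split.
  by apply: le_trans (ltW lt); exact: simple_time_ge0 sh (ltnW (ltn_ord j)).
by apply: le_trans (simple_time_le sh (ltn_ord j)); rewrite lee_fin.
Qed.

Lemma integral_cutoff (z : Omega -> R -> R) : measurable_fun setT (cutoff z) ->
  (\int[P]_w \int[mu]_(s in time_range a b) (z w s ^+ 2)%:E =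
   \int[(P \x mu)%E]_x (cutoff z x ^+ 2)%:E)%E.
Proof.
move=> mz; rewrite fubini_tonelli1//; last 2 first.
- by apply/measurable_EFinP; exact: measurable_funX.
- by move=> x; rewrite lee_fin sqr_ge0.
apply: eq_integral => w _; rewrite integral_mkcond; apply: eq_integral => s _.
rewrite patchE /fubini_F /cutoff/= indicE.
have [sab|sab] := pselect (time_range a b s); first by rewrite !mem_set// mulr1.
by rewrite !memNset// mulr0 expr0n.
Qed.

Lemma cutoffB (z z' : Omega -> R -> R) :
  cutoff (fun w s => z w s - z' w s) = (fun x => cutoff z x - cutoff z' x).
Proof. by apply/funext => x; rewrite /cutoff mulrBl. Qed.

Lemma is_ito1_approx k z I : measurable_fun setT (cutoff z) ->
  is_ito1 P W k a b z I ->
  [/\ sqint P I, sqint (P \x mu)%E (cutoff z) &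
    exists h : nat -> @simple_process R disp Omega,
    [/\ forall n, is_simple P W a b (h n),
      ip P (fun w => sp_integral W k (h n) w - I w)
        (fun w => sp_integral W k (h n) w - I w) @[n --> \oo] --> 0 &
      ip (P \x mu)%E (fun x => sp_val (h n) x.1 x.2 - cutoff z x)
        (fun x => sp_val (h n) x.1 x.2 - cutoff z x) @[n --> \oo] --> 0]].
Proof.
move=> mz [mI [h [sh cz cI]]].
have [sI ipI] := sqint_lim mI (fun n => sqint_simple_integral P_complete W_brownian a0 k (sh n)) cI.
have sv n := sqint_simple_val P_complete W_brownian (sh n).
have [|sz ipz] := sqint_lim mz sv.
  rewrite (_ : (fun n => _) = (fun n => \int[P]_w \int[mu]_(s in time_range a b)
      ((sp_val (h n) w s - z w s) ^+ 2)%:E)%E)//.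
  apply/funext => n; rewrite (integral_cutoff (z := fun w s => sp_val (h n) w s - z w s)).
    by apply: eq_integral => x _; rewrite cutoffB simple_val_cutoff.
  rewrite cutoffB simple_val_cutoff//; apply: measurable_funB => //.
  exact: (sv n).1.
by split => //; exists h.
Qed.

(** The identity holds along the approximating simple processes, and by [ip_cvg] both sides pass to
    the limit. *)
Lemma ito_isometry k l z z' I I' : measurable_fun setT (cutoff z) ->
  measurable_fun setT (cutoff z') ->
  is_ito1 P W k a b z I -> is_ito1 P W l a b z' I' ->
  ip P I I' = (k == l)%:R * ip (P \x mu)%E (cutoff z) (cutoff z').
Proof.
move=> mz mz' /(is_ito1_approx mz)[sI sz [h [sh cI cz]]].
move=> /(is_ito1_approx mz')[sI' sz' [h' [sh' cI' cz']]].
have si n := sqint_simple_integral P_complete W_brownian a0 k (sh n).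
have si' n := sqint_simple_integral P_complete W_brownian a0 l (sh' n).
have sv n := sqint_simple_val P_complete W_brownian (sh n).
have sv' n := sqint_simple_val P_complete W_brownian (sh' n).
have c1 := ip_cvg sI sI' si si' cI cI'.
have c2 := ip_cvg sz sz' sv sv' cz cz'.
rewrite (funext (fun n =>
  simple_isometry P_complete W_brownian a0 k l (sh n) (sh' n))) in c1.
exact: (cvg_unique _ c1 (cvgM (cvg_cst _) c2)).
Qed.

Lemma ito_orthogonal k z I xi : measurable_fun setT (cutoff z) ->
  is_ito1 P W k a b z I -> Fmeas a xi -> sqint P xi -> ip P xi I = 0.
Proof.
move=> mz /(is_ito1_approx mz)[sI sz [h [sh cI cz]]] mxi sxi.
have si n := sqint_simple_integral P_complete W_brownian a0 k (sh n).
have c0 : ip P (fun w => xi w - xi w) (fun w => xi w - xi w) @[n --> \oo] --> 0.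
  rewrite (_ : (fun w => xi w - xi w) = cst 0); last by apply/funext => w; rewrite subrr.
  by rewrite ip0l; exact: cvg_cst.
have c1 := ip_cvg sxi sI (fun=> sxi) si c0 cI.
rewrite (funext (fun n =>
  simple_orthogonal P_complete W_brownian a0 k (sh n) mxi sxi)) in c1.
exact: (cvg_unique _ c1 (cvg_cst _)).
Qed.

Section energy.
Variables (z z' : 'I_d -> Omega -> R -> R) (J J' : 'I_d -> Omega -> R).
Variable xi : Omega -> R.
Hypotheses (mz : forall k, measurable_fun setT (cutoff (z k)))
  (mz' : forall k, measurable_fun setT (cutoff (z' k)))
  (zJ : forall k, is_ito1 P W k a b (z k) (J k))
  (zJ' : forall k, is_ito1 P W k a b (z' k) (J' k))
  (mxi : Fmeas a xi) (sxi : sqint P xi).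

Let D k w := J k w - J' k w.
Let dz k w s := z k w s - z' k w s.

Let sqintJ k : sqint P (J k). Proof. by case: (is_ito1_approx (mz k) (zJ k)). Qed.
Let sqintJ' k : sqint P (J' k). Proof. by case: (is_ito1_approx (mz' k) (zJ' k)). Qed.
Let sqint_D k : sqint P (D k). Proof. exact: sqintB. Qed.
Let sqintz k : sqint (P \x mu)%E (cutoff (z k)).
Proof. by case: (is_ito1_approx (mz k) (zJ k)). Qed.
Let sqintz' k : sqint (P \x mu)%E (cutoff (z' k)).
Proof. by case: (is_ito1_approx (mz' k) (zJ' k)). Qed.
Let sqintdz k : sqint (P \x mu)%E (cutoff (dz k)).
Proof. by rewrite cutoffB; exact: sqintB. Qed.

(** Bilinear expansion into four isometries; no approximating processes for the difference [dz] have
    to be exhibited. *)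
Let ipD k l : ip P (D k) (D l) =
  (k == l)%:R * ip (P \x mu)%E (cutoff (dz k)) (cutoff (dz l)).
Proof.
rewrite /D /dz !cutoffB (ipBB (sqintJ k) (sqintJ' k) (sqintJ l) (sqintJ' l)).
rewrite (ipBB (sqintz k) (sqintz' k) (sqintz l) (sqintz' l)).
rewrite (ito_isometry (mz k) (mz l) (zJ k) (zJ l)).
rewrite (ito_isometry (mz k) (mz' l) (zJ k) (zJ' l)).
rewrite (ito_isometry (mz' k) (mz l) (zJ' k) (zJ l)).
rewrite (ito_isometry (mz' k) (mz' l) (zJ' k) (zJ' l)); ring.
Qed.

Lemma sqint_ito_sum : sqint P (fun w => xi w + \sum_k (J k w - J' k w)).
Proof. by apply: sqintD => //; apply: (sqint_sum _ (F := D)). Qed.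

(** Pythagoras: [xi], known at time [a], is orthogonal to every integral over later times, and
    integrals along different coordinates are orthogonal to each other. *)
Lemma ito_energy1 :
  (\int[P]_w ((xi w + \sum_k (J k w - J' k w)) ^+ 2)%:E =
   \int[P]_w (xi w ^+ 2)%:E + \sum_k
   \int[P]_w \int[mu]_(s in time_range a b) ((z k w s - z' k w s) ^+ 2)%:E)%E.
Proof.
have sS : sqint P (fun w => \sum_k D k w) by exact: sqint_sum.
have xiD : ip P xi (fun w => \sum_k D k w) = 0.
  rewrite ip_sumr// big1// => k _; rewrite ipBr//.
  by rewrite (ito_orthogonal (mz k) (zJ k))// (ito_orthogonal (mz' k) (zJ' k))// subrr.
apply: (etrans (esym (ipE sqint_ito_sum))).
transitivity ((ip P xi xi)%:E +
    \sum_k (ip (P \x mu)%E (cutoff (dz k)) (cutoff (dz k)))%:E)%E; last first.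
  congr (_ + _)%E; first exact: ipE.
  apply: eq_bigr => k _; rewrite (integral_cutoff (z := dz k)) ?ipE//.
  exact: (sqintdz k).1.
rewrite sumEFin -EFinD; congr EFin.
rewrite ipDl//; last exact: sqint_ito_sum.
rewrite !ipDr// xiD addr0 (ipC _ _ xi) xiD add0r; congr (_ + _).
apply: (etrans (ip_suml _ sqint_D sS)); apply: eq_bigr => k _.
rewrite (ip_sumr _ sqint_D)// (bigD1 k)//=.
rewrite big1 => [|l lk]; last by rewrite ipD eq_sym (negbTE lk) mul0r.
by rewrite addr0 ipD eqxx mul1r.
Qed.

End energy.

Lemma is_ito_sqint m (z : Omega -> R -> 'M[R]_(m, d)) I i :
  (forall i k, measurable_fun setT (cutoff (fun w s => z w s i k))) ->
  is_ito P W a b z I -> sqint P (fun w => I w i ord0).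
Proof.
move=> mz [J zJ IJ].
rewrite (_ : (fun w => _) = (fun w => \sum_k J k w i ord0)); last first.
  by apply/funext => w; rewrite IJ summxE.
by apply: sqint_sum => k; case: (is_ito1_approx (mz i k) (zJ k i)).
Qed.

Lemma ito_energy m (z z' : Omega -> R -> 'M[R]_(m, d)) I I'
    (X : Omega -> 'cV[R]_m) :
  (forall i k, measurable_fun setT (cutoff (fun w s => z w s i k))) ->
  (forall i k, measurable_fun setT (cutoff (fun w s => z' w s i k))) ->
  is_ito P W a b z I -> is_ito P W a b z' I' ->
  (forall i, Fmeas a (fun w => X w i ord0)) ->
  (forall i, sqint P (fun w => X w i ord0)) ->
  (\int[P]_w (frob (X w + (I w - I' w)) ^+ 2)%:E =
   \int[P]_w (frob (X w) ^+ 2)%:E +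
   \int[P]_w \int[mu]_(s in time_range a b) (frob (z w s - z' w s) ^+ 2)%:E)%E.
Proof.
move=> mz mz' [J zJ IJ] [J' zJ' IJ'] mX sX.
pose dz i k w s := z w s i k - z' w s i k.
have mdz i k : measurable_fun setT (cutoff (dz i k)).
  by rewrite cutoffB; exact: measurable_funB.
have mdz2 i k : measurable_fun setT (fun x => (cutoff (dz i k) x ^+ 2)%:E).
  by apply/measurable_EFinP; exact: measurable_funX.
have -> : (\int[P]_w \int[mu]_(s in time_range a b) (frob (z w s - z' w s) ^+ 2)%:E =
    \sum_i \sum_k \int[P]_w \int[mu]_(s in time_range a b) (dz i k w s ^+ 2)%:E)%E.
  transitivity (\int[(P \x mu)%E]_x \sum_i \sum_k (cutoff (dz i k) x ^+ 2)%:E)%E.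
    rewrite fubini_tonelli1//; last 2 first.
    - by apply: emeasurable_sum => i; exact: emeasurable_sum.
    - by move=> x; do 2![apply: sume_ge0 => ? _]; rewrite lee_fin sqr_ge0.
    apply: eq_integral => w _; rewrite integral_mkcond; apply: eq_integral => s _.
    rewrite patchE /fubini_F; have [sab|sab] := pselect (time_range a b s).
      rewrite mem_set// frob_sqr -sumEFin; apply: eq_bigr => i _.
      rewrite -sumEFin; apply: eq_bigr => k _.
      by rewrite /cutoff/= indicE mem_set// mulr1 !mxE.
    rewrite memNset// big1// => i _; rewrite big1// => k _.
    by rewrite /cutoff/= indicE memNset// mulr0 expr0n.
  rewrite ge0_integral_sum//; last 2 first.
  - by move=> i; exact: emeasurable_sum.
  - by move=> i x _; apply: sume_ge0 => k _; rewrite lee_fin sqr_ge0.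
  apply: eq_bigr => i _; rewrite ge0_integral_sum//; last first.
    by move=> k x _; rewrite lee_fin sqr_ge0.
  by apply: eq_bigr => k _; rewrite integral_cutoff.
have E w i : (X w + (I w - I' w)) i ord0 =
    X w i ord0 + \sum_k (J k w i ord0 - J' k w i ord0).
  by rewrite !mxE IJ IJ' !summxE sumrB.
have sE i : sqint P (fun w => (X w + (I w - I' w)) i ord0).
  under eq_fun do rewrite E.
  exact: (sqint_ito_sum (mz i) (mz' i) (fun k => zJ k i) (fun k => zJ' k i)).
rewrite integral_frob_sqr => [|i]; last exact: (sE i).1.
rewrite integral_frob_sqr => [|i]; last exact: (sX i).1.
rewrite -big_split/=; apply: eq_bigr => i _.
under eq_integral do rewrite E.
exact: (ito_energy1 (mz i) (mz' i) (fun k => zJ k i) (fun k => zJ' k i)).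
Qed.

End ito.

(** * Convergence of conditional expectations *)

Section conditional_expectation.
Context {R : realType} {disp : measure_display} {Omega : measurableType disp}.
Variable P : probability Omega R.
Local Notation mu := (@lebesgue_measure R).

Section contraction.
Variables (G : set (set Omega)) (X Y : Omega -> R).
Hypotheses (sG : <<s G >> = G) (Gm : G `<=` measurable).
Hypothesis XY : is_condexp P G X Y.

Let iX : P.-integrable setT (EFin \o X). Proof. by case: XY. Qed.
Let iY : P.-integrable setT (EFin \o Y). Proof. by case: XY. Qed.
Let mX : measurable_fun setT X.
Proof. exact/measurable_EFinP/(measurable_int _ iX). Qed.
Let mY : measurable_fun setT Y.
Proof. exact/measurable_EFinP/(measurable_int _ iY). Qed.
Let mYG : measurable_fun setT (Y : g_sigma_algebraType G -> R).
Proof. by case: XY. Qed.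
Let intXY A : G A -> (\int[P]_(w in A) (Y w)%:E = \int[P]_(w in A) (X w)%:E)%E.
Proof. by case: XY => _ _ _; apply. Qed.
Let GI A B : G A -> G B -> G (A `&` B).
Proof.
rewrite -sG => GA GB.
exact: (@measurableI _ (g_sigma_algebraType G)).
Qed.
Let GY B : measurable B -> G (Y @^-1` B).
Proof. by move=> mB; rewrite -sG -[X in _ X]setTI; exact: mYG. Qed.

Let integrableS1 A f : measurable A -> P.-integrable setT (EFin \o f) ->
  P.-integrable A (EFin \o f).
Proof. by move=> mA; apply: integrableS. Qed.

(** The parts of [A] where [Y] is nonnegative and where it is negative both belong to [G]; on each
    of them the integral of the absolute value is, up to sign, an integral of [X]. *)
Let condexp_sign A : G A ->
  (\int[P]_(w in A) `|Y w|%:E <= \int[P]_(w in A) `|X w|%:E)%E.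
Proof.
move=> GA; pose A1 := A `&` Y @^-1` `[0, +oo[; pose A2 := A `&` Y @^-1` `]-oo, 0[.
have G1 : G A1 by apply: GI => //; exact: GY.
have G2 : G A2 by apply: GI => //; exact: GY.
have [m1 m2] := (Gm G1, Gm G2).
have AE : A = A1 `|` A2.
  rewrite /A1 /A2 -setIUr [X in _ `&` X](_ : _ = setT) ?setIT//.
  apply/seteqP; split => // w _ /=; rewrite !in_itv/= andbT.
  by have [|] := leP 0 (Y w); [left|right].
have dA : [disjoint A1 & A2].
  apply/eqP/seteqP; split => // w [[_ /=]]; rewrite in_itv/= andbT => Y0.
  by move=> [_ /=]; rewrite in_itv/= ltNge Y0.
have mabs : measurable_fun setT (fun w => `|Y w|%:E).
  by apply/measurable_EFinP; exact: measurableT_comp.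
have leXY B : G B -> (`|\int[P]_(w in B) (Y w)%:E| <= \int[P]_(w in B) `|X w|%:E)%E.
  move=> GB; rewrite intXY//; apply: le_abse_integral; first exact: Gm.
  by apply/measurable_EFinP; exact: measurable_funTS.
rewrite AE !ge0_integral_setU//; last 2 first.
- by apply/measurable_EFinP; apply: measurable_funTS; exact: measurableT_comp.
- exact: measurable_funTS.
apply: leeD.
  apply: le_trans (leXY _ G1); apply: le_trans (lee_abs _).
  rewrite le_eqVlt; apply/orP; left; apply/eqP; apply: eq_integral => w.
  by rewrite inE => -[_ /=]; rewrite in_itv/= andbT => Y0; rewrite ger0_norm.
apply: le_trans (leXY _ G2); rewrite -abseN; apply: le_trans (lee_abs _).
rewrite -integralN; last exact/integrable_add_def/integrableS1.
rewrite le_eqVlt; apply/orP; left; apply/eqP; apply: eq_integral => w.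
by rewrite inE => -[_ /=]; rewrite in_itv/= => Y0; rewrite ltr0_norm.
Qed.

Let layer (s Z : Omega -> R) (x : Omega * measurableTypeR R) : \bar R :=
  (\1_[set x : Omega * measurableTypeR R | 0 <= x.2 < s x.1] x * Z x.1)%:E.

Let mlayer s Z : measurable_fun setT s -> measurable_fun setT Z ->
  measurable_fun setT (layer s Z).
Proof.
move=> ms mZ; apply/measurable_EFinP; apply: measurable_funM; last first.
  exact: measurableT_comp mZ measurable_fst.
apply: measurable_indic.
rewrite (_ : mkset _ = [set x : Omega * measurableTypeR R | 0 <= x.2] `\`
    [set x | s x.1 <= x.2]).
  have m2 : measurable_fun setT (fun x : Omega * measurableTypeR R => x.2 : R).
    exact: measurable_snd.
  apply: measurableD; apply: measurable_set_le => //.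
  exact: measurableT_comp ms measurable_fst.
apply/seteqP; split => x /=; first by move=> /andP[-> xs]; split => //; apply/negP; rewrite -ltNge.
by move=> [-> /negP]; rewrite -ltNge.
Qed.

Let layer_ge0 s Z : (forall w, 0 <= Z w) -> forall x, (0 <= layer s Z x)%E.
Proof. by move=> Z0 x; rewrite lee_fin mulr_ge0. Qed.

(* Tonelli, with [s = \int_0^s du]. *)
Let layer_cake (s Z : Omega -> R) : measurable_fun setT s -> (forall w, 0 <= s w) ->
  measurable_fun setT Z -> (forall w, 0 <= Z w) ->
  (\int[P]_w (s w * Z w)%:E = \int[mu]_u \int[P]_w layer s Z (w, u))%E.
Proof.
move=> ms s0 mZ Z0.
apply: (etrans _ (fubini_tonelli (layer s Z) (mlayer ms mZ) (layer_ge0 s Z0))).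
apply: eq_integral => w _; rewrite /layer/=.
transitivity (\int[mu]_u ((\1_`[0, s w[ u)%:E * (Z w)%:E))%E.
  rewrite ge0_integralZr//; last 2 first.
  - by apply/measurable_EFinP; exact: measurable_indic.
  - by rewrite lee_fin.
  rewrite integral_indic// setIT.
  rewrite [X in (X * _)%E](_ : _ = lebesgue_measure `[0, s w[%classic)//.
  rewrite lebesgue_measure_itv/= lte_fin.
  have := s0 w; rewrite le_eqVlt => /predU1P[<-|->].
    by rewrite ltxx mul0r mul0e.
  by rewrite oppr0 adde0.
by apply: eq_integral => u _; rewrite -EFinM; congr (_ * _)%:E.
Qed.

(** [condexp_sign] on the level sets of [s], integrated over the level. This brings in a weight
    without a product rule for conditional expectations. *)
Let condexp_weighted (s : Omega -> R) : measurable_fun setT s -> (forall w, 0 <= s w) ->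
  (forall u, G [set w | u < s w]) ->
  (\int[P]_w (s w * `|Y w|)%:E <= \int[P]_w (s w * `|X w|)%:E)%E.
Proof.
move=> ms s0 Gs.
have mn f : measurable_fun setT f -> measurable_fun setT (fun w : Omega => `|f w : R|).
  by move=> mf; exact: measurableT_comp.
rewrite !layer_cake//; last 2 first; [exact: mn|exact: mn|].
have mG (Z : Omega -> R) : measurable_fun setT Z -> measurable_fun setT
    (fun u => \int[P]_w layer s (fun w => `|Z w|%R) (w, u))%E.
  move=> mZ; apply: (measurable_fun_fubini_tonelli_G (layer s (fun w => `|Z w|))).
    exact: mlayer (mn _ mZ).
  exact: layer_ge0.
apply: ge0_le_integral => //.
- by move=> u _; apply: integral_ge0 => w _; exact: layer_ge0.
- exact: mG.
- exact: mG.
move=> u _; have [u0|u0] := leP 0 u; last first.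
  rewrite !integral0_eq// => w _; rewrite /layer indicE memNset ?mul0r//=;
  by rewrite leNgt u0.
have E (Z : Omega -> R) : (\int[P]_w layer s (fun w => `|Z w|%R) (w, u) =
    \int[P]_(w in [set w | (u < s w)%R]) `|Z w|%:E)%E.
  rewrite [RHS]integral_mkcond; apply: eq_integral => w _.
  rewrite /layer patchE indicE; have [us|us] := pselect (u < s w).
    by rewrite !mem_set ?mul1r//= u0 us.
  by rewrite !memNset ?mul0r//= u0/=.
by rewrite !E; exact: condexp_sign.
Qed.

(** [Y] is only known to be integrable, so the bound is proved for the truncations [s n] of its
    absolute value, through E[s_n^2] <= E[s_n |Y|] <= E[s_n |X|], and passed on by monotone
    convergence. *)
Lemma condexp_contraction : sqint P X ->
  sqint P Y /\ (\int[P]_w (Y w ^+ 2)%:E <= \int[P]_w (X w ^+ 2)%:E)%E.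
Proof.
move=> sX; pose s (n : nat) w := Num.min `|Y w| n%:R.
have ms n : measurable_fun setT (s n).
  by apply: measurable_minr => //; exact: measurableT_comp.
have s0 n w : 0 <= s n w by rewrite le_min normr_ge0/=.
have Gs n u : G [set w | u < s n w].
  rewrite (_ : mkset _ = Y @^-1` [set y | u < Num.min `|y| n%:R])//.
  apply: GY; rewrite -[X in measurable X]setTI.
  rewrite (_ : mkset _ = (fun y => Num.min `|y| n%:R) @^-1` `]u, +oo[).
    have : measurable_fun setT (fun y : R => Num.min `|y| n%:R).
      by apply: measurable_minr => //; exact: measurableT_comp.
    by apply.
  by apply/seteqP; split => y /=; rewrite in_itv/= andbT.
have bnd n w : `|s n w| <= n%:R by rewrite ger0_norm// /s ge_min lexx orbT.
have ss n : sqint P (s n) by apply: sqint_bounded => //; exists n%:R.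
have mY2 : measurable_fun setT (fun w => (Y w ^+ 2)%:E).
  by apply/measurable_EFinP; exact: measurable_funX.
have le n : (\int[P]_w (s n w ^+ 2)%:E <= \int[P]_w (X w ^+ 2)%:E)%E.
  have sXs := sqint_integrable_mul (ss n) sX.
  have h1 : ((ip P (s n) (s n))%:E <= (ip P (s n) (fun w => `|X w|))%:E)%E.
    rewrite ipE//.
    have sabs : sqint P (fun w => `|X w|).
      by apply: sqint_le sX _ => [|w]; [exact: measurableT_comp|rewrite normr_id].
    rewrite [leRHS]fineK; last exact: integrable_fin_num (sqint_integrable_mul _ _).
    apply: le_trans (condexp_weighted (ms n) (s0 n) (Gs n)).
    apply: ge0_le_integral => //.
    - by move=> w _; rewrite lee_fin sqr_ge0.
    - by apply/measurable_EFinP; exact: measurable_funX.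
    - apply/measurable_EFinP; apply: measurable_funM => //.
      exact: measurableT_comp.
    - by move=> w _; rewrite lee_fin expr2 ler_wpM2l// /s ge_min lexx.
  have sabs : sqint P (fun w => `|X w|).
    by apply: sqint_le sX _ => [|w]; [exact: measurableT_comp|rewrite normr_id].
  rewrite lee_fin in h1; rewrite -!ipE// lee_fin.
  (* Expanding this square and inserting [h1] leaves E[s_n^2] <= E[X^2]. *)
  have := ip_ge0 P (fun w => s n w - `|X w|).
  rewrite ipBB// (ipC _ (fun w => `|X w|) (s n)).
  have -> : ip P (fun w => `|X w|) (fun w => `|X w|) = ip P X X.
    by apply: eq_Rintegral => w _; rewrite -normrM ger0_norm// -expr2 sqr_ge0.
  lra.
have cv : (\int[P]_w (s n w ^+ 2)%:E)%E @[n --> \oo] --> (\int[P]_w (Y w ^+ 2)%:E)%E.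
  have -> : (\int[P]_w (Y w ^+ 2)%:E = \int[P]_w limn (fun n => (s n w ^+ 2)%:E))%E.
    apply: eq_integral => w _; apply/esym/cvg_lim => //; apply: cvg_near_cst.
    near=> n; rewrite /s min_l ?real_normK ?num_real//.
    near: n; exact: nbhs_infty_ger.
  apply: cvg_monotone_convergence => //.
  - by move=> n; apply/measurable_EFinP; exact: measurable_funX.
  - by move=> n w _; rewrite lee_fin sqr_ge0.
  - move=> w _ a b ab; rewrite lee_fin lerXn2r ?nnegrE//.
    by rewrite /s le_min !ge_min lexx/= ler_nat ab orbT.
have leY : (\int[P]_w (Y w ^+ 2)%:E <= \int[P]_w (X w ^+ 2)%:E)%E.
  rewrite -(cvg_lim _ cv)//; apply: lime_le; first by apply/cvg_ex; eexists; exact: cv.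
  by near=> n.
by split => //; split => //; apply: le_lt_trans leY sX.2.
Unshelve. all: by end_near. Qed.

End contraction.

End conditional_expectation.

(** * Approximation in finite time and L2 martingale convergence *)

Section martingale_convergence.
Context {R : realType} {disp : measure_display} {Omega : measurableType disp}.
Variables (P : probability Omega R) (d : nat) (W : Omega -> R -> 'cV[R]_d).
Hypothesis P_complete : measure_is_complete P.
Hypothesis W_brownian : is_brownian P W.
Local Notation Fmeas t xi :=
  (measurable_fun setT (xi : g_sigma_algebraType (filt P W t) -> R)).
Implicit Types X : Omega -> R.

(** [X] is an L2-limit of random variables known in finite time. *)
Definition finite_time_approx X : Prop := sqint P X /\
  forall e : R, 0 < e -> exists t X', [/\ 0 <= t, Fmeas t X', sqint P X' &
    ip P (fun w => X w - X' w) (fun w => X w - X' w) <= e].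

Lemma ip_add_le (f g : Omega -> R) : sqint P f -> sqint P g ->
  ip P (fun w => f w + g w) (fun w => f w + g w) <= 2 * (ip P f f + ip P g g).
Proof.
move=> sf sg; have := ip_ge0 P (fun w => f w - g w); rewrite ipBB//.
rewrite ipDl ?(ipDr _ _ (h := f)) ?(ipDr _ _ (h := g))//; last exact: sqintD.
rewrite (ipC P g f); lra.
Qed.

Lemma finite_time_approxD X1 X2 : finite_time_approx X1 ->
  finite_time_approx X2 -> finite_time_approx (fun w => X1 w + X2 w).
Proof.
move=> [s1 a1] [s2 a2]; split; first exact: sqintD.
move=> e e0; have e4 : 0 < e / 4 by rewrite divr_gt0.
have [t1 [Y1 [t10 m1 q1 l1]]] := a1 _ e4; have [t2 [Y2 [t20 m2 q2 l2]]] := a2 _ e4.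
exists (Num.max t1 t2), (fun w => Y1 w + Y2 w); split.
- by rewrite le_max t10.
- apply: measurable_funD; [apply: filt_fun_mono m1|apply: filt_fun_mono m2].
    by rewrite le_max lexx.
  by rewrite le_max lexx orbT.
- exact: sqintD.
- have -> : (fun w => X1 w + X2 w - (Y1 w + Y2 w)) =
      (fun w => (X1 w - Y1 w) + (X2 w - Y2 w)) by apply/funext => w; ring.
  apply: le_trans (ip_add_le (sqintB s1 q1) (sqintB s2 q2)) _; lra.
Qed.

Lemma finite_time_approxZ k X : finite_time_approx X ->
  finite_time_approx (fun w => k * X w).
Proof.
(* The tolerance is divided by [k ^+ 2 + 1] rather than [k ^+ 2] in order to allow [k = 0]. *)
move=> [s a]; split; first exact: sqintZ.
move=> e e0; have [|t [Y [t0 mY q l]]] := a (e / (k ^+ 2 + 1)).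
  by rewrite divr_gt0// ltr_wpDl// sqr_ge0.
exists t, (fun w => k * Y w); split => //; [exact: measurable_funM|exact: sqintZ|].
under eq_fun do rewrite -mulrBr.
have sB := sqintB s q; rewrite (ipZl _ sB (sqintZ k sB)) (ipZr _ sB sB) mulrA -expr2.
have k1 : 0 < k ^+ 2 + 1 by rewrite ltr_wpDl// sqr_ge0.
rewrite ler_pdivlMr// in l; have := ip_ge0 P (fun w => X w - Y w); nra.
Qed.

Lemma finite_time_approx_lim X (X_ : nat -> Omega -> R) : measurable_fun setT X ->
  (forall n, finite_time_approx (X_ n)) ->
  (\int[P]_w ((X_ n w - X w) ^+ 2)%:E)%E @[n --> \oo] --> 0%E ->
  finite_time_approx X.
Proof.
move=> mX aX cX; have [sX] := sqint_lim mX (fun n => (aX n).1) cX.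
move=> /cvgrPdist_le cip; split => // e e0.
have e4 : 0 < e / 4 by rewrite divr_gt0.
have [N _ /(_ N (leqnn N))/=] := cip _ e4; rewrite sub0r normrN ger0_norm ?ip_ge0// => le1.
have [sN /(_ _ e4)[t [Y [t0 mY q l]]]] := aX N.
exists t, Y; split => //.
have -> : (fun w => X w - Y w) = (fun w => - (X_ N w - X w) + (X_ N w - Y w)).
  by apply/funext => w; ring.
have s1 := sqintB sN sX; have s2 := sqintB sN q.
apply: le_trans (ip_add_le (sqintN s1) s2) _.
have -> : ip P (fun w => - (X_ N w - X w)) (fun w => - (X_ N w - X w)) =
    ip P (fun w => X_ N w - X w) (fun w => X_ N w - X w).
  by apply: eq_Rintegral => w _; rewrite mulrNN.
lra.
Qed.

Lemma finite_time_approx_Fmeas t X : 0 <= t -> Fmeas t X -> sqint P X ->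
  finite_time_approx X.
Proof.
move=> t0 mX sX; split => // e e0; exists t, X; split => //.
rewrite (_ : (fun w => X w - X w) = cst 0) ?ip0l ?ltW//.
by apply/funext => w; rewrite subrr.
Qed.

Lemma finite_time_approx0 : finite_time_approx (cst 0).
Proof. by apply: (finite_time_approx_Fmeas (lexx 0)) => //; exact: sqint0. Qed.

Lemma sqint_indic A : measurable A -> sqint P \1_A.
Proof.
move=> mA; apply: sqint_bounded => //; exists 1 => w.
by rewrite ger0_norm// indicE; case: (_ \in _).
Qed.

(** Dynkin argument: the events whose indicator can be approximated are stable under complements and
    disjoint unions, and the events known at some finite time are stable under intersection because
    the filtration increases. *)
Lemma finite_time_approx_indic A : filt_oo P W A -> finite_time_approx \1_A.
Proof.
pose C := [set A | finite_time_approx \1_A].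
have mfilt t B : filt P W t B -> measurable B by exact: measurable_filt.
have aT : finite_time_approx \1_setT.
  apply: (finite_time_approx_Fmeas (lexx 0)); last exact: sqint_indic.
  exact: measurable_indic.
suff /(_ A) : filt_oo P W `<=` [set A | measurable A /\ C A] by move=> + h => /(_ h)[].
have dynC : dynkin [set A | measurable A /\ C A].
  split => [|B [mB aB]|F tF aF]; first by split.
    split; first exact: measurableC.
    rewrite /C/=; have -> : \1_(~` B) = (fun w => \1_setT w + (-1) * \1_B w) :> (Omega -> R).
      by apply/funext => w; rewrite !indicE in_setC in_setT; case: (_ \in _) => /=; ring.
    by apply: finite_time_approxD => //; exact: finite_time_approxZ.
  have mF n : measurable (F n) by case: (aF n).
  split; first exact: bigcupT_measurable.
  (* By disjointness the indicator of a partial union is a sum of indicators; the partial unions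
     converge to the full one, dominated by 1. *)
  pose U n := \big[setU/set0]_(i < n) F i.
  have UE n : U n = \bigcup_(i < n) F i by rewrite bigcup_mkord.
  have mU n : measurable (U n) by exact: bigsetU_measurable.
  have aU n : finite_time_approx \1_(U n).
    rewrite /U; elim: n => [|n ih].
      by rewrite big_ord0 indic0; exact: finite_time_approx0.
    rewrite big_ord_recr/= -/(U n) (_ : \1__ = (fun w => \1_(U n) w + \1_(F n) w)).
      by apply: finite_time_approxD => //; case: (aF n).
    apply/funext => w; rewrite !indicE in_setU.
    have [Un|Un] := pselect (U n w); last by rewrite (memNset Un) add0r.
    rewrite (mem_set Un) memNset ?addr0// => Fn.
    have : (\bigcup_(i < n) F i) w by rewrite -UE.
    move=> [i /= ilt Fi].
    by move: ilt; rewrite (tF i n)// ?ltnn//; exists w.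
  apply: (finite_time_approx_lim _ aU); first exact/measurable_indic/bigcupT_measurable.
  apply: (sqint_dominated (g := cst 1)) => //.
  - exact/measurable_indic/bigcupT_measurable.
  - by move=> n; exact: measurable_indic.
  - move=> w; have [[i _ Fi]|nF] := pselect ((\bigcup_n F n) w).
      apply: cvg_near_cst; near=> n; rewrite UE !indicE !mem_set//; first by exists i.
      by exists i => //=; near: n; exact: nbhs_infty_gt.
    apply: cvg_near_cst; near=> n; rewrite UE !indicE !memNset//.
    by move=> [i _ Fi]; apply: nF; exists i.
  - by apply: sqint_bounded => //; exists 1 => w; rewrite normr1.
  - move=> n w; rewrite normr1 !indicE.
    by do 2!case: (_ \in _); rewrite /= ?subrr ?subr0 ?sub0r ?normrN ?normr1 ?normr0.
have setI_filt : setI_closed (\bigcup_(t in [set t | 0 <= t]) filt P W t).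
  move=> B B' [t t0 fB] [t' t0' fB'].
  exists (Num.max t t'); first by rewrite /= le_max t0.
  rewrite -filt_sigma_algebra.
  apply: (@measurableI _ (g_sigma_algebraType (filt P W (Num.max t t'))));
    apply: sub_sigma_algebra; [apply: filt_mono fB|apply: filt_mono fB'].
    by rewrite le_max lexx.
  by rewrite le_max lexx orbT.
rewrite /filt_oo -setI_closed_g_dynkin_g_sigma_algebra//.
apply: smallest_sub => // B [t t0 fB]; split; first exact: mfilt fB.
apply: (finite_time_approx_Fmeas t0); last by apply: sqint_indic; exact: mfilt fB.
apply: (@measurable_indic _ (g_sigma_algebraType (filt P W t))).
exact: sub_sigma_algebra.
Unshelve. all: by end_near. Qed.

Lemma finite_time_approx_sum I (r : seq I) (F : I -> Omega -> R) :
  (forall i, finite_time_approx (F i)) ->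
  finite_time_approx (fun w => \sum_(i <- r) F i w).
Proof.
move=> aF; elim: r => [|i r ih].
  under eq_fun do rewrite big_nil.
  exact: finite_time_approx0.
under eq_fun do rewrite big_cons.
exact: finite_time_approxD.
Qed.

Import HBNNSimple.

Let Foo := g_sigma_algebraType (filt_oo P W).

Let Foo_meas (X : Omega -> R) : measurable_fun setT (X : Foo -> R) ->
  measurable_fun setT X.
Proof. by apply: sub_sigma_measurable_fun => A; exact: measurable_filt_oo. Qed.

(** The approximating simple functions are taken over [Foo], so that their level sets are events of
    [filt_oo]; they lie between 0 and [X], and [X] itself dominates the error. *)
Let finite_time_approx_ge0 X : measurable_fun setT (X : Foo -> R) ->
  sqint P X -> (forall w, 0 <= X w) -> finite_time_approx X.
Proof.
move=> mX sX X0.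
have mEX : measurable_fun setT (EFin \o (X : Foo -> R)) by exact/measurable_EFinP.
pose f n : {nnsfun Foo >-> R} := nnsfun_approx measurableT mEX n.
have f0 w : setT w -> (0 <= (EFin \o (X : Foo -> R)) w)%E by rewrite lee_fin.
have mf n : measurable_fun setT (fun w : Omega => f n w) by exact: Foo_meas.
have fX n w : 0 <= f n w <= X w.
  apply/andP; split => //; rewrite -lee_fin /f nnsfun_approxE.
  exact: le_approx.
apply: (finite_time_approx_lim (X_ := fun n w => f n w)).
- exact: sX.1.
- move=> n; under eq_fun do rewrite fimfunEord.
  apply: finite_time_approx_sum => i; apply: finite_time_approxZ.
  apply: finite_time_approx_indic.
  have mset r : filt_oo P W (f n @^-1` [set r]).
    have sFoo : <<s filt_oo P W >> `<=` filt_oo P W.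
      by rewrite sigma_algebra_id//; exact: smallest_sigma_algebra.
    apply: sFoo.
    have : measurable (f n @^-1` [set r]) by exact: measurable_sfunP.
    exact.
  exact: mset.
- apply: (sqint_dominated (g := X)) => //; first exact: sX.1.
    move=> w; have := cvg_nnsfun_approx measurableT mEX f0 (I : setT w).
    by move=> /fine_cvgP[_].
  move=> n w; have /andP[f0' fX'] := fX n w.
  by rewrite distrC ger0_norm ?subr_ge0// ger0_norm// gerBl.
Qed.

Lemma finite_time_approx_sqint X : measurable_fun setT (X : Foo -> R) ->
  sqint P X -> finite_time_approx X.
Proof.
move=> mX sX.
have aux (Y : Omega -> R) : measurable_fun setT (Y : Foo -> R) -> sqint P Y ->
    finite_time_approx (fun w => Num.max (Y w) 0).
  move=> mY sY; have mM : measurable_fun setT ((fun w => Num.max (Y w) 0) : Foo -> R).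
    exact: measurable_maxr.
  apply: finite_time_approx_ge0 => //.
    apply: sqint_le sY _ => [|w]; first exact: Foo_meas.
    by rewrite ger0_norm ?le_max ?lexx ?orbT// ge_max ler_norm normr_ge0.
  by move=> w; rewrite le_max lexx orbT.
have -> : X = (fun w => Num.max (X w) 0 + (-1) * Num.max (- X w) 0).
  by apply/funext => w; case: leP => ?; case: leP => ?; lra.
apply: finite_time_approxD; first exact: aux.
apply: finite_time_approxZ; apply: (aux (fun w => - X w)); last exact: sqintN.
exact: measurable_funN.
Qed.

(** Let [X'], known at time [t0], approximate [X]. For [t >= t0], [Y - X'] is a version of the
    conditional expectation of [X - X'], hence no larger in L2. The triangle inequality in the form
    (x + y)^2 <= 2 (x^2 + y^2) costs a factor 4, which explains the tolerance [e / 4]. *)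
Lemma condexp_cvg X : measurable_fun setT (X : Foo -> R) -> sqint P X ->
  forall e : R, 0 < e -> exists2 t0, 0 <= t0 & forall t Y, t0 <= t ->
    is_condexp P (filt P W t) X Y ->
    (\int[P]_w ((X w - Y w) ^+ 2)%:E <= e%:E)%E.
Proof.
move=> mX sX e e0; have [_ /(_ (e / 4))[|t0 [X' [t00 mX' sX' le]]]] :=
  finite_time_approx_sqint mX sX; first by rewrite divr_gt0.
exists t0 => // t Y t0t XY.
have iX' : P.-integrable setT (EFin \o X').
  have := sqint_integrable_mul sX' (sqint_indic measurableT).
  by apply: eq_integrable => // w _; rewrite /= indicT mulr1.
have [iX mY iY intXY] := XY.
have mX't := filt_fun_mono t0t mX'.
have sXX' := sqintB sX sX'.
have [] := @condexp_contraction _ _ _ P (filt P W t) (fun w => X w - X' w)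
    (fun w => Y w - X' w) (filt_sigma_algebra _ _ _) _ _ sXX'.
- by move=> A; exact: measurable_filt.
- split.
  + exact: (integrableB measurableT iX iX').
  + exact: measurable_funB.
  + exact: (integrableB measurableT iY iX').
  + move=> A fA; have mA := measurable_filt P_complete W_brownian fA.
    have iS f : P.-integrable setT (EFin \o f) -> P.-integrable A (EFin \o f).
      by move=> i; exact: integrableS i.
    under eq_integral do rewrite EFinB.
    under [RHS]eq_integral do rewrite EFinB.
    by rewrite !integralB_EFin ?intXY//; exact: iS.
move=> sYX' le2'; have le2 : ip P (fun w => Y w - X' w) (fun w => Y w - X' w) <=
    ip P (fun w => X w - X' w) (fun w => X w - X' w) by rewrite -lee_fin !ipE.
have -> : (fun w => ((X w - Y w) ^+ 2)%:E) =
    (fun w => (((X w - X' w) + - (Y w - X' w)) ^+ 2)%:E).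
  by apply/funext => w; congr EFin; ring.
apply: (le_trans (y := (ip P (fun w => (X w - X' w) + - (Y w - X' w))
  (fun w => (X w - X' w) + - (Y w - X' w)))%:E)).
  by rewrite ipE//; apply: sqintD => //; exact: sqintN.
rewrite lee_fin; apply: le_trans (ip_add_le sXX' (sqintN sYX')) _.
have -> : ip P (fun w => - (Y w - X' w)) (fun w => - (Y w - X' w)) =
    ip P (fun w => Y w - X' w) (fun w => Y w - X' w).
  by apply: eq_Rintegral => w _; rewrite mulrNN.
lra.
Qed.

End martingale_convergence.

(** * The deterministic Volterra estimate *)

Section volterra.
Context {R : realType}.
Local Notation TR := (measurableTypeR R).
Local Notation mu := (@lebesgue_measure R).

Lemma ge0_integralT_shift (f : TR -> \bar R) (c : R) :
  measurable_fun setT f -> (forall x, 0 <= f x)%E ->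
  (\int[mu]_x f (x + c)%R = \int[mu]_x f x)%E.
Proof.
move=> mf f0.
have mc : measurable_fun setT (fun x : TR => x + c : TR).
  by apply: measurable_funD => //; exact: measurable_cst.
transitivity (\int[pushforward mu (fun x : TR => (x + c)%R : TR)]_x f x)%E.
  by rewrite ge0_integral_pushforward.
apply: eq_measure_integral => A mA _; apply/esym/lebesgue_measure_unique => //=.
move=> _ [[a b]] _ <-; rewrite /pushforward/=.
rewrite (_ : (fun x : R => x + c) @^-1` `]a, b] = `]a - c, b - c]%classic); last first.
  by apply/seteqP; split => x; rewrite /= !in_itv/= ltrBlDr lerBrDr.
rewrite !lebesgue_measure_itv/= !lte_fin ltrD2r.
by case: ifP => // _; rewrite -!EFinB; congr EFin; ring.
Qed.

Lemma amgm_integral (k f : TR -> R) (s : R) : 0 < s ->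
  measurable_fun setT k -> measurable_fun setT f ->
  (forall x, 0 <= k x) -> (forall x, 0 <= f x) ->
  (\int[mu]_x (k x * f x)%:E <= (s / 2)%:E * \int[mu]_x (k x ^+ 2)%:E +
    (2 * s)^-1%:E * \int[mu]_x (f x ^+ 2)%:E)%E.
Proof.
move=> s0 mk mf k0 f0.
rewrite -ge0_integralZl//; last 3 first.
- by apply/measurable_EFinP; exact: measurable_funX.
- by move=> x _; rewrite lee_fin sqr_ge0.
- by rewrite lee_fin divr_ge0// ltW.
rewrite -ge0_integralZl//; last 3 first.
- by apply/measurable_EFinP; exact: measurable_funX.
- by move=> x _; rewrite lee_fin sqr_ge0.
- by rewrite lee_fin invr_ge0 mulr_ge0// ltW.
rewrite -ge0_integralD//; last 4 first.
- by move=> x _; rewrite mule_ge0// lee_fin ?sqr_ge0// divr_ge0// ltW.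
- by apply: measurable_funeM; apply/measurable_EFinP; exact: measurable_funX.
- by move=> x _; rewrite mule_ge0// lee_fin ?sqr_ge0// invr_ge0 mulr_ge0// ltW.
- by apply: measurable_funeM; apply/measurable_EFinP; exact: measurable_funX.
apply: ge0_le_integral => //.
- by move=> x _; rewrite lee_fin mulr_ge0.
- by apply/measurable_EFinP; exact: measurable_funM.
- by apply: emeasurable_funD; apply: measurable_funeM;
    apply/measurable_EFinP; exact: measurable_funX.
move=> x _; rewrite -!EFinM -EFinD lee_fin.
have -> : s / 2 * k x ^+ 2 + (2 * s)^-1 * f x ^+ 2 =
    k x * f x + (s * k x - f x) ^+ 2 / (2 * s) by field; rewrite gt_eqF.
by rewrite lerDl divr_ge0 ?sqr_ge0// mulr_ge0// ltW.
Qed.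

(* AM-GM for each of the three integrals, with the common parameter
   [V / (c1 + c2 + c3)], replaces Cauchy-Schwarz. *)
Lemma kernel_sqr_bound (V : R) (k1 k2 k3 f1 f2 f3 : TR -> R) (c1 c2 c3 : R) :
  0 <= V -> 0 < c1 -> 0 < c2 -> 0 < c3 ->
  measurable_fun setT k1 -> measurable_fun setT k2 -> measurable_fun setT k3 ->
  measurable_fun setT f1 -> measurable_fun setT f2 -> measurable_fun setT f3 ->
  (forall x, 0 <= k1 x) -> (forall x, 0 <= k2 x) -> (forall x, 0 <= k3 x) ->
  (forall x, 0 <= f1 x) -> (forall x, 0 <= f2 x) -> (forall x, 0 <= f3 x) ->
  (\int[mu]_x (k1 x)%:E <= c1%:E)%E ->
  (\int[mu]_x (k2 x ^+ 2)%:E <= (c2 ^+ 2)%:E)%E ->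
  (\int[mu]_x (k3 x ^+ 2)%:E <= (c3 ^+ 2)%:E)%E ->
  (V%:E <= \int[mu]_x (k1 x * f1 x + k2 x * f2 x + k3 x * f3 x)%:E)%E ->
  ((V ^+ 2)%:E <= (c1 + c2 + c3)%:E * (\int[mu]_x (k1 x * f1 x ^+ 2)%:E +
     c2%:E * \int[mu]_x (f2 x ^+ 2)%:E + c3%:E * \int[mu]_x (f3 x ^+ 2)%:E))%E.
Proof.
move=> V0 c10 c20 c30 mk1 mk2 mk3 mf1 mf2 mf3 k10 k20 k30 f10 f20 f30 b1 b2 b3.
have ge0I (h : TR -> R) : (forall x, 0 <= h x) -> (0 <= \int[mu]_x (h x)%:E)%E.
  by move=> h0; apply: integral_ge0 => x _; rewrite lee_fin.
have mulf0 (k f : TR -> R) : (forall x, 0 <= k x) -> (forall x, 0 <= f x) ->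
    forall x, setT x -> (0 <= (k x * f x)%:E)%E.
  by move=> k0 f0 x _; rewrite lee_fin mulr_ge0.
have mkf (k f : TR -> R) : measurable_fun setT k -> measurable_fun setT f ->
    measurable_fun setT (fun x => (k x * f x)%:E).
  by move=> mk mf; apply/measurable_EFinP; exact: measurable_funM.
under eq_integral do rewrite 2!EFinD.
rewrite ge0_integralD//; last 4 first.
- by move=> x _; rewrite adde_ge0// ?mulf0.
- by apply: emeasurable_funD; exact: mkf.
- exact: mulf0.
- exact: mkf.
rewrite ge0_integralD//; last 4 first.
- exact: mulf0.
- exact: mkf.
- exact: mulf0.
- exact: mkf.
have I1 : (0 <= \int[mu]_x (k1 x * f1 x ^+ 2)%:E)%E.
  by apply: ge0I => x; rewrite mulr_ge0 ?sqr_ge0.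
have I2 : (0 <= \int[mu]_x (f2 x ^+ 2)%:E)%E by apply: ge0I => x; rewrite sqr_ge0.
have I3 : (0 <= \int[mu]_x (f3 x ^+ 2)%:E)%E by apply: ge0I => x; rewrite sqr_ge0.
(* The AM-GM parameter is proportional to [V] and has to be positive. *)
have [->|Vn0] := eqVneq V 0.
  move=> _; rewrite expr0n; apply: mule_ge0.
    by rewrite lee_fin !addr_ge0// ltW.
  by do 2?[apply: adde_ge0] => //; apply: mule_ge0; rewrite // lee_fin ltW.
have {V0 Vn0}V0 : 0 < V by rewrite lt_neqAle eq_sym Vn0.
have kap0 : 0 < c1 + c2 + c3 by rewrite !addr_gt0.
pose t := V / (c1 + c2 + c3); have t0 : 0 < t by rewrite divr_gt0.
(* [k1] is controlled in L1 only, so its square root is put on each factor; one copy of [k1] remains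
   attached to [f1 ^+ 2]. *)
have a1 : (\int[mu]_x (k1 x * f1 x)%:E <= (t / 2)%:E * \int[mu]_x (k1 x)%:E +
    (2 * t)^-1%:E * \int[mu]_x (k1 x * f1 x ^+ 2)%:E)%E.
  have ms : measurable_fun setT (fun x => Num.sqrt (k1 x)).
    apply: (@measurableT_comp _ _ _ _ _ _ (@Num.sqrt R)) mk1.
    exact: continuous_measurable_fun (@sqrt_continuous R).
  have e1 : (\int[mu]_x (k1 x * f1 x)%:E =
      \int[mu]_x (Num.sqrt (k1 x) * (Num.sqrt (k1 x) * f1 x))%:E)%E.
    by apply: eq_integral => x _; rewrite mulrA -expr2 sqr_sqrtr.
  have e2 : (\int[mu]_x (k1 x)%:E = \int[mu]_x (Num.sqrt (k1 x) ^+ 2)%:E)%E.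
    by apply: eq_integral => x _; rewrite sqr_sqrtr.
  have e3 : (\int[mu]_x (k1 x * f1 x ^+ 2)%:E =
      \int[mu]_x ((Num.sqrt (k1 x) * f1 x) ^+ 2)%:E)%E.
    by apply: eq_integral => x _; rewrite exprMn sqr_sqrtr.
  rewrite e1 e2 e3; apply: amgm_integral => //; first exact: measurable_funM.
  by move=> x; rewrite mulr_ge0 ?sqrtr_ge0.
(* Dividing [t] by the L2 bound of the kernel turns its square into a single factor, so that all
   three estimates have the shape c t / 2 + (...) / (2 t). *)
have a2 := @amgm_integral k2 f2 (t / c2) (divr_gt0 t0 c20) mk2 mf2 k20 f20.
have a3 := @amgm_integral k3 f3 (t / c3) (divr_gt0 t0 c30) mk3 mf3 k30 f30.
move=> /le_trans/(_ (leeD (leeD a1 a2) a3)).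
move: I1 I2 I3.
have : (0 <= \int[mu]_x (k1 x)%:E)%E by exact: ge0I.
have : (0 <= \int[mu]_x (k2 x ^+ 2)%:E)%E by apply: ge0I => x; rewrite sqr_ge0.
have : (0 <= \int[mu]_x (k3 x ^+ 2)%:E)%E by apply: ge0I => x; rewrite sqr_ge0.
move: b1 b2 b3.
move: (integral _ _ (fun x => (k1 x)%:E)) => [m1| |]//.
move: (integral _ _ (fun x => (k2 x ^+ 2)%:E)) => [m2| |]//.
move: (integral _ _ (fun x => (k3 x ^+ 2)%:E)) => [m3| |]//.
have y0 (c : R) : 0 < c -> (c%:E * +oo = +oo)%E by move=> ?; rewrite gt0_muley ?lte_fin.
(* If an integral on the right is infinite, so is the bound; otherwise the computation is in the
   reals. *)
move: (integral _ _ (fun x => (k1 x * f1 x ^+ 2)%:E)) => [i1| |]//; last first.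
  move=> _ _ _ _ _ _ _ i2 i3 _; rewrite !addye ?y0 ?leey//.
  - by rewrite gt_eqF// (lt_le_trans (ltNyr 0))// mule_ge0// lee_fin ltW.
  - by rewrite gt_eqF// (lt_le_trans (ltNyr 0))// mule_ge0// lee_fin ltW.
move: (integral _ _ (fun x => (f2 x ^+ 2)%:E)) => [i2| |]//; last first.
  move=> _ _ _ _ _ _ _ _ i3 _; rewrite y0//= addye ?y0 ?leey//.
  by rewrite gt_eqF// (lt_le_trans (ltNyr 0))// mule_ge0// lee_fin ltW.
move: (integral _ _ (fun x => (f3 x ^+ 2)%:E)) => [i3| |]//; last first.
  by move=> *; rewrite y0//= y0// leey.
rewrite -?EFinM -?EFinD -?EFinM ?lee_fin.
move=> b1 b2 b3 _ _ _ i10 i20 i30 le1.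
have le2 : V <= t / 2 * (c1 + c2 + c3) + (2 * t)^-1 * (i1 + c2 * i2 + c3 * i3).
  apply: (le_trans le1).
  have e2 : (2 * (t / c2))^-1 * i2 = (2 * t)^-1 * (c2 * i2).
    by field; rewrite !gt_eqF.
  have e3 : (2 * (t / c3))^-1 * i3 = (2 * t)^-1 * (c3 * i3).
    by field; rewrite !gt_eqF.
  have l1 : t / 2 * m1 <= t / 2 * c1 by rewrite ler_wpM2l// divr_ge0// ltW.
  have l2 : t / c2 / 2 * m2 <= t / 2 * c2.
    apply: (@le_trans _ _ (t / c2 / 2 * c2 ^+ 2)).
      by rewrite ler_wpM2l// divr_ge0// divr_ge0// ltW.
    by rewrite le_eqVlt; apply/orP; left; apply/eqP; field; rewrite gt_eqF.
  have l3 : t / c3 / 2 * m3 <= t / 2 * c3.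
    apply: (@le_trans _ _ (t / c3 / 2 * c3 ^+ 2)).
      by rewrite ler_wpM2l// divr_ge0// divr_ge0// ltW.
    by rewrite le_eqVlt; apply/orP; left; apply/eqP; field; rewrite gt_eqF.
  rewrite e2 e3; lra.
(* With t = V / (c1 + c2 + c3) the kernel part equals [V / 2]; the other half of [V] is left, and
   multiplying by [2 * V] gives the claim. *)
move: le2; rewrite (_ : t / 2 * _ = V / 2); last by rewrite /t; field; rewrite gt_eqF.
rewrite -lerBlDl (_ : V - V / 2 = V / 2); last by field.
rewrite (_ : (2 * t)^-1 * _ = (c1 + c2 + c3) * (i1 + c2 * i2 + c3 * i3) / V / 2); last first.
  by rewrite /t; field; rewrite !gt_eqF.
by rewrite ler_pM2r ?invr_gt0// ler_pdivlMr// -expr2.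
Qed.

(** Integration in [t] bounds the kernel terms by c1 A + c2 B + c3 A, with A and B the integrals of
    [a] and [b]: for the last one, Tonelli exchanges the arguments of [h]. The hypothesis already
    contains one factor (1 - kappa)^-1 and absorption produces the second; subtraction is allowed
    because A + B is finite. *)
Lemma volterra_bound (a b q : TR -> \bar R) (h : TR * TR -> \bar R)
    (k : TR -> R) (c1 c2 c3 : R) :
  measurable_fun setT a -> measurable_fun setT b -> measurable_fun setT q ->
  measurable_fun setT h -> measurable_fun setT k ->
  (forall t, 0 <= a t)%E -> (forall t, 0 <= b t)%E -> (forall t, 0 <= q t)%E ->
  (forall x, 0 <= h x)%E -> (forall t, 0 <= k t) ->
  0 <= c1 -> 0 <= c2 -> 0 <= c3 -> c1 + c2 + c3 < 1 ->
  (\int[mu]_t (k t)%:E <= c1%:E)%E ->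
  {ae mu, forall t, (a t + b t <= (1 - (c1 + c2 + c3))^-1%:E * q t +
    (\int[mu]_s ((k (s - t)%R)%:E * a s) + c2%:E * b t +
     c3%:E * \int[mu]_s h (s, t)))%E} ->
  {ae mu, forall t, (\int[mu]_s h (t, s) <= a t)%E} ->
  (\int[mu]_t a t + \int[mu]_t b t < +oo)%E ->
  (\int[mu]_t a t + \int[mu]_t b t <=
    ((1 - (c1 + c2 + c3))^-1 ^+ 2)%:E * \int[mu]_t q t)%E.
Proof.
move=> ma mb mq mh mk a0 b0 q0 h0 k0 c10 c20 c30 kap kc1 ineq hle fin.
set e := 1 - (c1 + c2 + c3); have e0 : 0 < e by rewrite subr_gt0.
have mka : measurable_fun setT (fun x : TR * TR => (k (x.2 - x.1)%R)%:E * a x.2)%E.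
  apply: emeasurable_funM; last exact: measurableT_comp ma measurable_snd.
  apply/measurable_EFinP; apply: (measurableT_comp mk).
  by apply: measurable_funB; [exact: measurable_snd|exact: measurable_fst].
have ka0 x : (0 <= (k (x.2 - x.1)%R)%:E * a x.2)%E by rewrite mule_ge0// lee_fin.
have mF : measurable_fun setT (fun t : TR => \int[mu]_s ((k (s - t)%R)%:E * a s))%E.
  exact: (measurable_fun_fubini_tonelli_F _ mka ka0).
have mG : measurable_fun setT (fun t : TR => \int[mu]_s h (s, t))%E.
  exact: (measurable_fun_fubini_tonelli_G _ mh h0).
have mH : measurable_fun setT (fun t : TR => \int[mu]_s h (t, s))%E.
  exact: (measurable_fun_fubini_tonelli_F _ mh h0).
have I0 (f : TR -> \bar R) : (forall t, 0 <= f t)%E -> (0 <= \int[mu]_t f t)%E.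
  by move=> f0; apply: integral_ge0.
have kaE : (\int[mu]_t \int[mu]_s ((k (s - t)%R)%:E * a s) <= c1%:E * \int[mu]_t a t)%E.
  rewrite (fubini_tonelli (fun x : TR * TR => (k (x.2 - x.1)%R)%:E * a x.2)%E)//=.
  rewrite -[leRHS]ge0_integralZl ?lee_fin//.
  apply: ge0_le_integral => //.
  - by move=> s _; apply: I0 => t; exact: (ka0 (t, s)).
  - exact: (measurable_fun_fubini_tonelli_G _ mka ka0).
  - exact: measurable_funeM.
  move=> s _; rewrite ge0_integralZr//; last 2 first.
  - apply/measurable_EFinP; apply: (measurableT_comp mk).
    by apply: measurable_funB => //; exact: measurable_cst.
  - by move=> t _; rewrite lee_fin.
  apply: lee_wpmul2r => //; apply: le_trans kc1.
  rewrite le_eqVlt; apply/orP; left; apply/eqP.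
  (* The integration variable is [t] with [s] fixed, so a reflection and a translation recover the
     mass of [k]. *)
  rewrite -(@ge0_integralT_opp _ (fun t => (k t)%:E)); last 2 first.
  - exact/measurable_EFinP.
  - by move=> t; rewrite lee_fin.
  rewrite -(@ge0_integralT_shift (fun t => (k (- t))%:E) (- s)); last 2 first.
  - apply/measurable_EFinP; apply: (measurableT_comp mk); exact: oppr_measurable.
  - by move=> t; rewrite lee_fin.
  by apply: eq_integral => t _; rewrite opprB.
have hE : (\int[mu]_t \int[mu]_s h (s, t) <= \int[mu]_t a t)%E.
  rewrite -(fubini_tonelli h)//; apply: ae_ge0_le_integral => //.
    by move=> t _; apply: I0.
  by apply: filterS hle => t + _.
have ei0 : (0 <= e^-1%:E :> \bar R)%E by rewrite lee_fin invr_ge0 ltW.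
have k_ge0 (t : TR) : (0 <= \int[mu]_s ((k (s - t)%R)%:E * a s))%E.
  by apply: I0 => s; exact: (ka0 (t, s)).
have cb0 (t : TR) : (0 <= c2%:E * b t)%E by rewrite mule_ge0 ?lee_fin.
have ch0 (t : TR) : (0 <= c3%:E * \int[mu]_s h (s, t))%E.
  by apply: mule_ge0; [rewrite lee_fin|exact: I0].
have kb0 (t : TR) : (0 <= \int[mu]_s ((k (s - t)%R)%:E * a s) + c2%:E * b t)%E.
  exact: adde_ge0.
have kbh0 (t : TR) : (0 <= \int[mu]_s ((k (s - t)%R)%:E * a s) + c2%:E * b t +
    c3%:E * \int[mu]_s h (s, t))%E by exact: adde_ge0.
have : (\int[mu]_t (a t + b t) <= \int[mu]_t (e^-1%:E * q t +
    (\int[mu]_s ((k (s - t)%R)%:E * a s) + c2%:E * b t +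
     c3%:E * \int[mu]_s h (s, t))))%E.
  apply: ae_ge0_le_integral => //.
  - by move=> t _; exact: adde_ge0.
  - exact: emeasurable_funD.
  - by move=> t _; apply: adde_ge0 => //; exact: mule_ge0.
  - apply: emeasurable_funD; first exact: measurable_funeM.
    apply: emeasurable_funD; last exact: measurable_funeM.
    by apply: emeasurable_funD => //; exact: measurable_funeM.
  - by apply: filterS ineq => t + _.
have mcb : measurable_fun setT (fun t => c2%:E * b t)%E by exact: measurable_funeM.
have mch : measurable_fun setT (fun t : TR => c3%:E * \int[mu]_s h (s, t))%E.
  exact: measurable_funeM.
have meq : measurable_fun setT (fun t => e^-1%:E * q t)%E by exact: measurable_funeM.
have eq0 t : (0 <= e^-1%:E * q t)%E by exact: mule_ge0.
rewrite ge0_integralD// ge0_integralD//; last first.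
  by apply: emeasurable_funD => //; exact: emeasurable_funD.
rewrite ge0_integralD//; last exact: emeasurable_funD.
rewrite ge0_integralD//.
rewrite !ge0_integralZl//; last by move=> t _; exact: I0.
move=> le1.
have {le1 kaE hE} : (\int[mu]_t a t + \int[mu]_t b t <= e^-1%:E * \int[mu]_t q t +
    (c1%:E * \int[mu]_t a t + c2%:E * \int[mu]_t b t + c3%:E * \int[mu]_t a t))%E.
  apply: (le_trans le1); apply: leeD => //; apply: leeD; first exact: leeD.
  by apply: lee_wpmul2l; rewrite ?lee_fin.
have := I0 _ a0; have := I0 _ b0; have := I0 _ q0.
move: fin.
move: (integral _ _ a) => [na| |]//; move: (integral _ _ b) => [nb| |]//.
move: (integral _ _ q) => [nq| |]//; last first.
  by move=> *; rewrite gt0_muley ?leey// lte_fin exprn_gt0// invr_gt0.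
rewrite -!EFinM -!EFinD !lee_fin => _ nq0 nb0 na0 le1.
rewrite expr2 -mulrA -(ler_pM2l e0) mulrA divff ?gt_eqF// mul1r /e.
move: le1; rewrite /e; move: (_^-1 * nq) => z le1.
(* These products make up the difference between (c1 + c2 + c3) (A + B) and c1 A + c2 B + c3 A. *)
have := mulr_ge0 c20 na0; have := mulr_ge0 c10 nb0; have := mulr_ge0 c30 nb0; nra.
Qed.

End volterra.

(** * The Frobenius norm *)

Section frobenius.
Context {R : realType}.

Lemma frob_ge0 m n (A : 'M[R]_(m, n)) : 0 <= frob A.
Proof. exact: sqrtr_ge0. Qed.

Lemma frob0 k l : frob (0 : 'M[R]_(k, l)) = 0.
Proof.
by rewrite /frob big1 ?sqrtr0// => i _; rewrite big1// => j _; rewrite mxE expr0n.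
Qed.

Lemma frobZ k l (c : R) (A : 'M[R]_(k, l)) : 0 <= c -> frob (c *: A) = c * frob A.
Proof.
move=> c0; rewrite -[LHS](@ger0_norm R) ?frob_ge0// -sqrtr_sqr.
rewrite (_ : frob (c *: A) ^+ 2 = (c * frob A) ^+ 2).
  by rewrite sqrtr_sqr ger0_norm// mulr_ge0// frob_ge0.
rewrite exprMn !frob_sqr mulr_sumr; apply: eq_bigr => i _.
by rewrite mulr_sumr; apply: eq_bigr => j _; rewrite mxE exprMn.
Qed.

(** Convexity of the square with weights [1 - k] and [k]. For [k = c1 + c2 + c3] the factor [k^-1]
    cancels the one in front of [kernel_sqr_bound], so that no constant is lost before
    absorption. *)
Lemma frob_sqrD_le m n (A B : 'M[R]_(m, n)) (k : R) : 0 < k < 1 ->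
  frob (A + B) ^+ 2 <= (1 - k)^-1 * frob A ^+ 2 + k^-1 * frob B ^+ 2.
Proof.
move=> /andP[k0 k1]; rewrite !frob_sqr !mulr_sumr -big_split/=.
apply: ler_sum => i _; rewrite !mulr_sumr -big_split/=.
apply: ler_sum => j _; rewrite mxE.
have k1' : 0 < 1 - k by rewrite subr_gt0.
rewrite -subr_ge0.
have -> : (1 - k)^-1 * A i j ^+ 2 + k^-1 * B i j ^+ 2 - (A i j + B i j) ^+ 2 =
    (k * A i j - (1 - k) * B i j) ^+ 2 / (k * (1 - k)).
  by field; rewrite !gt_eqF.
by rewrite divr_ge0 ?sqr_ge0// mulr_ge0// ltW.
Qed.

Lemma frob_sqrB_le m n (A B : 'M[R]_(m, n)) :
  frob (A - B) ^+ 2 <= 2 * frob A ^+ 2 + 2 * frob B ^+ 2.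
Proof.
rewrite !frob_sqr !mulr_sumr -big_split/=.
apply: ler_sum => i _; rewrite !mulr_sumr -big_split/=.
apply: ler_sum => j _; rewrite !mxE.
have := sqr_ge0 (A i j + B i j); nra.
Qed.

Lemma frob_dot_le m (u v : 'cV[R]_m) :
  \sum_i u i ord0 * v i ord0 <= frob u * frob v.
Proof.
have frob0 (x : 'cV[R]_m) : frob x = 0 -> forall i, x i ord0 = 0.
  move=> x0 i; have := frob_sqr x; rewrite x0 expr0n/= => /esym/eqP.
  rewrite psumr_eq0 => [|j _]; last by apply: sumr_ge0 => ? _; exact: sqr_ge0.
  by move=> /allP/(_ i (mem_index_enum _)); rewrite big_ord1 sqrf_eq0 => /eqP.
have := frob_ge0 u; rewrite le_eqVlt => /predU1P[/esym u0|u0].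
  by rewrite u0 mul0r big1// => i _; rewrite frob0// mul0r.
have := frob_ge0 v; rewrite le_eqVlt => /predU1P[/esym v0|v0].
  by rewrite v0 mulr0 big1// => i _; rewrite (frob0 v)// mulr0.
have frobE (x : 'cV[R]_m) : \sum_i x i ord0 ^+ 2 = frob x ^+ 2.
  by rewrite frob_sqr; apply: eq_bigr => i _; rewrite big_ord1.
(* The parameter for which the AM-GM bound, summed over the coordinates, equals the product of the
   norms. *)
pose s := frob v / frob u; have s0 : 0 < s by rewrite divr_gt0.
apply: (@le_trans _ _ (\sum_i (s / 2 * u i ord0 ^+ 2 + (2 * s)^-1 * v i ord0 ^+ 2))).
  apply: ler_sum => i _; rewrite -subr_ge0.
  have -> : s / 2 * u i ord0 ^+ 2 + (2 * s)^-1 * v i ord0 ^+ 2 - u i ord0 * v i ord0 =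
      (s * u i ord0 - v i ord0) ^+ 2 / (2 * s) by field; rewrite gt_eqF.
  by rewrite divr_ge0 ?sqr_ge0// mulr_ge0// ltW.
rewrite big_split/= -!mulr_sumr !frobE /s.
by rewrite le_eqVlt; apply/orP; left; apply/eqP; field; rewrite !gt_eqF.
Qed.

Lemma frob_coord m n (A : 'M[R]_(m, n)) i j : `|A i j| <= frob A.
Proof.
rewrite -sqrtr_sqr ler_sqrt; last by do 2![apply: sumr_ge0 => ? _]; exact: sqr_ge0.
rewrite (bigD1 i)//= (bigD1 j)//= -addrA lerDl.
by rewrite addr_ge0//; do ?[apply: sumr_ge0 => ? _]; exact: sqr_ge0.
Qed.

(** Testing against the integral [v] itself: |v|^2 is the integral of the scalar products of [v] and
    [f x], which are at most |v| |f x|; then |v| is cancelled. *)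
Lemma frob_col_integral_le d (T : measurableType d) (mu : {measure set T -> \bar R})
    m (D : set T) (f : T -> 'cV[R]_m) : measurable D ->
  (forall i, mu.-integrable D (fun x => (f x i ord0)%:E)) ->
  ((frob (\col_i \int[mu]_(x in D) f x i ord0))%:E <=
   \int[mu]_(x in D) (frob (f x))%:E)%E.
Proof.
move=> mD fi; set v : 'cV[R]_m := (X in frob X).
have mf : measurable_fun D (fun x => (frob (f x))%:E).
  apply/measurable_EFinP/measurable_frob => //.
  apply/measurable_mxBP => // i j; rewrite ord1.
  exact/measurable_EFinP/(measurable_int _ (fi i)).
have [v0|v0] := eqVneq (frob v) 0.
  by rewrite v0; apply: integral_ge0 => x _; rewrite lee_fin frob_ge0.
have {}v0 : 0 < frob v by rewrite lt_neqAle eq_sym v0 frob_ge0.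
have [fin|] := ltP (\int[mu]_(x in D) (frob (f x))%:E)%E +oo%E; last first.
  by rewrite leye_eq => /eqP->; rewrite leey.
have if0 : mu.-integrable D (fun x => (frob (f x))%:E).
  apply/integrableP; split => //.
  rewrite (eq_integral (fun x => (frob (f x))%:E))// => x _.
  by rewrite gee0_abs// lee_fin frob_ge0.
have ivf i : mu.-integrable D (fun x => (v i ord0 * f x i ord0)%:E).
  by have := integrableZl mD (v i ord0) (fi i); apply: eq_integrable.
have : frob v ^+ 2 <= frob v * \int[mu]_(x in D) frob (f x).
  rewrite -RintegralZl//.
  have -> : frob v ^+ 2 = \int[mu]_(x in D) \sum_i v i ord0 * f x i ord0.
    rewrite /Rintegral (eq_integral (fun x => \sum_i (v i ord0 * f x i ord0)%:E)%E).
      rewrite integral_sum// (eq_bigr (fun i => (v i ord0 ^+ 2)%:E)) => [|i _].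
        by rewrite sumEFin/= frob_sqr; apply: eq_bigr => i _; rewrite big_ord1.
      rewrite -[LHS]fineK ?integrable_fin_num//; congr EFin.
      rewrite [LHS](_ : _ = \int[mu]_(x in D) (v i ord0 * f x i ord0))//.
      by rewrite (RintegralZl _ mD (fi i)) expr2; congr (_ * _); rewrite mxE.
    by move=> x _; rewrite sumEFin.
  apply: le_Rintegral => //.
  - rewrite (_ : _ \o _ = (fun x => \sum_i (v i ord0 * f x i ord0)%:E)%E).
      exact: integrable_sum.
    by apply/funext => x; rewrite /= sumEFin.
  - by have := integrableZl mD (frob v) if0; apply: eq_integrable.
  - by move=> x _; exact: frob_dot_le.
rewrite expr2 ler_pM2l// => le1.
by rewrite -[leRHS]fineK ?lee_fin// integrable_fin_num.
Qed.

End frobenius.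

(** * Kernels, Tonelli and null sets *)

Section weighted_norms.
Context {R : realType} {disp : measure_display} {Omega : measurableType disp}.
Variable P : probability Omega R.
Local Notation TR := (measurableTypeR R).
Local Notation mu := (@lebesgue_measure R).

(** Vanishing for negative arguments encodes the constraint [t <= s] in [kern K rho (s - t)], so
    that all time integrals run over the whole line and translation invariance applies. *)
Definition kern (K : R -> R) (rho : R) (u : TR) : R :=
  expR (- (rho * u)) * (K \_ `[0, +oo[) u.

Lemma measurable_expRM (d : measure_display) (T : measurableType d) (f : T -> R) (c : R) :
  measurable_fun setT f -> measurable_fun setT (fun x => expR (c * f x)).
Proof.
move=> mf; apply: (@measurableT_comp _ _ _ _ _ _ (@expR R)) => //.
exact: measurable_funM.
Qed.

Lemma measurable_kern p K rho : Lpstar p K -> measurable_fun setT (kern K rho).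
Proof.
move=> [mK _ _]; apply: measurable_funM.
  by under eq_fun do rewrite -mulNr; exact: measurable_expRM.
by apply/(measurable_restrictT _ _).1.
Qed.

Lemma kern_ge0 p K rho : Lpstar p K -> forall u, 0 <= kern K rho u.
Proof.
move=> [_ K0 _] u; rewrite mulr_ge0 ?expR_ge0// patchE.
by case: ifPn => // /set_mem; rewrite /= in_itv/= andbT => /K0.
Qed.

Lemma kernE K rho (u : R) : 0 <= u -> kern K rho u = expR (- (rho * u)) * K u.
Proof. by move=> u0; rewrite /kern patchE mem_set//= in_itv/= u0. Qed.

Lemma integral_kern p K rho : (0 < p)%N ->
  (\int[mu]_(t in `[0%R, +oo[) (expR (- (p%:R * rho * t)) * K t ^+ p)%:E =
   \int[mu]_u (kern K rho u ^+ p)%:E)%E.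
Proof.
move=> p0; rewrite integral_mkcond; apply: eq_integral => u _.
rewrite /kern !patchE exprMn -expRM_natl mulrN mulrA.
by case: ifPn => _ //; rewrite expr0n eqn0Ngt p0 mulr0.
Qed.

(** Reassociates the triple product so that [s] becomes the second factor of a binary product. *)
Lemma measurable_inner_integral (F : Omega * (TR * TR) -> \bar R) :
  measurable_fun setT F -> (forall x, 0 <= F x)%E ->
  measurable_fun setT (fun x : Omega * TR => \int[mu]_s F (x.1, (x.2, s)))%E.
Proof.
move=> mF F0.
have mF' : measurable_fun setT
    (fun x : Omega * TR * TR => F (x.1.1, (x.1.2, x.2))).
  apply: (measurableT_comp mF).
  apply: measurable_fun_pair; first exact: measurableT_comp measurable_fst measurable_fst.
  apply: measurable_fun_pair; last exact: measurable_snd.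
  exact: measurableT_comp measurable_snd measurable_fst.
exact: (measurable_fun_fubini_tonelli_F _ mF' (fun=> F0 _)).
Qed.

Lemma tonelli3 (F : Omega * (TR * TR) -> \bar R) : measurable_fun setT F ->
  (forall x, 0 <= F x)%E ->
  (\int[P]_w \int[mu]_t \int[mu]_s F (w, (t, s)) =
   \int[mu]_t \int[P]_w \int[mu]_s F (w, (t, s)))%E.
Proof.
move=> mF F0.
have mG := measurable_inner_integral mF F0.
have G0 (x : Omega * TR) : (0 <= \int[mu]_s F (x.1, (x.2, s)))%E.
  by apply: integral_ge0 => s _.
exact: (fubini_tonelli (fun x : Omega * TR => \int[mu]_s F (x.1, (x.2, s)))%E mG G0).
Qed.

Lemma measurable_section2 d (T' : measurableType d) (F : Omega * (TR * TR) -> T') t :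
  measurable_fun setT F -> measurable_fun setT (fun x : Omega * TR => F (x.1, (t, x.2))).
Proof.
move=> mF; apply: (measurableT_comp mF).
apply: measurable_fun_pair; first exact: measurable_fst.
by apply: measurable_fun_pair; [exact: measurable_cst|exact: measurable_snd].
Qed.

Lemma tonelli2 (F : Omega * (TR * TR) -> \bar R) t : measurable_fun setT F ->
  (forall x, 0 <= F x)%E ->
  (\int[P]_w \int[mu]_s F (w, (t, s)) = \int[mu]_s \int[P]_w F (w, (t, s)))%E.
Proof.
move=> mF F0.
exact: (fubini_tonelli (fun x : Omega * TR => F (x.1, (t, x.2)))
  (measurable_section2 t mF) (fun=> F0 _)).
Qed.

Lemma ge0_integral_eq0_ae d (T : measurableType d) (nu : {measure set T -> \bar R})
    (f : T -> \bar R) : measurable_fun setT f -> (forall x, 0 <= f x)%E ->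
  (\int[nu]_x f x = 0)%E -> {ae nu, forall x, f x = 0%E}.
Proof.
move=> mf f0 f1; have /ae_eq_integral_abs : measurable_fun setT f by [].
move=> /(_ nu measurableT)[+ _].
under eq_integral do rewrite gee0_abs//.
by move=> /(_ f1); apply: filterS => x; exact.
Qed.

Lemma ae_eq0_ge0_integral d (T : measurableType d) (nu : {measure set T -> \bar R})
    (f : T -> \bar R) : measurable_fun setT f ->
  {ae nu, forall x, f x = 0%E} -> (\int[nu]_x f x = 0)%E.
Proof.
move=> mf f0; rewrite (ae_eq_integral (cst 0%E)) ?integral0//.
by apply: filterS f0 => x + _.
Qed.

(** The indicator of the complement of [S] has triple integral 0, and Tonelli permits reading this
    in the order [t], outcome, [s]. Conditions on the driver, given pair by pair, thus become usable
    under the integral over [s] at fixed [t] and outcome. *)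
Lemma ae_ae_swap (S : set (Omega * (TR * TR))) : measurable S ->
  {ae (mu \x mu)%E, forall ts, {ae P, forall w, S (w, ts)}} ->
  {ae mu, forall t, {ae P, forall w, {ae mu, forall s, S (w, (t, s))}}}.
Proof.
move=> mS aeN.
pose F (x : Omega * (TR * TR)) : \bar R := (\1_(~` S) x)%:E.
have mF : measurable_fun setT F.
  by apply/measurable_EFinP; apply: measurable_indic; exact: measurableC.
have F0 x : (0 <= F x)%E by rewrite lee_fin.
have FN x : F x = 0%E -> S x.
  move=> Fx; apply: contrapT => Sx; move: Fx.
  by rewrite /F indicE mem_set//= => -[] /eqP; rewrite oner_eq0.
have NF x : S x -> F x = 0%E by move=> Sx; rewrite /F indicE memNset.
have mG : measurable_fun setT (fun ts : TR * TR => \int[P]_w F (w, ts))%E.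
  exact: (measurable_fun_fubini_tonelli_G F).
have G0 ts : (0 <= \int[P]_w F (w, ts))%E by exact: integral_ge0.
have : (\int[(mu \x mu)%E]_ts \int[P]_w F (w, ts) = 0)%E.
  apply: ae_eq0_ge0_integral => //; apply: filterS aeN => ts aeN.
  apply: ae_eq0_ge0_integral; first exact: measurableT_comp.
  by apply: filterS aeN => w; exact: NF.
rewrite (fubini_tonelli1 (fun ts => \int[P]_w F (w, ts)))%E//.
have mI : measurable_fun setT (fun t : TR => \int[mu]_s \int[P]_w F (w, (t, s)))%E.
  exact: (measurable_fun_fubini_tonelli_F (fun ts => \int[P]_w F (w, ts))%E).
move=> eq0.
have I0 (t : TR) : (0 <= \int[mu]_s \int[P]_w F (w, (t, s)))%E.
  by apply: integral_ge0 => s _; exact: integral_ge0.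
have mJ (t : TR) : measurable_fun setT (fun w => \int[mu]_s F (w, (t, s)))%E.
  exact: (measurable_fun_fubini_tonelli_F (fun x : Omega * TR => F (x.1, (t, x.2)))
    (measurable_section2 t mF) (fun=> F0 _)).
have mK (t : TR) w : measurable_fun setT (fun s => F (w, (t, s))).
  apply: (measurableT_comp mF); apply: measurable_fun_pair => //.
apply: filterS (ge0_integral_eq0_ae mI I0 eq0) => t; rewrite -tonelli2// => eqt.
have J0 w : (0 <= \int[mu]_s F (w, (t, s)))%E by exact: integral_ge0.
apply: filterS (ge0_integral_eq0_ae (mJ t) J0 eqt) => w eqw.
by apply: filterS (ge0_integral_eq0_ae (mK t w) (fun=> F0 _) eqw) => s; exact: FN.
Qed.

Lemma ae_imp d (T : measurableType d) (nu : {measure set T -> \bar R}) (A B : T -> Prop) :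
  {ae nu, forall t, A t} -> (forall t, A t -> B t) -> {ae nu, forall t, B t}.
Proof. by move=> hA AB; apply: filterS hA. Qed.

Lemma ae_and d (T : measurableType d) (nu : {measure set T -> \bar R}) (A B : T -> Prop) :
  {ae nu, forall t, A t} -> {ae nu, forall t, B t} -> {ae nu, forall t, A t /\ B t}.
Proof. by move=> hA hB; apply: filterS2 hA hB. Qed.

Lemma ae_imp2 (A B C : TR -> Prop) : {ae mu, forall t, A t} ->
  {ae mu, forall t, B t} -> (forall t, A t -> B t -> C t) -> {ae mu, forall t, C t}.
Proof. by move=> hA hB AB; apply: filterS2 hA hB. Qed.

Lemma le_integral_2D d (T : measurableType d) (nu : {measure set T -> \bar R})
    (f g h : T -> \bar R) : measurable_fun setT f -> measurable_fun setT g ->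
  measurable_fun setT h -> (forall x, 0 <= f x)%E -> (forall x, 0 <= g x)%E ->
  (forall x, 0 <= h x)%E -> (forall x, f x <= 2%:E * g x + 2%:E * h x)%E ->
  (\int[nu]_x f x <= 2%:E * \int[nu]_x g x + 2%:E * \int[nu]_x h x)%E.
Proof.
move=> mf mg mh f0 g0 h0 le; have c0 : (0 <= 2%:E :> \bar R)%E by rewrite lee_fin.
have m2 (k : T -> \bar R) : measurable_fun setT k ->
    measurable_fun setT (fun x => 2%:E * k x)%E by exact: measurable_funeM.
have p2 (x : \bar R) : (0 <= x -> 0 <= 2%:E * x)%E by exact: mule_ge0.
rewrite -(ge0_integralZl nu measurableT mg)// -(ge0_integralZl nu measurableT mh)//.
rewrite -ge0_integralD//; [|by move=> x _; exact: p2|exact: m2|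
  by move=> x _; exact: p2|exact: m2].
apply: ge0_le_integral => //.
by apply: emeasurable_funD; exact: m2.
Qed.

Lemma ge0_integral_comb d (T : measurableType d) (nu : {measure set T -> \bar R})
    (r p q : R) (f1 f2 f3 f4 : T -> \bar R) :
  0 <= r -> 0 <= p -> 0 <= q ->
  measurable_fun setT f1 -> measurable_fun setT f2 ->
  measurable_fun setT f3 -> measurable_fun setT f4 ->
  (forall x, 0 <= f1 x)%E -> (forall x, 0 <= f2 x)%E ->
  (forall x, 0 <= f3 x)%E -> (forall x, 0 <= f4 x)%E ->
  (\int[nu]_x (r%:E * f1 x + (f2 x + p%:E * f3 x + q%:E * f4 x)) =
   r%:E * \int[nu]_x f1 x + (\int[nu]_x f2 x + p%:E * \int[nu]_x f3 x +
     q%:E * \int[nu]_x f4 x))%E.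
Proof.
move=> r0 p0 q0 mf1 mf2 mf3 mf4 f10 f20 f30 f40.
have mZ (c : R) (f : T -> \bar R) : measurable_fun setT f ->
    measurable_fun setT (fun x => c%:E * f x)%E by exact: measurable_funeM.
have pZ (c : R) (x : \bar R) : (0 <= c)%R -> (0 <= x -> 0 <= c%:E * x)%E.
  by move=> c0 x0; rewrite mule_ge0// lee_fin.
rewrite ge0_integralD//; last 4 first.
- by move=> x _; exact: pZ.
- exact: mZ.
- by move=> x _; rewrite !adde_ge0//; exact: pZ.
- by apply: emeasurable_funD; [apply: emeasurable_funD => //|]; exact: mZ.
rewrite ge0_integralZl//; congr (_ + _)%E.
rewrite ge0_integralD//; last 4 first.
- by move=> x _; rewrite adde_ge0//; exact: pZ.
- by apply: emeasurable_funD => //; exact: mZ.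
- by move=> x _; exact: pZ.
- exact: mZ.
rewrite ge0_integralD//; last 2 first.
- by move=> x _; exact: pZ.
- exact: mZ.
by rewrite !ge0_integralZl.
Qed.

Lemma lty_2D (x y : \bar R) : (x < +oo -> y < +oo -> 2%:E * x + 2%:E * y < +oo)%E.
Proof.
by move=> xoo yoo; apply: lte_add_pinfty; rewrite lte_mul_pinfty ?lee_fin.
Qed.

(** The time [t] is outermost because the Ito isometry and the kernel estimate are applied at a
    fixed [t]. *)
Definition integral3 (F : Omega * (TR * TR) -> \bar R) : \bar R :=
  (\int[mu]_t \int[P]_w \int[mu]_s F (w, (t, s)))%E.

Section integral3.
Variables F G : Omega * (TR * TR) -> \bar R.
Hypotheses (mF : measurable_fun setT F) (mG : measurable_fun setT G).
Hypotheses (F0 : forall x, (0 <= F x)%E) (G0 : forall x, (0 <= G x)%E).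

Lemma measurable_slice (t : TR) w : measurable_fun setT (fun s => F (w, (t, s))).
Proof. by apply: (measurableT_comp mF); apply: measurable_fun_pair. Qed.

Lemma measurable_integral2 (t : TR) :
  measurable_fun setT (fun w => \int[mu]_s F (w, (t, s)))%E.
Proof.
exact: (measurable_fun_fubini_tonelli_F (fun x : Omega * TR => F (x.1, (t, x.2)))
  (measurable_section2 t mF) (fun=> F0 _)).
Qed.

Lemma measurable_integral3 :
  measurable_fun setT (fun t => \int[P]_w \int[mu]_s F (w, (t, s)))%E.
Proof.
exact: (measurable_fun_fubini_tonelli_G _ (measurable_inner_integral mF F0)
  (fun x => integral_ge0 _ (fun s _ => F0 _))).
Qed.

End integral3.

Section integral3_theory.
Variables F G : Omega * (TR * TR) -> \bar R.
Hypotheses (mF : measurable_fun setT F) (mG : measurable_fun setT G).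
Hypotheses (F0 : forall x, (0 <= F x)%E) (G0 : forall x, (0 <= G x)%E).

Lemma le_integral3 : (forall x, F x <= G x)%E -> (integral3 F <= integral3 G)%E.
Proof.
move=> FG; apply: ge0_le_integral => //.
- by move=> t _; do ?[apply: integral_ge0 => ? _].
- exact: measurable_integral3.
- exact: measurable_integral3.
- move=> t _; apply: ge0_le_integral => //.
  + by move=> w _; exact: integral_ge0.
  + exact: measurable_integral2.
  + exact: measurable_integral2.
  + move=> w _; apply: ge0_le_integral => //; exact: measurable_slice.
Qed.

Lemma integral3D : integral3 (fun x => F x + G x)%E = (integral3 F + integral3 G)%E.
Proof.
rewrite /integral3 -ge0_integralD//; last 4 first.
- by move=> t _; do ?[apply: integral_ge0 => ? _].
- exact: measurable_integral3.
- by move=> t _; do ?[apply: integral_ge0 => ? _].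
- exact: measurable_integral3.
apply: eq_integral => t _; rewrite -ge0_integralD//; last 4 first.
- by move=> w _; exact: integral_ge0.
- exact: measurable_integral2.
- by move=> w _; exact: integral_ge0.
- exact: measurable_integral2.
by apply: eq_integral => w _; rewrite ge0_integralD//; exact: measurable_slice.
Qed.

Lemma integral3Z (c : R) : 0 <= c ->
  integral3 (fun x => c%:E * F x)%E = (c%:E * integral3 F)%E.
Proof.
move=> c0; rewrite /integral3 -ge0_integralZl//; last 2 first.
- exact: measurable_integral3.
- by move=> t _; do ?[apply: integral_ge0 => ? _].
apply: eq_integral => t _; rewrite -ge0_integralZl//; last 2 first.
- exact: measurable_integral2.
- by move=> w _; exact: integral_ge0.
by apply: eq_integral => w _; rewrite ge0_integralZl//; exact: measurable_slice.
Qed.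

End integral3_theory.

End weighted_norms.

(** * Weighted processes *)

Section weighted_processes.
Context {R : realType} {disp : measure_display} {Omega : measurableType disp}.
Variables (P : probability Omega R) (m d : nat) (eta : R).
Local Notation TR := (measurableTypeR R).
Local Notation mu := (@lebesgue_measure R).
Implicit Types (y : Omega -> R -> 'cV[R]_m) (z : Omega -> R -> R -> 'M[R]_(m, d)).

Definition jmeas1 y : Prop := measurable_fun (setT `*` (`[0, +oo[ : set R))
  ((fun x => y x.1 x.2) : Omega * R -> mxB R m 1).

Definition jmeas2 z : Prop :=
  measurable_fun (setT `*` ((`[0, +oo[ : set R) `*` (`[0, +oo[ : set R)))
    ((fun x => z x.1 x.2.1 x.2.2) : Omega * (R * R) -> mxB R m d).

Definition quadrant : set (TR * TR) := `[0, +oo[ `*` `[0, +oo[.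
(** On [upper] the values Z(t,s) are governed by the equation, on [lower] by the relation defining
    M-solutions. Both contain the diagonal, which is harmless as only upper bounds on the whole
    quadrant are drawn from them. *)
Definition upper : set (TR * TR) := [set ts | 0 <= ts.1 <= ts.2].
Definition lower : set (TR * TR) := [set ts | 0 <= ts.2 <= ts.1].

(** [wt1] and [wt2] include the weight and vanish outside the relevant times, so that Tonelli
    applies on full product spaces; in [wt2] the weight depends on the first time argument. *)
Definition wt1 y : Omega * TR -> R :=
  (fun x => expR (eta * x.2) * frob (y x.1 x.2)) \_ (setT `*` `[0, +oo[).

Definition wt2 (D : set (TR * TR)) z : Omega * (TR * TR) -> R :=
  (fun x => expR (eta * x.2.1) * frob (z x.1 x.2.1 x.2.2)) \_ (setT `*` D).

Lemma measurable_upper : measurable upper.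
Proof.
rewrite (_ : upper = [set ts | 0 <= ts.1] `&` [set ts | ts.1 <= ts.2]).
  apply: measurableI.
    rewrite (_ : mkset _ = (fst : TR * TR -> TR) @^-1` `[0, +oo[).
      by rewrite -[X in measurable X]setTI; exact: measurable_fst.
    by apply/seteqP; split => x /=; rewrite in_itv/= andbT.
  by apply: measurable_set_le; [exact: measurable_fst|exact: measurable_snd].
by apply/seteqP; split => x /= /andP.
Qed.

Lemma measurable_lower : measurable lower.
Proof.
rewrite (_ : lower = (fun x : TR * TR => (x.2, x.1)) @^-1` upper)//.
rewrite -[X in measurable X]setTI; apply: measurable_swap => //.
exact: measurable_upper.
Qed.

Lemma upper_quadrant : upper `<=` quadrant.
Proof.
move=> [t s] /andP[/= t0 ts]; split; rewrite /= in_itv/= andbT//.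
exact: le_trans ts.
Qed.

Lemma lower_quadrant : lower `<=` quadrant.
Proof.
move=> [t s] /andP[/= t0 ts]; split; rewrite /= in_itv/= andbT//.
exact: le_trans ts.
Qed.

Lemma measurable_weighted d' (T : measurableType d') (D : set T) (phi : T -> R)
    k l (f : T -> 'M[R]_(k, l)) : measurable D -> measurable_fun setT phi ->
  measurable_fun D (f : T -> mxB R k l) ->
  measurable_fun setT ((fun x => expR (eta * phi x) * frob (f x)) \_ D).
Proof.
move=> mD mphi mf; apply/(measurable_restrictT _ mD).1.
apply: measurable_funM; last exact: measurable_frob.
by apply: measurable_funTS; exact: measurable_expRM.
Qed.

Lemma measurable_wt1 y : jmeas1 y -> measurable_fun setT (wt1 y).
Proof.
move=> my; apply: (measurable_weighted (phi := snd)); last exact: my.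
- exact: measurableX.
- exact: measurable_snd.
Qed.

Lemma measurable_wt2 D z : measurable D -> D `<=` quadrant -> jmeas2 z ->
  measurable_fun setT (wt2 D z).
Proof.
move=> mD Dq mz.
apply: (measurable_weighted (phi := fun x : Omega * (TR * TR) => x.2.1)).
- exact: measurableX.
- exact: (measurableT_comp measurable_fst measurable_snd).
- have mq : measurable (setT `*` quadrant : set (Omega * (TR * TR))).
    by apply: measurableX => //; exact: measurableX.
  by apply: measurable_funS mq _ _ => // x [_ /Dq].
Qed.

Lemma wt1_ge0 y x : 0 <= wt1 y x.
Proof. by rewrite /wt1 patchE; case: ifP => // _; rewrite mulr_ge0 ?expR_ge0 ?frob_ge0. Qed.

Lemma wt2_ge0 D z x : 0 <= wt2 D z x.
Proof. by rewrite /wt2 patchE; case: ifP => // _; rewrite mulr_ge0 ?expR_ge0 ?frob_ge0. Qed.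

Lemma wt1E y w t : 0 <= t -> wt1 y (w, t) = expR (eta * t) * frob (y w t).
Proof. by move=> t0; rewrite /wt1 patchE mem_set//; split => //=; rewrite in_itv/= t0. Qed.

Lemma wt1_lt0 y w t : t < 0 -> wt1 y (w, t) = 0.
Proof.
move=> t0; rewrite /wt1 patchE memNset// => -[_ /=].
by rewrite in_itv/= andbT leNgt t0.
Qed.

Lemma wt2E D z w t s : D (t, s) -> wt2 D z (w, (t, s)) = expR (eta * t) * frob (z w t s).
Proof. by move=> Dts; rewrite /wt2 patchE mem_set. Qed.

Lemma wt2_notin D z w t s : ~ D (t, s) -> wt2 D z (w, (t, s)) = 0.
Proof. by move=> Dts; rewrite /wt2 patchE memNset// => -[]. Qed.

Lemma wt2_quadrant_le z x :
  wt2 quadrant z x ^+ 2 <= wt2 upper z x ^+ 2 + wt2 lower z x ^+ 2.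
Proof.
case: x => w [t s]; have [[/=]|nq] := pselect (quadrant (t, s)); last first.
  by rewrite (wt2_notin _ _ nq) expr0n/= addr_ge0 ?sqr_ge0.
rewrite !in_itv/= !andbT => t0 s0.
have q : quadrant (t, s) by split; rewrite /= in_itv/= ?t0 ?s0.
have [ts|/ltW st] := leP t s.
  have u : upper (t, s) by rewrite /upper/= t0.
  by rewrite [wt2 quadrant _ _]wt2E// [wt2 upper _ _]wt2E// lerDl sqr_ge0.
have u : lower (t, s) by rewrite /lower/= s0.
by rewrite [wt2 quadrant _ _]wt2E// [wt2 lower _ _]wt2E// lerDr sqr_ge0.
Qed.

Lemma wt1B_le y y' x :
  wt1 (fun w t => y w t - y' w t) x ^+ 2 <= 2 * wt1 y x ^+ 2 + 2 * wt1 y' x ^+ 2.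
Proof.
case: x => w t; have [t0|t0] := leP 0 t; last first.
  by rewrite !wt1_lt0// expr0n/= mulr0 addr0.
rewrite !wt1E// !exprMn.
have := frob_sqrB_le (y w t) (y' w t); have := sqr_ge0 (expR (eta * t)); nra.
Qed.

Lemma wt2B_le D z z' x :
  wt2 D (fun w t s => z w t s - z' w t s) x ^+ 2 <=
  2 * wt2 D z x ^+ 2 + 2 * wt2 D z' x ^+ 2.
Proof.
case: x => w [t s]; have [Dts|Dts] := pselect (D (t, s)); last first.
  by rewrite !wt2_notin// expr0n/= mulr0 addr0.
rewrite !wt2E// !exprMn.
have := frob_sqrB_le (z w t s) (z' w t s); have := sqr_ge0 (expR (eta * t)); nra.
Qed.

Lemma measurable_sqrE d' (T : measurableType d') (f : T -> R) :
  measurable_fun setT f -> measurable_fun setT (fun x => (f x ^+ 2)%:E).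
Proof. by move=> mf; apply/measurable_EFinP; exact: measurable_funX. Qed.

Lemma integral_wt1E y w :
  (\int[mu]_(t in `[0%R, +oo[) (expR (2 * eta * t) * frob (y w t) ^+ 2)%:E =
   \int[mu]_t (wt1 y (w, t) ^+ 2)%:E)%E.
Proof.
rewrite integral_mkcond; apply: eq_integral => t _.
rewrite patchE; have [t0|t0] := leP 0 t.
  by rewrite mem_set ?wt1E//= ?in_itv/= ?t0// exprMn -expRM_natl mulrA.
rewrite memNset ?wt1_lt0 ?expr0n//= in_itv/= andbT leNgt t0//.
Qed.

Lemma energy1E y : jmeas1 y ->
  (\int[P]_w \int[mu]_(t in `[0%R, +oo[)
     (expR (2 * eta * t) * frob (y w t) ^+ 2)%:E =
   \int[mu]_t \int[P]_w (wt1 y (w, t) ^+ 2)%:E)%E.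
Proof.
move=> my; have /measurable_sqrE m2 := measurable_wt1 my.
rewrite -(fubini_tonelli (fun x => (wt1 y x ^+ 2)%:E) m2); last first.
  by move=> x; rewrite lee_fin sqr_ge0.
by apply: eq_integral => w _; exact: integral_wt1E.
Qed.

Lemma integral_wt2E z w : jmeas2 z ->
  (\int[mu]_(t in `[0%R, +oo[) ((expR (2 * eta * t))%:E *
     \int[mu]_(s in `[0%R, +oo[) (frob (z w t s) ^+ 2)%:E) =
   \int[mu]_t \int[mu]_s (wt2 quadrant z (w, (t, s)) ^+ 2)%:E)%E.
Proof.
move=> mz; have mq : measurable quadrant by exact: measurableX.
rewrite integral_mkcond; apply: eq_integral => t _.
rewrite patchE; have [t0|t0] := leP 0 t; last first.
  rewrite memNset ?integral0_eq//= ?in_itv/= ?andbT ?leNgt ?t0// => s _.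
  by rewrite wt2_notin ?expr0n// => -[]/=; rewrite in_itv/= leNgt t0.
rewrite mem_set/= ?in_itv/= ?t0// integral_mkcond -ge0_integralZl//.
- apply: eq_integral => s _; rewrite patchE; have [s0|s0] := leP 0 s.
    rewrite mem_set/= ?in_itv/= ?s0// wt2E; last first.
      by split => /=; rewrite in_itv/= ?t0 ?s0.
    by rewrite exprMn -expRM_natl mulrA EFinM.
  rewrite memNset ?mule0/= ?in_itv/= ?andbT ?leNgt ?s0//.
  by rewrite wt2_notin ?expr0n// => -[]/= _; rewrite in_itv/= leNgt s0.
- rewrite (_ : _ \_ _ = (fun s => ((expR (2 * eta * t))^-1 *
      wt2 quadrant z (w, (t, s)) ^+ 2)%:E)).
    apply/measurable_EFinP; apply: measurable_funM => //; apply: measurable_funX.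
    apply: (measurableT_comp (measurable_wt2 mq (@subset_refl _ _) mz)).
    by apply: measurable_fun_pair => //; exact: measurable_fun_pair.
  apply/funext => s; rewrite patchE; have [s0|s0] := leP 0 s.
    rewrite mem_set/= ?in_itv/= ?s0// wt2E; last first.
      by split => /=; rewrite in_itv/= ?t0 ?s0.
    rewrite exprMn -expRM_natl mulrA; congr EFin.
    by rewrite mulrA mulVf ?mul1r// gt_eqF// expR_gt0.
  rewrite memNset/= ?in_itv/= ?andbT ?leNgt ?s0//.
  rewrite wt2_notin ?expr0n ?mulr0// => -[]/= _; rewrite in_itv/= leNgt s0//.
- by move=> s _; rewrite patchE; case: ifP => // _; rewrite lee_fin sqr_ge0.
Qed.

Lemma energy2E z : jmeas2 z ->
  (\int[P]_w \int[mu]_(t in `[0%R, +oo[) ((expR (2 * eta * t))%:E *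
     \int[mu]_(s in `[0%R, +oo[) (frob (z w t s) ^+ 2)%:E) =
   \int[mu]_t \int[P]_w \int[mu]_s (wt2 quadrant z (w, (t, s)) ^+ 2)%:E)%E.
Proof.
move=> mz; have mq : measurable quadrant by exact: measurableX.
have /measurable_sqrE m2 := measurable_wt2 mq (@subset_refl _ _) mz.
rewrite -(tonelli3 P (F := fun x => (wt2 quadrant z x ^+ 2)%:E) m2); last first.
  by move=> x; rewrite lee_fin sqr_ge0.
by apply: eq_integral => w _; exact: integral_wt2E.
Qed.

End weighted_processes.

(** * Sections at a fixed time *)

Section slices.
Context {R : realType} {disp : measure_display} {Omega : measurableType disp}.
Variables (P : probability Omega R) (m d : nat) (eta : R).
Local Notation TR := (measurableTypeR R).
Local Notation mu := (@lebesgue_measure R).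
Implicit Types (y : Omega -> R -> 'cV[R]_m) (z : Omega -> R -> R -> 'M[R]_(m, d)).

Lemma measurable_fun_pair_in d' d1 d2 (T : measurableType d') (T1 : measurableType d1)
    (T2 : measurableType d2) (D : set T) (f1 : T -> T1) (f2 : T -> T2) :
  measurable D -> measurable_fun D f1 -> measurable_fun D f2 ->
  measurable_fun D (fun x => (f1 x, f2 x)).
Proof.
move=> mD mf1 mf2.
apply: (@measurability _ _ T (T1 * T2)%type D _
  (preimage_set_system setT fst measurable `|` preimage_set_system setT snd measurable)) => //.
move=> _ [_ [[B mB <-]|[B mB <-]] <-]; rewrite setTI.
- exact: mf1.
- exact: mf2.
Qed.

Lemma jmeas1B y y' : jmeas1 y -> jmeas1 y' -> jmeas1 (fun w t => y w t - y' w t).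
Proof.
have mD : measurable (setT `*` `[0, +oo[ : set (Omega * R)) by exact: measurableX.
move=> /(measurable_mxBP _ mD) my /(measurable_mxBP _ mD) my'.
apply/(measurable_mxBP _ mD) => i j; rewrite (_ : (fun x => _) =
  (fun x => y x.1 x.2 i j - y' x.1 x.2 i j)); last by apply/funext => x; rewrite !mxE.
exact: measurable_funB.
Qed.

Lemma jmeas2B z z' : jmeas2 z -> jmeas2 z' ->
  jmeas2 (fun w t s => z w t s - z' w t s).
Proof.
have mD : measurable (setT `*` (`[0, +oo[ `*` `[0, +oo[) : set (Omega * (R * R))).
  by apply: measurableX => //; exact: measurableX.
move=> /(measurable_mxBP _ mD) mz /(measurable_mxBP _ mD) mz'.
apply/(measurable_mxBP _ mD) => i j; rewrite (_ : (fun x => _) =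
  (fun x => z x.1 x.2.1 x.2.2 i j - z' x.1 x.2.1 x.2.2 i j)).
  exact: measurable_funB.
by apply/funext => x; rewrite !mxE.
Qed.

Lemma jmeas1_0 : jmeas1 (fun (_ : Omega) (_ : R) => 0 : 'cV[R]_m).
Proof.
apply/measurable_mxBP => [|i j]; first exact: measurableX.
exact: measurable_cst.
Qed.

Lemma jmeas2_0 : jmeas2 (fun (_ : Omega) (_ _ : R) => 0 : 'M[R]_(m, d)).
Proof.
apply/measurable_mxBP => [|i j]; last exact: measurable_cst.
by apply: measurableX => //; exact: measurableX.
Qed.

Lemma jmeas1_slice y t : 0 <= t -> jmeas1 y ->
  forall i, measurable_fun setT (fun w => y w t i ord0).
Proof.
have mD : measurable (setT `*` `[0, +oo[ : set (Omega * R)) by exact: measurableX.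
move=> t0 /(measurable_mxBP _ mD) my i.
apply: (measurable_comp mD _ (my i ord0) (_ : measurable_fun setT (fun w : Omega => (w, t)))).
- by move=> _ [w _ <-]; split => //=; rewrite in_itv/= t0.
- exact: measurable_fun_pair.
Qed.

Lemma measurable_frob_sqr k (X : Omega -> 'cV[R]_k) :
  (forall i, measurable_fun setT (fun w => X w i ord0)) ->
  measurable_fun setT (fun w => (frob (X w) ^+ 2)%:E).
Proof.
move=> mX; apply: measurable_sqrE; apply: measurable_frob => //.
by apply/measurable_mxBP => // i j; rewrite ord1.
Qed.

Lemma measurable_wt2_slice D z t : measurable D -> D `<=` quadrant -> jmeas2 z ->
  measurable_fun setT (fun x : Omega * TR => (wt2 eta D z (x.1, (t, x.2)) ^+ 2)%:E).
Proof.
move=> mD Dq mz; apply: measurable_sqrE; apply: (measurableT_comp (measurable_wt2 eta mD Dq mz)).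
by apply: measurable_fun_pair => //; exact: measurable_fun_pair.
Qed.

Lemma integral_wt2_slice D S z t : measurable D -> D `<=` quadrant -> jmeas2 z ->
  (forall s, D (t, s) <-> S s) ->
  (\int[P]_w \int[mu]_s (wt2 eta D z (w, (t, s)) ^+ 2)%:E =
   (expR (eta * t) ^+ 2)%:E *
   \int[P]_w \int[mu]_(s in S) (frob (z w t s) ^+ 2)%:E)%E.
Proof.
move=> mD Dq mz DS; set c := expR (eta * t) ^+ 2.
have c0 : 0 < c by rewrite exprn_gt0// expR_gt0.
(* Dividing the weight out of [wt2] gives the squared norm of [z], cut off outside [D], together
   with its joint measurability. *)
pose phi (x : Omega * TR) : \bar R := (c^-1 * wt2 eta D z (x.1, (t, x.2)) ^+ 2)%:E.
have m2 := measurable_wt2_slice t mD Dq mz.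
have mphi : measurable_fun setT phi.
  by apply/measurable_EFinP; apply: measurable_funM => //; exact/measurable_EFinP.
have phi0 x : (0 <= phi x)%E by rewrite lee_fin mulr_ge0 ?sqr_ge0// invr_ge0 ltW.
transitivity (\int[P]_w \int[mu]_s (c%:E * phi (w, s)))%E.
  apply: eq_integral => w _; apply: eq_integral => s _.
  by rewrite -EFinM mulrA mulfV ?mul1r// gt_eqF.
transitivity (\int[P]_w (c%:E * \int[mu]_s phi (w, s)))%E.
  apply: eq_integral => w _; rewrite ge0_integralZl ?lee_fin ?ltW//.
  exact: measurableT_comp.
rewrite ge0_integralZl ?lee_fin ?ltW//.
- congr (_ * _)%E; apply: eq_integral => w _; rewrite [in RHS]integral_mkcond.
  apply: eq_integral => s _; rewrite patchE /phi/=.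
  have [Ss|Ss] := pselect (S s).
    rewrite mem_set// wt2E; last exact/DS.
    by rewrite exprMn mulrA mulVf ?mul1r// gt_eqF.
  by rewrite memNset// wt2_notin ?expr0n ?mulr0// => /DS.
- exact: (measurable_fun_fubini_tonelli_F _ mphi phi0).
- by move=> w _; exact: integral_ge0.
Qed.

Lemma integral_wt1_slice y t : jmeas1 y -> 0 <= t ->
  (\int[P]_w (wt1 eta y (w, t) ^+ 2)%:E =
   (expR (eta * t) ^+ 2)%:E * \int[P]_w (frob (y w t) ^+ 2)%:E)%E.
Proof.
move=> my t0; rewrite -ge0_integralZl.
- by apply: eq_integral => w _; rewrite wt1E// exprMn EFinM.
- by [].
- apply: measurable_sqrE; apply: measurable_frob => //.
  by apply/measurable_mxBP => // i j; rewrite ord1; exact: jmeas1_slice.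
- by move=> w _; rewrite lee_fin sqr_ge0.
- by rewrite lee_fin sqr_ge0.
Qed.

Lemma measurable_cutoff_slice z t a b i k : jmeas2 z -> 0 <= t -> 0 <= a ->
  measurable_fun setT (cutoff a b (fun w s => z w t s i k)).
Proof.
have mD : measurable (setT `*` (`[0, +oo[ `*` `[0, +oo[) : set (Omega * (R * R))).
  by apply: measurableX => //; exact: measurableX.
move=> /(measurable_mxBP _ mD) /(_ i k) mz t0 a0.
have mT : measurable (setT `*` time_range a b : set (Omega * TR)).
  by apply: measurableX => //; exact: measurable_time_range.
rewrite (_ : cutoff _ _ _ = (fun x : Omega * TR => z x.1 t x.2 i k) \_
    (setT `*` time_range a b)); last first.
  apply/funext => -[w s]; rewrite patchE /cutoff/=.
  have [sab|sab] := pselect (time_range a b s).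
    by rewrite mem_set// indicE mem_set// mulr1.
  by rewrite memNset; [rewrite indicE memNset// mulr0|case].
apply: (measurable_restrictT (fun x : Omega * TR => z x.1 t x.2 i k) mT).1.
have sub : ((fun x => (x.1, (t, x.2))) : Omega * TR -> Omega * (R * R)) @`
    (setT `*` time_range a b) `<=` setT `*` (`[0, +oo[ `*` `[0, +oo[).
  move=> _ [[w s] [_ [/= a_s _]] <-]; split => //=.
  by split; rewrite /= in_itv/= ?t0 ?(le_trans a0 a_s).
have mg : measurable_fun (setT `*` time_range a b)
    ((fun x => (x.1, (t, x.2))) : Omega * TR -> Omega * (R * R)).
  apply: measurable_funTS; apply: measurable_fun_pair => //.
  exact: measurable_fun_pair.
exact: (measurable_comp mD sub mz mg).
Qed.

Lemma sqint_coord y t i : jmeas1 y -> 0 <= t ->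
  (\int[P]_w (wt1 eta y (w, t) ^+ 2)%:E < +oo)%E -> sqint P (fun w => y w t i ord0).
Proof.
move=> my t0; rewrite integral_wt1_slice// => fin.
split; first exact: jmeas1_slice.
have mf : measurable_fun setT (fun w => (frob (y w t) ^+ 2)%:E).
  apply: measurable_sqrE; apply: measurable_frob => //.
  by apply/measurable_mxBP => // k l; rewrite ord1; exact: jmeas1_slice.
have f0 : (0 <= \int[P]_w (frob (y w t) ^+ 2)%:E)%E.
  by apply: integral_ge0 => w _; rewrite lee_fin sqr_ge0.
apply: (@le_lt_trans _ _ (\int[P]_w (frob (y w t) ^+ 2)%:E)%E).
  apply: ge0_le_integral => //.
  - by move=> w _; rewrite lee_fin sqr_ge0.
  - by apply: measurable_sqrE; exact: jmeas1_slice.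
  - move=> w _; rewrite lee_fin -[leLHS](real_normK (num_real _)).
    by rewrite lerXn2r ?nnegrE ?frob_ge0// frob_coord.
(* The weight at [t] is positive, so an infinite second moment would remain infinite after
   weighting. *)
move: fin; rewrite !ltey; apply: contraNN => /eqP->.
by rewrite gt0_muley// lte_fin exprn_gt0// expR_gt0.
Qed.

End slices.

(** * Stability *)

Section stability.
Context {R : realType} {disp : measure_display} {Omega : measurableType disp}.
Variables (P : probability Omega R) (m d : nat) (W : Omega -> R -> 'cV[R]_d).
Hypothesis P_complete : measure_is_complete P.
Hypothesis W_brownian : is_brownian P W.
Variable g : Omega -> R -> R -> 'cV[R]_m -> 'M[R]_(m, d) -> 'M[R]_(m, d) -> 'cV[R]_m.
Variables (Ky Kz1 Kz2 : R -> R) (eta lambda : R).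
Hypothesis hB : assumption_B P W g Ky Kz1 Kz2.
Local Notation TR := (measurableTypeR R).
Local Notation mu := (@lebesgue_measure R).
Implicit Types (y : Omega -> R -> 'cV[R]_m) (z : Omega -> R -> R -> 'M[R]_(m, d)).

Definition energy1 y : \bar R := (\int[mu]_t \int[P]_w (wt1 eta y (w, t) ^+ 2)%:E)%E.

Definition energy2 (D : set (TR * TR)) z : \bar R :=
  integral3 P (fun x => (wt2 eta D z x ^+ 2)%:E).

(* Adaptedness of [z] is not part of this notion: it is only used through the
   existence of the stochastic integrals. *)
Definition msol (psi : Omega -> R -> 'cV[R]_m) y z : Prop :=
  [/\ jmeas1 y /\ jmeas2 z, adapted P W `[0, +oo[ y,
      (energy1 y < +oo)%E /\ (energy2 quadrant z < +oo)%E,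
      {ae mu, forall t, 0 <= t -> M_relation P W y z t} &
      solves_bsvie P W g lambda +oo%E psi y z].

Lemma measurable_driver y z : jmeas1 y -> jmeas2 z -> measurable_fun (setT `*` upper)
  ((fun x => g x.1 x.2.1 x.2.2 (y x.1 x.2.2) (z x.1 x.2.1 x.2.2) (z x.1 x.2.2 x.2.1)) :
     Omega * (TR * TR) -> mxB R m 1).
Proof.
move=> my mz; have [mg _ _ _ _] := hB.
have mU : measurable (setT `*` upper : set (Omega * (TR * TR))).
  by apply: measurableX => //; exact: measurable_upper.
have mq2 : measurable (setT `*` (`[0, +oo[ `*` `[0, +oo[) : set (Omega * (R * R))).
  by apply: measurableX => //; exact: measurableX.
have mF : measurable [set x : (Omega * (R * R)) *
    (mxB R m 1 * (mxB R m d * mxB R m d)) | 0 <= x.1.2.1 <= x.1.2.2].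
  rewrite (_ : mkset _ = (fun x => x.1.2) @^-1` (upper : set (R * R)))//.
  rewrite -[X in measurable X]setTI.
  apply: (measurableT_comp measurable_snd measurable_fst) => //.
  exact: measurable_upper.
have mswap : measurable_fun setT
    ((fun x => (x.1, (x.2.2, x.2.1))) : Omega * (TR * TR) -> Omega * (R * R)).
  apply: measurable_fun_pair => //; apply: measurable_fun_pair.
    exact: (measurableT_comp measurable_snd measurable_snd).
  exact: (measurableT_comp measurable_fst measurable_snd).
have m_y : measurable_fun (setT `*` upper)
    ((fun x => y x.1 x.2.2) : Omega * (TR * TR) -> mxB R m 1).
  have mD : measurable (setT `*` `[0, +oo[ : set (Omega * R)) by exact: measurableX.
  have mp : measurable_fun (setT `*` upper)
      ((fun x => (x.1, x.2.2)) : Omega * (TR * TR) -> Omega * R).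
    apply: measurable_funTS; apply: measurable_fun_pair => //.
    exact: (measurableT_comp measurable_snd measurable_snd).
  apply: (measurable_comp mD _ my mp).
  by move=> _ [[w [t s]] [_ /upper_quadrant[_ s0]] <-].
have m_z : measurable_fun (setT `*` upper)
    ((fun x => z x.1 x.2.1 x.2.2) : Omega * (TR * TR) -> mxB R m d).
  by apply: (measurable_funS mq2 _ mz) => x [_ /upper_quadrant].
have m_zT : measurable_fun (setT `*` upper)
    ((fun x => z x.1 x.2.2 x.2.1) : Omega * (TR * TR) -> mxB R m d).
  apply: (measurable_comp mq2 _ mz (measurable_funTS mswap)).
  by move=> _ [[w [t s]] [_ /upper_quadrant[t0 s0]] <-].
have mphi : measurable_fun (setT `*` upper)
    ((fun x => (x, (y x.1 x.2.2, (z x.1 x.2.1 x.2.2, z x.1 x.2.2 x.2.1)))) :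
     Omega * (TR * TR) -> (Omega * (R * R)) * (mxB R m 1 * (mxB R m d * mxB R m d))).
  apply: (measurable_fun_pair_in mU _ (measurable_fun_pair_in mU m_y
    (measurable_fun_pair_in mU m_z m_zT))).
  exact: measurable_funTS.
apply: (measurable_comp mF _ mg mphi).
by move=> _ [x [_ xu] <-].
Qed.

(** Makes the driver vanish beyond the horizon, where the extended solution is zero. The joint
    measurability needed by [ae_ae_swap] comes from [measurable_driver] at the zero processes, with
    weight exponent 0. *)
Lemma driver0_ae : {ae mu, forall t, {ae P, forall w, {ae mu, forall s,
  upper (t, s) -> g w t s 0 0 0 = 0}}}.
Proof.
have mU : measurable (setT `*` upper : set (Omega * (TR * TR))).
  by apply: measurableX => //; exact: measurable_upper.
have my0 : jmeas1 (fun (_ : Omega) (_ : R) => 0 : 'cV[R]_m) by exact: jmeas1_0.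
have mz0 : jmeas2 (fun (_ : Omega) (_ _ : R) => 0 : 'M[R]_(m, d)) by exact: jmeas2_0.
have mt : measurable_fun setT (fun x : Omega * (TR * TR) => x.2.1).
  exact: (measurableT_comp measurable_fst measurable_snd).
have mG := measurable_weighted 0 mU mt (measurable_driver my0 mz0).
set G := _ \_ _ in mG.
have GE w t s : upper (t, s) -> G (w, (t, s)) = frob (g w t s 0 0 0).
  by move=> ts; rewrite /G patchE mem_set//= mul0r expR0 mul1r.
have mS : measurable [set x : Omega * (TR * TR) | G x <= 0].
  by apply: measurable_set_le => //; exact: measurable_cst.
have h0 : {ae (mu \x mu)%E, forall ts, {ae P, forall w, G (w, ts) <= 0}}.
  have [_ _ _ _ g0] := hB; apply: (ae_imp g0) => -[t s] gts.
  have [ts|ts] := pselect (upper (t, s)); last first.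
    by apply: aeW => w; rewrite /G patchE memNset// => -[].
  apply: (ae_imp (gts ts)) => w /= gw; by rewrite GE// gw frob0.
apply: (ae_imp (ae_ae_swap mS h0)) => t aet; apply: (ae_imp aet) => w aew.
apply: (ae_imp aew) => s /= le0 ts; rewrite GE// in le0.
apply/matrixP => i j; have := frob_coord (g w t s 0 0 0) i j.
by move=> /le_trans /(_ le0); rewrite normr_le0 mxE => /eqP.
Qed.

Section two_solutions.
Variables (psi1 psi2 y1 y2 : Omega -> R -> 'cV[R]_m).
Variables (z1 z2 : Omega -> R -> R -> 'M[R]_(m, d)).
Hypothesis mpsi : jmeas1 (fun w t => psi1 w t - psi2 w t).
Hypothesis sol1 : msol psi1 y1 z1.
Hypothesis sol2 : msol psi2 y2 z2.
Variables c1 c2 c3 : R.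
Hypotheses (c10 : 0 < c1) (c20 : 0 < c2) (c30 : 0 < c3) (c_lt1 : c1 + c2 + c3 < 1).
Let k1 := kern Ky (eta + lambda).
Let k2 := kern Kz1 lambda.
Let k3 := kern Kz2 (eta + lambda).
Hypothesis k1c : (\int[mu]_u (k1 u)%:E <= c1%:E)%E.
Hypothesis k2c : (\int[mu]_u (k2 u ^+ 2)%:E <= (c2 ^+ 2)%:E)%E.
Hypothesis k3c : (\int[mu]_u (k3 u ^+ 2)%:E <= (c3 ^+ 2)%:E)%E.
Let dy w t := y1 w t - y2 w t.
Let dz w t s := z1 w t s - z2 w t s.
Let dpsi w t := psi1 w t - psi2 w t.

Let mdy : jmeas1 dy.
Proof. by case: sol1 => -[? _] _ _ _ _; case: sol2 => -[? _] _ _ _ _; exact: jmeas1B. Qed.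

Let mdz : jmeas2 dz.
Proof. by case: sol1 => -[_ ?] _ _ _ _; case: sol2 => -[_ ?] _ _ _ _; exact: jmeas2B. Qed.

Let mk1 : measurable_fun setT k1.
Proof. by have [_ _ [K1 K2 K3] _ _] := hB; exact: measurable_kern K1. Qed.

Let mk2 : measurable_fun setT k2.
Proof. by have [_ _ [K1 K2 K3] _ _] := hB; exact: measurable_kern K2. Qed.

Let mk3 : measurable_fun setT k3.
Proof. by have [_ _ [K1 K2 K3] _ _] := hB; exact: measurable_kern K3. Qed.

Let k10 u : 0 <= k1 u.
Proof. by have [_ _ [K1 K2 K3] _ _] := hB; exact: (kern_ge0 _ K1). Qed.

Let k20 u : 0 <= k2 u.
Proof. by have [_ _ [K1 K2 K3] _ _] := hB; exact: (kern_ge0 _ K2). Qed.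

Let k30 u : 0 <= k3 u.
Proof. by have [_ _ [K1 K2 K3] _ _] := hB; exact: (kern_ge0 _ K3). Qed.

(** [a], [b], [q] and [h] are the data of [volterra_bound]. The weight is included, and they vanish
    at negative times. *)
Let a (t : TR) : \bar R := (\int[P]_w (wt1 eta dy (w, t) ^+ 2)%:E)%E.
Let b (t : TR) : \bar R := (\int[P]_w \int[mu]_s (wt2 eta upper dz (w, (t, s)) ^+ 2)%:E)%E.
Let q (t : TR) : \bar R := (\int[P]_w (wt1 eta dpsi (w, t) ^+ 2)%:E)%E.
Let h (x : TR * TR) : \bar R := (\int[P]_w (wt2 eta lower dz (w, x) ^+ 2)%:E)%E.

Let m1 y : jmeas1 y -> measurable_fun setT (fun x => (wt1 eta y x ^+ 2)%:E).
Proof. by move=> my; apply: measurable_sqrE; exact: measurable_wt1. Qed.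

Let mup : measurable_fun setT (fun x => (wt2 eta upper dz x ^+ 2)%:E).
Proof.
apply: measurable_sqrE; apply: measurable_wt2 => //.
- exact: measurable_upper.
- exact: upper_quadrant.
Qed.

Let mqu z : jmeas2 z -> measurable_fun setT (fun x => (wt2 eta quadrant z x ^+ 2)%:E).
Proof.
move=> mz; apply: measurable_sqrE; apply: measurable_wt2 => //.
exact: measurableX.
Qed.

Let mlo : measurable_fun setT (fun x => (wt2 eta lower dz x ^+ 2)%:E).
Proof.
apply: measurable_sqrE; apply: measurable_wt2 => //.
- exact: measurable_lower.
- exact: lower_quadrant.
Qed.

Let sqrE0 T (f : T -> R) x : (0 <= (f x ^+ 2)%:E)%E.
Proof. by rewrite lee_fin sqr_ge0. Qed.

Let ma : measurable_fun setT a.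
Proof. exact: (measurable_fun_fubini_tonelli_G _ (m1 mdy) (sqrE0 _)). Qed.

Let mq : measurable_fun setT q.
Proof. exact: (measurable_fun_fubini_tonelli_G _ (m1 mpsi) (sqrE0 _)). Qed.

Let mh : measurable_fun setT h.
Proof. exact: (measurable_fun_fubini_tonelli_G _ mlo (sqrE0 _)). Qed.

Let mb : measurable_fun setT b.
Proof.
exact: (measurable_fun_fubini_tonelli_G _ (measurable_inner_integral mup (sqrE0 _))
  (fun x => integral_ge0 _ (fun s _ => sqrE0 _ _))).
Qed.

Let a0 t : (0 <= a t)%E. Proof. by apply: integral_ge0 => w _. Qed.
Let q0 t : (0 <= q t)%E. Proof. by apply: integral_ge0 => w _. Qed.
Let h0 x : (0 <= h x)%E. Proof. by apply: integral_ge0 => w _. Qed.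
Let b0 t : (0 <= b t)%E.
Proof. by apply: integral_ge0 => w _; exact: integral_ge0. Qed.

Let int_h t : (\int[mu]_s h (t, s) =
  \int[P]_w \int[mu]_s (wt2 eta lower dz (w, (t, s)) ^+ 2)%:E)%E.
Proof. by rewrite (tonelli2 P t mlo (sqrE0 _)). Qed.

Let energy2_dz_le : (energy2 quadrant dz <= \int[mu]_t b t + \int[mu]_t \int[mu]_s h (t, s))%E.
Proof.
rewrite (_ : \int[mu]_t \int[mu]_s h (t, s) = integral3 P (fun x => (wt2 eta lower dz x ^+ 2)%:E))%E.
  rewrite -[leRHS](integral3D P mup mlo (sqrE0 _) (sqrE0 _)).
  have mUL := emeasurable_funD mup mlo.
  apply: (le_integral3 P (mqu mdz) mUL (sqrE0 _)).
  - by move=> x; rewrite adde_ge0.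
  - by move=> x; rewrite -EFinD lee_fin wt2_quadrant_le.
by apply: eq_integral => t _; rewrite int_h.
Qed.

(** The a priori bound behind the absorption: the energy of a difference is at most twice the sum of
    the energies. *)
Let energy_finite : (\int[mu]_t a t + \int[mu]_t b t < +oo)%E.
Proof.
have [[my1 mz1] _ [ey1 ez1] _ _] := sol1; have [[my2 mz2] _ [ey2 ez2] _ _] := sol2.
apply: lte_add_pinfty.
- apply: (@le_lt_trans _ _ (2%:E * energy1 y1 + 2%:E * energy1 y2)%E); last first.
    exact: lty_2D.
  rewrite -[leLHS](fubini_tonelli2 _ (m1 mdy) (sqrE0 _)).
  rewrite /energy1 -(fubini_tonelli2 _ (m1 my1) (sqrE0 _)).
  rewrite -(fubini_tonelli2 _ (m1 my2) (sqrE0 _)).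
  apply: le_integral_2D => //; [exact: m1..|].
  by move=> x; rewrite -!EFinM -EFinD lee_fin; exact: wt1B_le.
- pose U z x : \bar R := (2%:E * (wt2 eta quadrant z x ^+ 2)%:E)%E.
  have mU z : jmeas2 z -> measurable_fun setT (U z).
    by move=> mz; apply: measurable_funeM; exact: mqu.
  have U0 z x : (0 <= U z x)%E by rewrite mule_ge0.
  apply: (@le_lt_trans _ _ (integral3 P (fun x => U z1 x + U z2 x)%E)).
    have mUU : measurable_fun setT (fun x => U z1 x + U z2 x)%E.
      by apply: emeasurable_funD; exact: mU.
    have UU0 x : (0 <= U z1 x + U z2 x)%E by rewrite adde_ge0.
    apply: (le_integral3 P mup mUU (sqrE0 _) UU0).
    + case=> w [t s]; rewrite /U -!EFinM -EFinD lee_fin.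
      have [ts|ts] := pselect (upper (t, s)); last first.
        by rewrite wt2_notin// expr0n/= addr_ge0// mulr_ge0// sqr_ge0.
      have := wt2B_le eta quadrant z1 z2 (w, (t, s)).
      by rewrite [in X in X -> _]wt2E ?wt2E//; exact: upper_quadrant.
  rewrite (integral3D P (mU _ mz1) (mU _ mz2) (U0 _) (U0 _)).
  rewrite (integral3Z P (mqu mz1) (sqrE0 _) (ler0n R 2)).
  rewrite (integral3Z P (mqu mz2) (sqrE0 _) (ler0n R 2)).
  exact: (lty_2D ez1 ez2).
Qed.

Let sqint_cst (c : R) : sqint P (fun=> c).
Proof.
split; first exact: measurable_cst.
by rewrite integral_cst// [X in (_ * X)%E](_ : _ = 1%E) ?mule1 ?ltry//; exact: probability_setT.
Qed.

(** [ito_energy] on the range from 0 to [t], with the constant difference [c] of the means as the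
    part known at time 0; its square is dropped. *)
Let M_energy_le : {ae mu, forall t, (\int[mu]_s h (t, s) <= a t)%E}.
Proof.
have [[my1 mz1] _ _ M1 _] := sol1; have [[my2 mz2] _ _ M2 _] := sol2.
apply: (ae_imp2 M1 M2) => t {}M1 {}M2; rewrite int_h.
have [t0|t0] := leP 0 t; last first.
  rewrite integral0_eq// => w _; rewrite integral0_eq// => s _.
  rewrite wt2_notin ?expr0n// => /andP[/= s0 st].
  by have := le_trans s0 st; rewrite leNgt t0.
have [I1 ito1 e1] := M1 t0; have [I2 ito2 e2] := M2 t0.
pose c := mean P (y1 ^~ t) - mean P (y2 ^~ t).
have mcut z i k : jmeas2 z ->
    measurable_fun setT (cutoff 0 t%:E (fun w s => z w t s i k)).
  by move=> mz; exact: measurable_cutoff_slice.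
have energy := ito_energy P_complete W_brownian (lexx 0) (fun i k => mcut _ i k mz1)
  (fun i k => mcut _ i k mz2) ito1 ito2 (X := fun=> c) (fun i => measurable_cst _)
  (fun i => sqint_cst (c i ord0)).
rewrite (integral_wt2_slice P eta measurable_lower lower_quadrant mdz
  (S := time_range 0 t%:E)); last by move=> s; split => [/andP|] [/= ? ?]; [|apply/andP].
rewrite /a integral_wt1_slice// lee_wpmul2l ?lee_fin ?sqr_ge0//.
rewrite [leRHS](ae_eq_integral (fun w => (frob (c + (I1 w - I2 w)) ^+ 2)%:E))//.
- rewrite energy leeDr//; apply: integral_ge0 => w _; exact: sqrE0.
- by apply: measurable_frob_sqr => i; exact: jmeas1_slice.
- apply: measurable_frob_sqr => i; under eq_fun do rewrite !mxE.
  apply: measurable_funD => //; apply: measurable_funB.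
    exact: (is_ito_sqint P_complete W_brownian (lexx 0) i (fun i k => mcut _ i k mz1) ito1).1.
  exact: (is_ito_sqint P_complete W_brownian (lexx 0) i (fun i k => mcut _ i k mz2) ito2).1.
- apply: filterS2 e1 e2 => w e1 e2 _; congr (_%:E).
  by rewrite /dy e1 e2 opprD addrACA.
Qed.

Let df w t s : 'cV[R]_m := expR (- (lambda * (s - t))) *:
  (g w t s (y1 w s) (z1 w t s) (z1 w s t) - g w t s (y2 w s) (z2 w t s) (z2 w s t)).

(** [G] and [H] are the weighted sides of the Lipschitz estimate as globally defined measurable
    functions, so that [ae_ae_swap] applies to the set where [G <= H]. In [H] the last process is
    evaluated at [(s, t)], below the diagonal and with weight e^(eta s). *)
Let G (x : Omega * (TR * TR)) : R :=
  ((fun x => expR (eta * x.2.1) * frob (df x.1 x.2.1 x.2.2)) \_ (setT `*` upper)) x.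

Let H (x : Omega * (TR * TR)) : R :=
  k1 (x.2.2 - x.2.1) * wt1 eta dy (x.1, x.2.2) +
  k2 (x.2.2 - x.2.1) * wt2 eta upper dz x +
  k3 (x.2.2 - x.2.1) * wt2 eta lower dz (x.1, (x.2.2, x.2.1)).

Let mG : measurable_fun setT G.
Proof.
have [[my1 mz1] _ _ _ _] := sol1; have [[my2 mz2] _ _ _ _] := sol2.
have mU : measurable (setT `*` upper : set (Omega * (TR * TR))).
  by apply: measurableX => //; exact: measurable_upper.
apply: (measurable_weighted eta (phi := fun x : Omega * (TR * TR) => x.2.1)) => //.
  exact: (measurableT_comp measurable_fst measurable_snd).
have /(measurable_mxBP _ mU) g1 := measurable_driver my1 mz1.
have /(measurable_mxBP _ mU) g2 := measurable_driver my2 mz2.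
apply/(measurable_mxBP _ mU) => i j; rewrite /df.
under eq_fun do rewrite !mxE.
apply: measurable_funM; last exact: measurable_funB.
apply: measurable_funTS; under eq_fun do rewrite -mulNr.
apply: measurable_expRM; apply: measurable_funB.
  exact: (measurableT_comp measurable_snd measurable_snd).
exact: (measurableT_comp measurable_fst measurable_snd).
Qed.

Let mH : measurable_fun setT H.
Proof.
have ms : measurable_fun setT (fun x : Omega * (TR * TR) => x.2.2).
  exact: (measurableT_comp measurable_snd measurable_snd).
have mt : measurable_fun setT (fun x : Omega * (TR * TR) => x.2.1).
  exact: (measurableT_comp measurable_fst measurable_snd).
have mB := measurable_funB ms mt.
have mwu := measurable_wt2 eta measurable_upper upper_quadrant mdz.
have mwl := measurable_wt2 eta measurable_lower lower_quadrant mdz.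
apply: measurable_funD; first apply: measurable_funD.
- apply: measurable_funM; first exact: (measurableT_comp mk1 mB).
  apply: (measurableT_comp (measurable_wt1 eta mdy)).
  exact: measurable_fun_pair.
- by apply: measurable_funM => //; exact: (measurableT_comp mk2 mB).
- apply: measurable_funM; first exact: (measurableT_comp mk3 mB).
  apply: (measurableT_comp mwl); apply: measurable_fun_pair => //.
  exact: measurable_fun_pair.
Qed.

Let H0 x : 0 <= H x.
Proof. by rewrite !addr_ge0// mulr_ge0// ?wt1_ge0 ?wt2_ge0. Qed.

Let lipschitz_ae : {ae mu, forall t, {ae P, forall w, {ae mu, forall s,
  G (w, (t, s)) <= H (w, (t, s))}}}.
Proof.
apply: (ae_ae_swap (measurable_set_le mG mH)).
have [_ _ _ Lip _] := hB; apply: (ae_imp Lip) => -[t s] {}Lip.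
have [ts|ts] := pselect (upper (t, s)); last first.
  by apply: aeW => w; rewrite /= /G patchE memNset// => -[].
apply: (ae_imp (Lip ts)) => w {}Lip.
have /andP[/= t0 le_ts] := ts; have s0 := le_trans t0 le_ts.
have u0 : 0 <= s - t by rewrite subr_ge0.
rewrite /= /G patchE mem_set//= /df frobZ ?expR_ge0//.
have := Lip (y1 w s) (y2 w s) (z1 w t s) (z2 w t s) (z1 w s t) (z2 w s t).
have EU : wt2 eta upper dz (w, (t, s)) = expR (eta * t) * frob (dz w t s) by exact: wt2E.
have EL : wt2 eta lower dz (w, (s, t)) = expR (eta * s) * frob (dz w s t) by exact: wt2E.
rewrite /= /H/= wt1E// EU EL.
rewrite /k1 /k2 /k3 !kernE//.
rewrite -[y1 w s - _]/(dy w s) -[z1 w t s - _]/(dz w t s) -[z1 w s t - _]/(dz w s t).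
(* The identity that shifts the exponent to eta + lambda for the two terms weighted at time [s]; the
   middle term is weighted at [t] and keeps lambda. *)
have eA : expR (- ((eta + lambda) * (s - t))) * expR (eta * s) =
    expR (eta * t) * expR (- (lambda * (s - t))).
  by rewrite -!expRD; congr expR; ring.
have E0 : 0 <= expR (eta * t) * expR (- (lambda * (s - t))) by rewrite mulr_ge0 ?expR_ge0.
move: eA E0; set e1 := expR (- _); set e2 := expR (eta * s); set e3 := expR (eta * t).
set e4 := expR (- _) => eA E0.
move=> /(ler_wpM2l E0); rewrite mulrA => /le_trans; apply.
rewrite le_eqVlt; apply/orP; left; apply/eqP.
rewrite !mulrDr; congr (_ + _ + _).
- by rewrite -eA; ring.
- by ring.
- by rewrite -eA; ring.
Qed.

Let driver y z w t s i : R :=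
  expR (- (lambda * (s - t))) * g w t s (y w s) (z w t s) (z w s t) i ord0.

Let driver_int y z w t : 'cV[R]_m :=
  \col_i (\int[mu]_(s in time_range t +oo%E) driver y z w t s i)%R.

Let driver_bound w t : 0 <= t ->
  (forall i, mu.-integrable (time_range t +oo%E) (fun s => (driver y1 z1 w t s i)%:E)) ->
  (forall i, mu.-integrable (time_range t +oo%E) (fun s => (driver y2 z2 w t s i)%:E)) ->
  {ae mu, forall s, G (w, (t, s)) <= H (w, (t, s))} ->
  ((expR (eta * t) * frob (driver_int y1 z1 w t - driver_int y2 z2 w t))%:E <=
   \int[mu]_s (H (w, (t, s)))%:E)%E.
Proof.
move=> t0 i1 i2 lip; pose D : set TR := time_range t +oo%E.
have mD : measurable D by exact: measurable_time_range.
have dfE s i : df w t s i ord0 = driver y1 z1 w t s i - driver y2 z2 w t s i.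
  by rewrite /df /driver !mxE mulrBr.
have idf i : mu.-integrable D (fun s => (df w t s i ord0)%:E).
  have := integrableB mD (i1 i) (i2 i); apply: eq_integrable => // s _.
  by rewrite dfE.
have -> : driver_int y1 z1 w t - driver_int y2 z2 w t =
    \col_i (\int[mu]_(s in D) df w t s i ord0)%R.
  apply/matrixP => i j; rewrite ord1 !mxE -(RintegralB mD (i1 i) (i2 i)).
  by apply: eq_Rintegral => s _; rewrite dfE.
have mdf : measurable_fun D (fun s => (frob (df w t s))%:E).
  apply/measurable_EFinP; apply: measurable_frob => //.
  apply: (measurable_mxBP (df w t : TR -> mxB R m 1) mD).2 => i j; rewrite ord1.
  by have /measurable_EFinP := measurable_int _ (idf i).
rewrite EFinM; apply: (le_trans (lee_wpmul2l _ (frob_col_integral_le mD idf))).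
  by rewrite lee_fin expR_ge0.
rewrite -ge0_integralZl//; last by move=> s _; rewrite lee_fin frob_ge0.
rewrite integral_mkcond [leLHS](_ : _ = \int[mu]_s (G (w, (t, s)))%:E)%E; last first.
  apply: eq_integral => s _; rewrite /G !patchE.
  have [Ds|Ds] := pselect (D s); last first.
    by rewrite !memNset// => -[_ /= /andP[/= _ ts]]; apply: Ds; rewrite /D/time_range/= ts leey.
  by rewrite !mem_set//; split => //; rewrite /upper/= t0; case: Ds.
have mpair : measurable_fun setT ((fun s => (w, (t, s))) : TR -> Omega * (TR * TR)).
  by apply: measurable_fun_pair.
apply: ae_ge0_le_integral => //.
- by move=> s _; rewrite lee_fin /G patchE; case: ifP => // _; rewrite mulr_ge0 ?expR_ge0 ?frob_ge0.
- by apply/measurable_EFinP; exact: (measurableT_comp mG mpair).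
- by move=> s _; rewrite lee_fin.
- by apply/measurable_EFinP; exact: (measurableT_comp mH mpair).
- by apply: (ae_imp lip) => s le _; rewrite lee_fin.
Qed.

(** Provides the square integrability of [dy] at a fixed [t], required by [ito_energy]. *)
Let a_lty : {ae mu, forall t, (a t < +oo)%E}.
Proof.
have ia : mu.-integrable setT a.
  apply/integrableP; split; first exact: ma.
  rewrite (eq_integral a); last by move=> t _; exact: gee0_abs (a0 t).
  apply: (le_lt_trans _ energy_finite).
  exact: leeDl (integral_ge0 _ (fun t _ => b0 t)).
apply: (ae_imp (integrable_ae measurableT ia)) => t /(_ I) fin.
by rewrite ltey_eq fin.
Qed.

(** Outcome by outcome, the three kernel terms produced by [kernel_sqr_bound]; their expectations
    are those in [volterra_bound]. *)
Let J1 t w := (\int[mu]_s (k1 (s - t)%R * wt1 eta dy (w, s) ^+ 2)%:E)%E.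
Let J2 t w := (\int[mu]_s (wt2 eta upper dz (w, (t, s)) ^+ 2)%:E)%E.
Let J3 t w := (\int[mu]_s (wt2 eta lower dz (w, (s, t)) ^+ 2)%:E)%E.

Let mshift (k : TR -> R) (t : TR) : measurable_fun setT k ->
  measurable_fun setT (fun s : TR => k (s - t)).
Proof.
by move=> mk; apply: (measurableT_comp mk); apply: measurable_funB.
Qed.

Let mJ1f t : measurable_fun setT
  (fun x : Omega * TR => (k1 (x.2 - t)%R * wt1 eta dy x ^+ 2)%:E).
Proof.
apply/measurable_EFinP; apply: measurable_funM.
  exact: (measurableT_comp (mshift t mk1) measurable_snd).
by apply: measurable_funX; exact: measurable_wt1.
Qed.

Let mJ3f t : measurable_fun setT
  (fun x : Omega * TR => (wt2 eta lower dz (x.1, (x.2, t)) ^+ 2)%:E).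
Proof.
apply: (measurableT_comp mlo); apply: measurable_fun_pair => //.
exact: measurable_fun_pair.
Qed.

Let J1f0 t x : (0 <= (k1 (x.2 - t)%R * wt1 eta dy x ^+ 2)%:E)%E.
Proof. by rewrite lee_fin mulr_ge0// sqr_ge0. Qed.

Let J10 t w : (0 <= J1 t w)%E.
Proof. by apply: integral_ge0 => s _; exact: (J1f0 t (w, s)). Qed.

Let J20 t w : (0 <= J2 t w)%E. Proof. by apply: integral_ge0 => s _. Qed.
Let J30 t w : (0 <= J3 t w)%E. Proof. by apply: integral_ge0 => s _. Qed.

Let mJ1 t : measurable_fun setT (J1 t).
Proof. exact: (measurable_fun_fubini_tonelli_F _ (mJ1f t) (J1f0 t)). Qed.

Let mJ2 t : measurable_fun setT (J2 t).
Proof. exact: (measurable_integral2 mup (sqrE0 _) t). Qed.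

Let mJ3 t : measurable_fun setT (J3 t).
Proof. exact: (measurable_fun_fubini_tonelli_F _ (mJ3f t) (sqrE0 _)). Qed.

Let int_J1 t : (\int[P]_w J1 t w = \int[mu]_s ((k1 (s - t)%R)%:E * a s))%E.
Proof.
rewrite /J1 (fubini_tonelli _ (mJ1f t) (J1f0 t)); apply: eq_integral => s _.
rewrite /a -ge0_integralZl//; first exact: (measurableT_comp (m1 mdy)).
by rewrite lee_fin.
Qed.

Let int_J3 t : (\int[P]_w J3 t w = \int[mu]_s h (s, t))%E.
Proof. exact: (fubini_tonelli _ (mJ3f t) (sqrE0 _)). Qed.

Let pathwise_bound t w : 0 <= t ->
  (forall i, mu.-integrable (time_range t +oo%E) (fun s => (driver y1 z1 w t s i)%:E)) ->
  (forall i, mu.-integrable (time_range t +oo%E) (fun s => (driver y2 z2 w t s i)%:E)) ->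
  {ae mu, forall s, G (w, (t, s)) <= H (w, (t, s))} ->
  ((expR (eta * t) ^+ 2 *
      frob (dpsi w t + (driver_int y1 z1 w t - driver_int y2 z2 w t)) ^+ 2)%:E <=
   (1 - (c1 + c2 + c3))^-1%:E * (wt1 eta dpsi (w, t) ^+ 2)%:E +
   (J1 t w + c2%:E * J2 t w + c3%:E * J3 t w))%E.
Proof.
move=> t0 i1 i2 lip; set v := driver_int y1 z1 w t - driver_int y2 z2 w t.
set k := c1 + c2 + c3; have k_gt0 : 0 < k by rewrite !addr_gt0.
have mpair : measurable_fun setT ((fun s => (w, (t, s))) : TR -> Omega * (TR * TR)).
  by apply: measurable_fun_pair.
have mpair' : measurable_fun setT ((fun s => (w, (s, t))) : TR -> Omega * (TR * TR)).
  by apply: measurable_fun_pair => //; exact: measurable_fun_pair.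
have shift (f : TR -> R) (c : R) : measurable_fun setT f -> (forall u, 0 <= f u) ->
    (\int[mu]_u (f u)%:E <= c%:E -> \int[mu]_u (f (u - t)%R)%:E <= c%:E)%E.
  move=> mf f0; rewrite (ge0_integralT_shift (f := fun u => (f u)%:E))//.
  exact/measurable_EFinP.
have vle := kernel_sqr_bound (mulr_ge0 (expR_ge0 (eta * t)) (frob_ge0 v)) c10 c20 c30
  (mshift t mk1) (mshift t mk2) (mshift t mk3)
  (measurableT_comp (measurable_wt1 eta mdy) (measurable_pair1 w))
  (measurableT_comp (measurable_wt2 eta measurable_upper upper_quadrant mdz) mpair)
  (measurableT_comp (measurable_wt2 eta measurable_lower lower_quadrant mdz) mpair')
  (fun s => k10 _) (fun s => k20 _) (fun s => k30 _)
  (fun s => wt1_ge0 _ _ _) (fun s => wt2_ge0 _ _ _ _) (fun s => wt2_ge0 _ _ _ _)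
  (shift _ _ mk1 k10 k1c)
  (shift _ _ (measurable_funX 2 mk2) (fun u => sqr_ge0 _) k2c)
  (shift _ _ (measurable_funX 2 mk3) (fun u => sqr_ge0 _) k3c)
  (driver_bound t0 i1 i2 lip).
have k01 : 0 < k < 1 by rewrite k_gt0.
apply: (@le_trans _ _ ((1 - k)^-1 * wt1 eta dpsi (w, t) ^+ 2 +
    k^-1 * (expR (eta * t) * frob v) ^+ 2)%:E).
  have := ler_wpM2l (sqr_ge0 (expR (eta * t))) (frob_sqrD_le (dpsi w t) v k01).
  rewrite lee_fin wt1E// !exprMn => /le_trans; apply; rewrite le_eqVlt.
  by apply/orP; left; apply/eqP; ring.
(* The factor [k^-1] of the convexity split now meets the factor [k] of [vle]. *)
rewrite EFinD EFinM leeD2l// EFinM.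
apply: (le_trans (lee_wpmul2l _ vle)); first by rewrite lee_fin invr_ge0 ltW.
by rewrite muleA -EFinM mulVf ?gt_eqF// mul1e.
Qed.

(** The expectation of [pathwise_bound]. The two equations, valid almost surely, identify
    [dy + (I1 - I2)] with the left side of that bound, and the Ito isometry identifies its weighted
    second moment with [a t + b t]. *)
Let volterra_ineq : {ae mu, forall t, (a t + b t <= (1 - (c1 + c2 + c3))^-1%:E * q t +
    (\int[mu]_s ((k1 (s - t)%R)%:E * a s) + c2%:E * b t +
     c3%:E * \int[mu]_s h (s, t)))%E}.
Proof.
have [[my1 mz1] ad1 _ _ eq1] := sol1; have [[my2 mz2] ad2 _ _ eq2] := sol2.
have r0 : 0 <= (1 - (c1 + c2 + c3))^-1 by rewrite invr_ge0 subr_ge0 ltW.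
have := ae_imp2 lipschitz_ae a_lty (fun t l f => conj l f).
move=> /(ae_imp2 (ae_imp2 eq1 eq2 (fun t e1 e2 => conj e1 e2))); apply.
move=> t [{}eq1 {}eq2] [lip a_fin].
have mpsit : measurable_fun setT (fun w => (wt1 eta dpsi (w, t) ^+ 2)%:E).
  exact: (measurableT_comp (m1 mpsi)).
rewrite -int_J1 -int_J3 -[b t]/(\int[P]_w J2 t w)%E.
have comb := ge0_integral_comb P r0 (ltW c20) (ltW c30) mpsit (mJ1 t) (mJ2 t) (mJ3 t)
  (fun w => sqrE0 _ _) (J10 t) (J20 t) (J30 t).
rewrite -[leRHS]comb.
have ge0E (x : R) : 0 <= x -> (0 <= x%:E)%E by rewrite lee_fin.
have rhs0 w := adde_ge0 (mule_ge0 (ge0E _ r0) (sqrE0 (wt1 eta dpsi) (w, t)))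
  (adde_ge0 (adde_ge0 (J10 t w) (mule_ge0 (ge0E _ (ltW c20)) (J20 t w)))
  (mule_ge0 (ge0E _ (ltW c30)) (J30 t w))).
(* At negative times the left-hand side is 0, by the cutoff in the weights. *)
have [t0|t0] := leP 0 t; last first.
  have -> : a t = 0%E by apply: integral0_eq => w _; rewrite wt1_lt0// expr0n.
  have -> : (\int[P]_w J2 t w = 0)%E.
    apply: integral0_eq => w _; apply: integral0_eq => s _.
    rewrite wt2_notin ?expr0n// => /andP[/= ts _].
    by move: t0; rewrite ltNge ts.
  by rewrite add0e; apply: integral_ge0 => w _; exact: rhs0.
have [I1 ito1 {}eq1] := eq1 (conj t0 (leey _)).
have [I2 ito2 {}eq2] := eq2 (conj t0 (leey _)).
have mcut z i k : jmeas2 z ->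
    measurable_fun setT (cutoff t +oo%E (fun w s => z w t s i k)).
  by move=> mz; exact: measurable_cutoff_slice.
(* By adaptedness [dy] at time [t] is the part known when the stochastic integral from [t] on
   begins. *)
have adX i : measurable_fun setT
    ((fun w => dy w t i ord0) : g_sigma_algebraType (filt P W t) -> R).
  have t0' : [set` `[0, +oo[] t by rewrite /= in_itv/= t0.
  have /(measurable_mxBP _ measurableT) /(_ i ord0) m1' := ad1 t t0'.
  have /(measurable_mxBP _ measurableT) /(_ i ord0) m2' := ad2 t t0'.
  under eq_fun do rewrite /dy !mxE.
  exact: measurable_funB.
have energy := ito_energy P_complete W_brownian t0 (fun i k => mcut _ i k mz1)
  (fun i k => mcut _ i k mz2) ito1 ito2 adX (fun i => sqint_coord i mdy t0 a_fin).
have mI (I : Omega -> 'cV[R]_m) z i : jmeas2 z ->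
    is_ito P W t +oo%E (fun w s => z w t s) I -> measurable_fun setT (fun w => I w i ord0).
  move=> mz ito.
  exact: (is_ito_sqint P_complete W_brownian t0 i (fun i k => mcut _ i k mz) ito).1.
have mX : measurable_fun setT (fun w => (frob (dy w t + (I1 w - I2 w)) ^+ 2)%:E).
  apply: measurable_frob_sqr => i; under eq_fun do rewrite !mxE.
  apply: measurable_funD.
    have := jmeas1_slice t0 mdy i.
    by under eq_fun do rewrite /dy !mxE.
  by apply: measurable_funB; [exact: mI ito1|exact: mI ito2].
have lhs0 w : (0 <= (expR (eta * t) ^+ 2 *
    frob (dy w t + (I1 w - I2 w)) ^+ 2)%:E)%E.
  by rewrite lee_fin mulr_ge0// sqr_ge0.
have mlhs : measurable_fun setT (fun w => (expR (eta * t) ^+ 2 *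
    frob (dy w t + (I1 w - I2 w)) ^+ 2)%:E).
  by apply/measurable_EFinP; apply: measurable_funM => //; exact/measurable_EFinP.
have mrhs := emeasurable_funD (measurable_funeM _ mpsit) (emeasurable_funD
  (emeasurable_funD (mJ1 t) (measurable_funeM _ (mJ2 t))) (measurable_funeM _ (mJ3 t))).
have -> : (a t + \int[P]_w J2 t w)%E =
    (\int[P]_w (expR (eta * t) ^+ 2 * frob (dy w t + (I1 w - I2 w)) ^+ 2)%:E)%E.
  have Ds s : upper (t, s) <-> time_range t +oo%E s.
    split => [/andP[/= _ ts]|[ts _]]; first by split; rewrite ?leey.
    by rewrite /upper/= t0.
  have Ea := integral_wt1_slice P eta mdy t0.
  have Eb := integral_wt2_slice P eta measurable_upper upper_quadrant mdz Ds.
  transitivity ((expR (eta * t) ^+ 2)%:E * \int[P]_w (frob (dy w t) ^+ 2)%:E +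
    (expR (eta * t) ^+ 2)%:E * \int[P]_w \int[mu]_(s in time_range t +oo%E)
      (frob (dz w t s) ^+ 2)%:E)%E; first by congr (_ + _)%E; [exact: Ea|exact: Eb].
  rewrite -ge0_muleDr; last 2 first.
  - by apply: integral_ge0 => w _; exact: sqrE0.
  - by apply: integral_ge0 => w _; apply: integral_ge0 => s _; exact: sqrE0.
  rewrite -energy -(ge0_integralZl P measurableT mX (fun w _ => sqrE0 _ _)
    (ge0E _ (sqr_ge0 (expR (eta * t))))).
  by apply: eq_integral => w _; rewrite EFinM.
apply: (ae_ge0_le_integral measurableT (fun w _ => lhs0 w) mlhs (fun w _ => rhs0 w) (mrhs _ _ _)).
apply: (ae_imp (ae_and (ae_and eq1 eq2) lip)) => w [[[i1 e1] [i2 e2]] {}lip] _.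
apply: le_trans (pathwise_bound t0 i1 i2 lip); rewrite lee_fin.
rewrite (_ : dy w t + _ = dpsi w t + (driver_int y1 z1 w t - driver_int y2 z2 w t)).
  exact: lexx.
have gen (p1 v1 l1 p2 v2 l2 : 'cV[R]_m) :
    p1 + v1 - l1 - (p2 + v2 - l2) + (l1 - l2) = p1 - p2 + (v1 - v2).
  by apply/matrixP => i j; rewrite !mxE; ring.
by rewrite /dy e1 e2; exact: gen.
Qed.

(** [volterra_bound] controls dY and dZ above the diagonal; dZ below the diagonal has at most the
    energy of dY, whence the additional factor 2. *)
Lemma stability : (energy1 dy + energy2 quadrant dz <=
  (2 * (1 - (c1 + c2 + c3))^-1 ^+ 2)%:E * energy1 dpsi)%E.
Proof.
have := volterra_bound ma mb mq mh mk1 a0 b0 q0 h0 k10 (ltW c10) (ltW c20) (ltW c30)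
  c_lt1 k1c volterra_ineq M_energy_le energy_finite.
set e := _ ^+ 2 => le.
have mih : measurable_fun setT (fun t => \int[mu]_s h (t, s))%E.
  exact: (measurable_fun_fubini_tonelli_F _ mh h0).
have le' : (\int[mu]_t \int[mu]_s h (t, s) <= \int[mu]_t a t)%E.
  apply: (@ae_ge0_le_integral _ _ _ mu setT measurableT _ _
    (fun t _ => integral_ge0 _ (fun s _ => h0 _)) mih (fun t _ => a0 t) ma).
  by apply: filterS M_energy_le => t + _.
have : (energy1 dy + energy2 quadrant dz <=
    2%:E * (\int[mu]_t a t + \int[mu]_t b t))%E.
  have aux (x w y v : \bar R) : (0 <= y -> w <= y + v -> v <= x ->
      x + w <= 2%:E * (x + y))%E.
    move=> y0 wyv vx; rewrite mule_natl mule2n -addeA leeD2l//.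
    apply: (le_trans wyv); rewrite leeD2l//.
    by apply: (le_trans vx); rewrite leeDl.
  exact: (aux _ _ _ _ (integral_ge0 _ (fun t _ => b0 t)) energy2_dz_le le').
move=> /le_trans; apply.
rewrite EFinM -muleA; apply: lee_wpmul2l; last exact: le.
by rewrite lee_fin.
Qed.

End two_solutions.

End stability.

(** * Kernel constants and extension of stochastic integrals *)

Section kernel_constants.
Context {R : realType}.
Local Notation TR := (measurableTypeR R).
Local Notation mu := (@lebesgue_measure R).

Lemma bracketE p (K : R -> R) (rho : R) : (0 < p)%N -> Lpstar p K ->
  (bracket p K rho < +oo)%E -> exists2 b : R, 0 <= b & bracket p K rho = b%:E /\
    (\int[mu]_u (kern K rho u ^+ p)%:E = (b ^+ p)%:E)%E.
Proof.
move=> p0 K0; rewrite /bracket integral_kern//; set I := (\int[mu]_u _)%E.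
have I0 : (0 <= I)%E.
  by apply: integral_ge0 => u _; rewrite lee_fin exprn_ge0// (kern_ge0 _ K0).
have := poweR_ge0 I p%:R^-1; case E : (I `^ _)%E => [b| |]// b0 _.
exists b => //; split => //.
have pr : p%:R != 0 :> R by rewrite pnatr_eq0 -lt0n.
by rewrite -[LHS]poweRe1// -(mulVf pr) poweRrM E poweR_EFin powR_mulrn.
Qed.

Lemma kernel_constants (Ky Kz1 Kz2 : R -> R) (rho lambda : R) :
  Lpstar 1 Ky -> Lpstar 2 Kz1 -> Lpstar 2 Kz2 ->
  (bracket 1 Ky rho + bracket 2 Kz1 lambda + bracket 2 Kz2 rho < 1)%E ->
  exists c : R * (R * R),
    [/\ 0 < c.1 /\ 0 < c.2.1 /\ 0 < c.2.2, c.1 + c.2.1 + c.2.2 < 1,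
        (\int[mu]_u (kern Ky rho u)%:E <= c.1%:E)%E,
        (\int[mu]_u (kern Kz1 lambda u ^+ 2)%:E <= (c.2.1 ^+ 2)%:E)%E &
        (\int[mu]_u (kern Kz2 rho u ^+ 2)%:E <= (c.2.2 ^+ 2)%:E)%E].
Proof.
move=> L1 L2 L3 lt1.
have ge0 p (K : R -> R) r : (0 <= bracket p K r)%E by exact: poweR_ge0.
have lt_oo (x y z : \bar R) : (0 <= x -> 0 <= y -> 0 <= z -> x + y + z < 1 ->
    [/\ x < +oo, y < +oo & z < +oo])%E.
  by case: x => [x| |]; case: y => [y| |]; case: z => [z| |]//=; rewrite ?ltry.
have [f1 f2 f3] := lt_oo _ _ _ (ge0 _ _ _) (ge0 _ _ _) (ge0 _ _ _) lt1.
have [b1 b10 [e1 i1]] := bracketE (isT : (0 < 1)%N) L1 f1.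
have [b2 b20 [e2 i2]] := bracketE (isT : (0 < 2)%N) L2 f2.
have [b3 b30 [e3 i3]] := bracketE (isT : (0 < 2)%N) L3 f3.
move: lt1; rewrite e1 e2 e3 -!EFinD lte_fin => lt1.
(* Each bracket is enlarged by [e], using half of the gap below 1 in total. The constants become
   strictly positive even for a vanishing kernel, as the divisions in [kernel_sqr_bound] demand. *)
pose e := (1 - (b1 + b2 + b3)) / 6.
have e0 : 0 < e by rewrite divr_gt0// subr_gt0.
have le_sqr (b : R) : 0 <= b -> b ^+ 2 <= (b + e) ^+ 2.
  by move=> b0; rewrite lerXn2r ?nnegrE// ?addr_ge0// ?lerDl ltW.
exists (b1 + e, (b2 + e, b3 + e)); split => /=.
- by rewrite !ltr_wpDl.
- by rewrite /e; lra.
- rewrite (eq_integral (fun u => (kern Ky rho u ^+ 1)%:E))//.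
  by rewrite i1 lee_fin expr1 lerDl ltW.
- by rewrite i2 lee_fin le_sqr.
- by rewrite i3 lee_fin le_sqr.
Qed.

Lemma ereal_cvg0 T (F : set_system T) (FF : Filter F) (f : T -> \bar R) :
  (forall x, 0 <= f x)%E ->
  (forall e : R, 0 < e -> \forall x \near F, (f x <= e%:E)%E) -> f x @[x --> F] --> 0%E.
Proof.
move=> f0 fe; apply/fine_cvgP; split.
  apply: filterS (fe 1 ltr01) => x fx1; rewrite fin_numE.
  by move: fx1 (f0 x); case: (f x).
apply/cvgrPdist_le => e /fe; apply: filterS => x fxe.
rewrite sub0r normrN /= ger0_norm ?fine_ge0//.
by move: fxe (f0 x); case: (f x).
Qed.

End kernel_constants.

(** * Stochastic integrals under a change of integrand or range *)

Section ito_extension.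
Context {R : realType} {disp : measure_display} {Omega : measurableType disp}.
Variables (P : probability Omega R) (d : nat) (W : Omega -> R -> 'cV[R]_d).
Local Notation mu := (@lebesgue_measure R).

Lemma is_ito_eq m a b (z z' : Omega -> R -> 'M[R]_(m, d)) I :
  (forall w s, time_range a b s -> z w s = z' w s) ->
  is_ito P W a b z I -> is_ito P W a b z' I.
Proof.
move=> zz' [J zJ IJ]; exists J; [move=> k i|exact: IJ]; have [mJ [h [sh cz cJ]]] := zJ k i.
split; [exact: mJ|exists h].
have E : (fun n => \int[P]_w \int[mu]_(s in time_range a b)
      ((sp_val (h n) w s - z' w s i k) ^+ 2)%:E)%E =
    (fun n => \int[P]_w \int[mu]_(s in time_range a b)
      ((sp_val (h n) w s - z w s i k) ^+ 2)%:E)%E.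
  apply/funext => n; apply: eq_integral => w _; apply: eq_integral => s /set_mem sab.
  by rewrite zz'.
by split; [exact: sh|exact: (eq_ind_r (fun f => f @ \oo --> 0%E) cz E)|exact: cJ].
Qed.

Lemma is_ito0 m a b : (a%:E <= b)%E -> is_ito P W a b (fun _ _ => 0 : 'M[R]_(m, d)) (fun=> 0).
Proof.
move=> ab; exists (fun _ _ => 0); last by move=> w; rewrite big1.
move=> k i; split; first exact: measurable_cst.
(* A process without steps; its single time [a] must still lie in the range, which is where [ab]
   enters. *)
pose h (n : nat) := SimpleProcess 0 (fun=> a) (fun _ (_ : Omega) => 0).
exists h; split.
- by move=> n; split => //; exists 0.
- suff E : (fun n : nat => \int[P]_w \int[mu]_(s in time_range a b)
        ((sp_val (h n) w s - (0 : 'M[R]_(m, d)) i k) ^+ 2)%:E)%E = (fun=> 0%E).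
    exact: (eq_ind_r (fun f => f @ \oo --> 0%E) (cvg_cst _) E).
  apply/funext => n; apply: integral0_eq => w _; apply: integral0_eq => s _.
  by rewrite /sp_val/= big_ord0 mxE subrr expr0n.
- suff E : (fun n : nat => \int[P]_w
        ((sp_integral W k (h n) w - (0 : 'cV[R]_m) i ord0) ^+ 2)%:E)%E = (fun=> 0%E).
    exact: (eq_ind_r (fun f => f @ \oo --> 0%E) (cvg_cst _) E).
  apply/funext => n; apply: integral0_eq => w _.
  by rewrite /sp_integral/= big_ord0 mxE subrr expr0n.
Qed.

(** The same simple processes approximate: their steps end by [T], and beyond [T] both they and [z']
    vanish. *)
Lemma is_ito_extend m a (T : R) (z z' : Omega -> R -> 'M[R]_(m, d)) I :
  (forall w s, a <= s <= T -> z' w s = z w s) ->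
  (forall w s, T < s -> z' w s = 0) ->
  is_ito P W a T%:E z I -> is_ito P W a +oo%E z' I.
Proof.
move=> zz' z'0 [J zJ IJ]; exists J; [move=> k i|exact: IJ]; have [mJ [h [sh cz cJ]]] := zJ k i.
split; [exact: mJ|exists h].
suff E : (fun n => \int[P]_w \int[mu]_(s in time_range a +oo%E)
      ((sp_val (h n) w s - z' w s i k) ^+ 2)%:E)%E =
    (fun n => \int[P]_w \int[mu]_(s in time_range a T%:E)
      ((sp_val (h n) w s - z w s i k) ^+ 2)%:E)%E.
  split; [|exact: (eq_ind_r (fun f => f @ \oo --> 0%E) cz E)|exact: cJ].
  by move=> n; have [h1 h2 h3 h4 h5] := sh n; split => //; exact: leey.
apply/funext => n; apply: eq_integral => w _.
rewrite integral_mkcond [RHS]integral_mkcond; apply: eq_integral => s _; rewrite !patchE.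
have [sT|Ts] := leP s T.
  have [as_|as_] := leP a s.
    rewrite mem_set; last by split => //; rewrite leey.
    by rewrite mem_set ?zz' ?as_ ?sT//; split => //; rewrite lee_fin.
  by rewrite !memNset// => -[]; rewrite leNgt as_.
rewrite [in RHS]memNset; last by move=> [_]; rewrite lee_fin leNgt Ts.
rewrite z'0// mxE (_ : sp_val (h n) w s = 0) ?subrr ?expr0n; last first.
  rewrite /sp_val big1// => j _; rewrite indicE memNset ?mulr0//.
  rewrite /= in_itv/= => /andP[_ sj]; have := lt_le_trans Ts sj.
  rewrite ltNge => /negP; apply; rewrite -lee_fin.
  exact: (simple_time_le (sh n) (ltn_ord j)).
by case: ifP.
Qed.

End ito_extension.

(** * Extension by zero *)

Lemma integral_wtD {R : realType} {disp : measure_display} {Omega : measurableType disp}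
    (P : probability Omega R) (m d : nat) (eta : R) (y : Omega -> R -> 'cV[R]_m)
    (z : Omega -> R -> R -> 'M[R]_(m, d)) : jmeas1 y -> jmeas2 z ->
  (\int[P]_w (\int[lebesgue_measure]_t (wt1 eta y (w, t) ^+ 2)%:E +
     \int[lebesgue_measure]_t \int[lebesgue_measure]_s
       (wt2 eta quadrant z (w, (t, s)) ^+ 2)%:E) =
   energy1 P eta y + energy2 P eta quadrant z)%E.
Proof.
move=> my mz.
have sq0 T' (f : T' -> R) x : (0 <= (f x ^+ 2)%:E)%E by rewrite lee_fin sqr_ge0.
have m1 := measurable_sqrE (measurable_wt1 eta my).
have mq : measurable (quadrant : set (measurableTypeR R * measurableTypeR R)).
  exact: measurableX.
have m2 := measurable_sqrE (measurable_wt2 eta mq (@subset_refl _ _) mz).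
have mA := measurable_fun_fubini_tonelli_F (m2 := @lebesgue_measure R) _ m1 (sq0 _ _).
have mB := measurable_fun_fubini_tonelli_F (m2 := @lebesgue_measure R) _
  (measurable_inner_integral m2 (sq0 _ _)) (fun x => integral_ge0 _ (fun s _ => sq0 _ _ _)).
rewrite (ge0_integralD P measurableT (fun w _ => integral_ge0 _ (fun t _ => sq0 _ _ _)) mA
  (fun w _ => integral_ge0 _ (fun t _ => integral_ge0 _ (fun s _ => sq0 _ _ _))) mB).
congr (_ + _)%E; last exact: (tonelli3 P m2 (sq0 _ _)).
exact: (fubini_tonelli _ m1 (sq0 _ _)).
Qed.

Section zero_extension.
Context {R : realType} {disp : measure_display} {Omega : measurableType disp}.
Variables (P : probability Omega R) (m d : nat) (W : Omega -> R -> 'cV[R]_d).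
Variables (T : R) (eta : R).
Local Notation TR := (measurableTypeR R).
Local Notation mu := (@lebesgue_measure R).
Implicit Types (y : Omega -> R -> 'cV[R]_m) (z : Omega -> R -> R -> 'M[R]_(m, d)).

(** Written with a scalar indicator so as to be convertible with the processes [YT] and [ZT] of the
    theorem and with the free term of the finite horizon equation. *)
Definition extend1 y w t : 'cV[R]_m := \1_(`[0, T] : set R) t *: y w t.

Definition extend2 z w t s : 'M[R]_(m, d) :=
  \1_(`[0%R, T] `*` `[0%R, T] : set (R * R)) (t, s) *: z w t s.

Lemma extend1_in y w t : 0 <= t <= T -> extend1 y w t = y w t.
Proof. by move=> tT; rewrite /extend1 indicE mem_set ?scale1r//= in_itv. Qed.

Lemma extend1_out y w t : T < t -> extend1 y w t = 0.
Proof.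
move=> tT; rewrite /extend1 indicE memNset ?scale0r//= in_itv/= => /andP[_].
by rewrite leNgt tT.
Qed.

Lemma extend2_in z w t s : 0 <= t <= T -> 0 <= s <= T -> extend2 z w t s = z w t s.
Proof.
by move=> tT sT; rewrite /extend2 indicE mem_set ?scale1r//; split; rewrite /= in_itv.
Qed.

Lemma extend2_outl z w t s : T < t -> extend2 z w t s = 0.
Proof.
move=> tT; rewrite /extend2 indicE memNset ?scale0r// => -[/= + _].
by rewrite in_itv/= => /andP[_]; rewrite leNgt tT.
Qed.

Lemma extend2_outr z w t s : T < s -> extend2 z w t s = 0.
Proof.
move=> tT; rewrite /extend2 indicE memNset ?scale0r// => -[/= _].
by rewrite in_itv/= => /andP[_]; rewrite leNgt tT.
Qed.

Lemma jmeas1_extend y : measurable_fun (setT `*` (`[0, T] : set R))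
    ((fun x => y x.1 x.2) : Omega * R -> mxB R m 1) -> jmeas1 (extend1 y).
Proof.
have mD : measurable (setT `*` `[0, +oo[ : set (Omega * R)) by exact: measurableX.
have mDT : measurable (setT `*` `[0, T] : set (Omega * R)) by exact: measurableX.
move=> /(measurable_mxBP _ mDT) my; apply/(measurable_mxBP _ mD) => i j.
apply: measurable_funTS.
rewrite (_ : (fun x => _) = (fun x => y x.1 x.2 i j) \_ (setT `*` `[0, T])).
  exact: (measurable_restrictT (fun x : Omega * R => y x.1 x.2 i j) mDT).1 (my i j).
apply/funext => -[w t]; rewrite patchE /extend1 mxE/= indicE.
have [tT|tT] := pselect (`[0, T]%classic t).
  by rewrite !mem_set// mul1r.
by rewrite !memNset ?mul0r// => -[].
Qed.

Lemma jmeas2_extend z : measurable_fun (setT `*` ((`[0, T] : set R) `*` (`[0, T] : set R)))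
    ((fun x => z x.1 x.2.1 x.2.2) : Omega * (R * R) -> mxB R m d) ->
  jmeas2 (extend2 z).
Proof.
have mD : measurable (setT `*` (`[0, +oo[ `*` `[0, +oo[) : set (Omega * (R * R))).
  by apply: measurableX => //; exact: measurableX.
have mDT : measurable (setT `*` (`[0, T] `*` `[0, T]) : set (Omega * (R * R))).
  by apply: measurableX => //; exact: measurableX.
move=> /(measurable_mxBP _ mDT) mz; apply/(measurable_mxBP _ mD) => i j.
apply: measurable_funTS.
rewrite (_ : (fun x => _) =
    (fun x => z x.1 x.2.1 x.2.2 i j) \_ (setT `*` (`[0, T] `*` `[0, T]))).
  exact: (measurable_restrictT (fun x : Omega * (R * R) => z x.1 x.2.1 x.2.2 i j) mDT).1
    (mz i j).
apply/funext => -[w [t s]]; rewrite patchE /extend2 mxE/= indicE.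
have [tT|tT] := pselect ((`[0, T]%classic `*` `[0, T]%classic) (t, s)).
  by rewrite !mem_set// mul1r.
by rewrite !memNset ?mul0r// => -[].
Qed.

Lemma extend_adapted y : adapted P W `[0%R, T] y -> adapted P W `[0%R, +oo[ (extend1 y).
Proof.
move=> ady t; rewrite /= in_itv/= andbT => t0; have [tT|Tt] := leP t T.
  rewrite (_ : (extend1 y) ^~ t = y ^~ t); first by apply: ady; rewrite /= in_itv/= t0.
  by apply/funext => w; rewrite extend1_in// t0.
apply/measurable_mxBP => // i j; rewrite (_ : (fun x => _) = cst 0).
  exact: measurable_cst.
by apply/funext => w; rewrite extend1_out// mxE.
Qed.

Let expR_eta_le t : 0 <= t <= T -> expR (eta * t) ^+ 2 <= expR (`|eta| * T) ^+ 2.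
Proof.
move=> /andP[t0 tT]; rewrite lerXn2r ?nnegrE ?expR_ge0// ler_expR.
by rewrite (le_trans (ler_norm _))// normrM (ger0_norm t0) ler_wpM2l.
Qed.

Lemma wt1_extend_le y x :
  wt1 eta (extend1 y) x ^+ 2 <= expR (`|eta| * T) ^+ 2 * wt1 0 (extend1 y) x ^+ 2.
Proof.
case: x => w t; have [t0|t0] := leP 0 t; last by rewrite !wt1_lt0// expr0n/= mulr0.
rewrite !wt1E// mul0r expR0 mul1r; have [tT|Tt] := leP t T; last first.
  by rewrite extend1_out// frob0 mulr0 expr0n/= mulr0.
by rewrite exprMn ler_wpM2r ?sqr_ge0// expR_eta_le// t0.
Qed.

Lemma wt2_extend_le z x : wt2 eta quadrant (extend2 z) x ^+ 2 <=
  expR (`|eta| * T) ^+ 2 * wt2 0 quadrant (extend2 z) x ^+ 2.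
Proof.
case: x => w [t s]; have [q|q] := pselect (quadrant (t, s)); last first.
  by rewrite !wt2_notin// expr0n/= mulr0.
rewrite !wt2E// mul0r expR0 mul1r; have [tT|Tt] := leP t T; last first.
  by rewrite extend2_outl// frob0 mulr0 expr0n/= mulr0.
rewrite exprMn ler_wpM2r ?sqr_ge0// expR_eta_le// tT andbT.
by case: q => /=; rewrite in_itv/= andbT.
Qed.

Lemma M_relation_extend y z t : 0 <= t -> (t <= T -> M_relation P W y z t) ->
  M_relation P W (extend1 y) (extend2 z) t.
Proof.
move=> t0 Mt; have [tT|Tt] := leP t T.
  have [I ito e] := Mt tT; have yE : (extend1 y) ^~ t = y ^~ t.
    by apply/funext => w; rewrite extend1_in// t0.
  exists I; last by rewrite yE; apply: (ae_imp e) => w; rewrite extend1_in// t0.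
  apply: is_ito_eq ito => w s [s0]; rewrite lee_fin => st.
  by rewrite extend2_in// ?t0// s0 (le_trans st).
(* After [T] the relation reads 0 = E[0] + 0. *)
have yE : (extend1 y) ^~ t = fun=> 0 by apply/funext => w; rewrite extend1_out.
exists (fun=> 0); last first.
  apply: aeW => w; rewrite extend1_out// yE addr0; apply/matrixP => i j.
  have z0 : (fun _ : Omega => (0 : 'cV[R]_m) i ord0) = cst 0 by apply/funext => v; rewrite mxE.
  by rewrite /mean mxE [RHS]mxE z0 expectation_cst.
apply: is_ito_eq (is_ito0 P W m _); last by rewrite lee_fin.
by move=> w s _; rewrite extend2_outl.
Qed.

Lemma integral_wt1_extend y w :
  (\int[mu]_t (wt1 0 (extend1 y) (w, t) ^+ 2)%:E =
   \int[mu]_(t in `[0%R, T]) (frob (y w t) ^+ 2)%:E)%E.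
Proof.
rewrite [in RHS]integral_mkcond; apply: eq_integral => t _; rewrite patchE.
have [tT|tT] := pselect (`[0, T]%classic t).
  rewrite mem_set//; move: tT; rewrite /= in_itv/= => tT.
  by rewrite wt1E ?extend1_in ?mul0r ?expR0 ?mul1r//; case/andP: tT.
rewrite memNset//; have [t0|t0] := leP 0 t; last by rewrite wt1_lt0 ?expr0n.
have Tt : T < t by rewrite ltNge; apply/negP => tT'; apply: tT; rewrite /= in_itv/= t0.
by rewrite wt1E// extend1_out// frob0 mulr0 expr0n.
Qed.

Lemma integral_wt2_extend z w :
  (\int[mu]_t \int[mu]_s (wt2 0 quadrant (extend2 z) (w, (t, s)) ^+ 2)%:E =
   \int[mu]_(t in `[0%R, T]) \int[mu]_(s in `[0%R, T]) (frob (z w t s) ^+ 2)%:E)%E.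
Proof.
rewrite [in RHS]integral_mkcond; apply: eq_integral => t _; rewrite patchE.
have [tT|tT] := pselect (`[0, T]%classic t); last first.
  rewrite memNset//; apply: integral0_eq => s _.
  have [[/= t0 s0]|q] := pselect (quadrant (t, s)); last by rewrite wt2_notin ?expr0n.
  have Tt : T < t.
    rewrite ltNge; apply/negP => tT'; apply: tT; rewrite /= in_itv/= tT' andbT.
    by move: t0; rewrite in_itv/= andbT.
  by rewrite wt2E; [rewrite extend2_outl// frob0 mulr0 expr0n|split].
rewrite mem_set//; move: tT; rewrite /= in_itv/= => tT; have [t0 _] := andP tT.
rewrite [in RHS]integral_mkcond; apply: eq_integral => s _; rewrite patchE.
have [sT|sT] := pselect (`[0, T]%classic s).
  rewrite mem_set//; move: sT; rewrite /= in_itv/= => sT; have [s0 _] := andP sT.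
  rewrite wt2E; last by split; rewrite /= in_itv/= ?t0 ?s0.
  by rewrite extend2_in// mul0r expR0 mul1r.
rewrite memNset//; have [s0|s0] := leP 0 s; last first.
  by rewrite wt2_notin ?expr0n// => -[_ /=]; rewrite in_itv/= andbT leNgt s0.
have Ts : T < s by rewrite ltNge; apply/negP => sT'; apply: sT; rewrite /= in_itv/= s0.
rewrite wt2E; last by split; rewrite /= in_itv/= ?t0 ?s0.
by rewrite extend2_outr// frob0 mulr0 expr0n.
Qed.

(** On a bounded horizon the weight is at most e^(|eta| T), whatever the sign of [eta], so the
    weighted energies are controlled by those with exponent 0, which are the integrals of
    [M2_finite]. *)
Lemma energy_extend y z : M2_finite P W T y z ->
  (energy1 P eta (extend1 y) < +oo)%E /\ (energy2 P eta quadrant (extend2 z) < +oo)%E.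
Proof.
move=> [[/jmeas1_extend my /jmeas2_extend mz] _ _ fin _].
have sq0 T' (f : T' -> R) x : (0 <= (f x ^+ 2)%:E)%E by rewrite lee_fin sqr_ge0.
have m1 e := measurable_sqrE (measurable_wt1 e my).
have mq : measurable (quadrant : set (TR * TR)) by exact: measurableX.
have m2 e := measurable_sqrE (measurable_wt2 e mq (@subset_refl _ _) mz).
have {}fin : (energy1 P 0 (extend1 y) + energy2 P 0 quadrant (extend2 z) < +oo)%E.
  rewrite -(integral_wtD P 0 my mz); apply: le_lt_trans fin; rewrite le_eqVlt; apply/orP; left.
  by apply/eqP/eq_integral => w _; rewrite integral_wt1_extend integral_wt2_extend.
pose M := expR (`|eta| * T) ^+ 2; have M0 : 0 <= M by exact: sqr_ge0.
have split_lty (x x' : \bar R) : (0 <= x -> 0 <= x' -> x + x' < +oo -> x < +oo /\ x' < +oo)%E.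
  by case: x => [x| |]; case: x' => [x'| |]//= _ _ _; rewrite !ltry.
have mul_lty (x : \bar R) : (x < +oo -> M%:E * x < +oo)%E.
  by move=> xoo; rewrite lte_mul_pinfty ?lee_fin.
have e10 : (0 <= energy1 P 0 (extend1 y))%E.
  by apply: integral_ge0 => t _; exact: integral_ge0.
have e20 : (0 <= energy2 P 0 quadrant (extend2 z))%E.
  by apply: integral_ge0 => t _; apply: integral_ge0 => w _; exact: integral_ge0.
have [f1 f2] := split_lty _ _ e10 e20 fin.
split.
- apply: le_lt_trans (mul_lty _ f1).
  rewrite /energy1 -(fubini_tonelli2 _ (m1 eta) (sq0 _ _)).
  rewrite -(fubini_tonelli2 _ (m1 0) (sq0 _ _)).
  rewrite -(ge0_integralZl _ measurableT (m1 0) (fun x _ => sq0 _ _ x)) ?lee_fin//.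
  apply: ge0_le_integral => //; first exact: measurable_funeM.
  by move=> x _; rewrite -EFinM lee_fin wt1_extend_le.
- apply: le_lt_trans (mul_lty _ f2).
  rewrite /energy2 -(integral3Z P (m2 0) (sq0 _ _) M0).
  apply: (le_integral3 P (m2 eta) (measurable_funeM _ (m2 0)) (sq0 _ _)).
    by move=> x; rewrite -EFinM lee_fin mulr_ge0// sqr_ge0.
  by move=> x; rewrite -EFinM lee_fin wt2_extend_le.
Qed.

End zero_extension.

(** * The extension by zero as a solution with infinite horizon *)

Section extended_solutions.
Context {R : realType} {disp : measure_display} {Omega : measurableType disp}.
Variables (P : probability Omega R) (m d : nat) (W : Omega -> R -> 'cV[R]_d).
Variable g : Omega -> R -> R -> 'cV[R]_m -> 'M[R]_(m, d) -> 'M[R]_(m, d) -> 'cV[R]_m.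
Variables (Ky Kz1 Kz2 : R -> R) (eta lambda : R).
Hypothesis hB : assumption_B P W g Ky Kz1 Kz2.
Local Notation TR := (measurableTypeR R).
Local Notation mu := (@lebesgue_measure R).
Implicit Types (y : Omega -> R -> 'cV[R]_m) (z : Omega -> R -> R -> 'M[R]_(m, d)).

Lemma jmeas1_filt_oo y : measurable_fun (setT `*` (`[0, +oo[ : set R))
    ((fun x => y x.1 x.2) : g_sigma_algebraType (filt_oo P W) * R -> mxB R m 1) ->
  measure_is_complete P -> is_brownian P W -> jmeas1 y.
Proof.
move=> my P_complete W_brownian.
have mid : measurable_fun setT (id : Omega -> g_sigma_algebraType (filt_oo P W)).
  move=> _ B mB; rewrite setTI.
  have : <<s filt_oo P W >> B by [].
  apply: smallest_sub; first exact: sigma_algebra_measurable.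
  by move=> A; exact: (measurable_filt_oo P_complete W_brownian).
have mD : measurable (setT `*` `[0, +oo[ : set (g_sigma_algebraType (filt_oo P W) * R)).
  exact: measurableX.
have mp : measurable_fun (setT `*` `[0, +oo[ : set (Omega * R)) ((fun x => (x.1, x.2)) :
    Omega * R -> g_sigma_algebraType (filt_oo P W) * R).
  apply: measurable_funTS; apply: measurable_fun_pair => //.
  exact: (measurableT_comp mid measurable_fst).
apply: (measurable_comp mD _ my mp).
by move=> _ [[w t] [_ t0] <-].
Qed.

Lemma msol_M2 psi y z : measure_is_complete P -> is_brownian P W ->
  M2_F P W eta y z -> solves_bsvie P W g lambda +oo%E psi y z ->
  msol P W g eta lambda psi y z.
Proof.
move=> P_complete W_brownian [[[my ey] ady] [mz _ ez] M] eqn.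
have my' := jmeas1_filt_oo my P_complete W_brownian.
split => //; split.
- by rewrite /energy1 -energy1E.
- by rewrite /energy2 /integral3 -energy2E.
Qed.

Let driver y z w t s i : R :=
  expR (- (lambda * (s - t))) * g w t s (y w s) (z w t s) (z w s t) i ord0.

Lemma measurable_driver_slice y z w t i : jmeas1 y -> jmeas2 z -> 0 <= t ->
  measurable_fun (time_range t +oo%E : set TR) (fun s => (driver y z w t s i)%:E).
Proof.
move=> my mz t0; have mD : measurable (time_range t +oo%E : set TR).
  exact: measurable_time_range.
have mU : measurable (setT `*` upper : set (Omega * (TR * TR))).
  by apply: measurableX => //; exact: measurable_upper.
have /(measurable_mxBP _ mU) /(_ i ord0) mg := measurable_driver hB my mz.
have mp : measurable_fun (time_range t +oo%E : set TR)
    ((fun s => (w, (t, s))) : TR -> Omega * (TR * TR)).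
  by apply: measurable_funTS; apply: measurable_fun_pair.
apply/measurable_EFinP; apply: measurable_funM.
  apply: measurable_funTS; under eq_fun do rewrite -mulNr.
  by apply: measurable_expRM; apply: measurable_funB.
apply: (measurable_comp mU _ mg mp).
by move=> _ [s [/= ts _] <-]; split => //; rewrite /upper/= t0.
Qed.

Variable T : R.

(** Up to [T] the integrand is unchanged; after [T] all its process arguments are 0, and the driver
    vanishes for a.e. [s]. The case [t > T] is included, the range on the right being empty. *)
Lemma driver_extend y z w t : jmeas1 (extend1 T y) -> jmeas2 (extend2 T z) -> 0 <= t ->
  {ae mu, forall s, upper (t, s) -> g w t s 0 0 0 = 0} ->
  (forall i, mu.-integrable (time_range t T%:E) (fun s => (driver y z w t s i)%:E)) ->
  forall i, mu.-integrable (time_range t +oo%E)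
      (fun s => (driver (extend1 T y) (extend2 T z) w t s i)%:E) /\
    (\int[mu]_(s in time_range t +oo%E) driver (extend1 T y) (extend2 T z) w t s i =
     \int[mu]_(s in time_range t T%:E) driver y z w t s i)%R.
Proof.
move=> my mz t0 g0 ify i; set F := driver (extend1 T y) (extend2 T z) w t.
have mD : measurable (time_range t +oo%E : set TR) by exact: measurable_time_range.
have mDT : measurable (time_range t T%:E : set TR) by exact: measurable_time_range.
pose phi : TR -> \bar R := (fun s => (driver y z w t s i)%:E) \_ (time_range t T%:E).
have iphi : mu.-integrable (time_range t +oo%E : set TR) phi.
  apply: (@integrableS _ _ _ _ setT) => //.
  by rewrite -(integrable_mkcond _ mDT); exact: ify.
have mF : measurable_fun (time_range t +oo%E : set TR) (fun s => (F s i)%:E).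
  exact: measurable_driver_slice.
have Fphi : {ae mu, forall s, time_range t +oo%E s -> (F s i)%:E = phi s}.
  apply: (ae_imp g0) => s gts [ts _]; rewrite /phi patchE; have [sT|Ts] := leP s T.
    rewrite mem_set; last by split; rewrite ?lee_fin.
    have s0 := le_trans t0 ts; have tT := le_trans ts sT.
    by rewrite /F /driver extend1_in ?s0// !extend2_in ?s0 ?t0.
  rewrite memNset; last by case => _; rewrite lee_fin leNgt Ts.
  rewrite /F /driver extend1_out// extend2_outr// extend2_outl//.
  by rewrite gts ?mxE ?mulr0// /upper/= t0.
have intE : (\int[mu]_(s in time_range t +oo%E) (F s i)%:E =
    \int[mu]_(s in time_range t T%:E) (driver y z w t s i)%:E)%E.
  rewrite (ae_eq_integral phi)//; last exact: (measurable_int _ iphi).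
  rewrite [in LHS]integral_mkcond [in RHS]integral_mkcond; apply: eq_integral => s _.
  rewrite /phi !patchE; case: (boolP (s \in time_range t T%:E)) => [|_]; last by case: ifP.
  by rewrite inE => -[ts _]; rewrite mem_set//; split; rewrite ?leey.
split; last by rewrite /Rintegral intE.
apply/integrableP; split => //.
rewrite (ae_eq_integral (fun s => `|phi s|)%E)//.
- by have /integrableP[] := iphi.
- exact: measurableT_comp.
- by apply: measurableT_comp => //; exact: (measurable_int _ iphi).
- by apply: (ae_imp Fphi) => s Fs /Fs ->.
Qed.

Lemma solves_extend psi y z : jmeas1 (extend1 T y) -> jmeas2 (extend2 T z) ->
  solves_bsvie P W g lambda T%:E (extend1 T psi) y z ->
  solves_bsvie P W g lambda +oo%E (extend1 T psi) (extend1 T y) (extend2 T z).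
Proof.
move=> my mz eqn; apply: (ae_imp2 eqn (driver0_ae hB)) => t et g0 [t0 _].
have [tT|Tt] := leP t T.
  have [I ito e] : exists2 I, is_ito P W t T%:E (fun w s => z w t s) I & _ :=
    et (conj t0 tT).
  exists I.
    apply: is_ito_extend ito => w s.
      by move=> /andP[ts sT]; rewrite extend2_in ?t0 ?(le_trans t0 ts).
    by move=> Ts; rewrite extend2_outr.
  apply: (ae_imp (ae_and e g0)) => w [[iy ey] gw].
  have drv := driver_extend my mz t0 gw iy.
  split; first by move=> i; have [] := drv i.
  rewrite extend1_in ?t0// ey; congr (_ + _ - _); apply/matrixP => i j; rewrite !mxE.
  by rewrite (drv i).2.
exists (fun=> 0).
  apply: is_ito_eq (is_ito0 P W m (leey _)) => w s _.
  by rewrite extend2_outl.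
apply: (ae_imp g0) => w gw.
(* After the horizon the equation is 0 = 0: the driver integral reduces to one over the empty
   range. *)
have e0 : time_range t T%:E = set0.
  by apply/seteqP; split => // s [ts]; rewrite lee_fin => /(le_trans ts); rewrite leNgt Tt.
have iy i : mu.-integrable (time_range t T%:E) (fun s => (driver y z w t s i)%:E).
  by rewrite e0; exact: integrable_set0.
have drv := driver_extend my mz t0 gw iy.
split; first by move=> i; have [] := drv i.
rewrite extend1_out// extend1_out// add0r subr0; apply/matrixP => i j.
by rewrite !mxE (drv i).2 e0 /Rintegral integral_set0.
Qed.

Lemma msol_extend psi y z : M2_finite P W T y z ->
  solves_bsvie P W g lambda T%:E (extend1 T psi) y z ->
  msol P W g eta lambda (extend1 T psi) (extend1 T y) (extend2 T z).
Proof.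
move=> hyz eqn; have [[my mz] ady _ _ M] := hyz.
have my' := jmeas1_extend my; have mz' := jmeas2_extend mz.
split => //.
- exact: (extend_adapted ady).
- exact: (energy_extend eta hyz).
- by apply: (ae_imp M) => t Mt t0; apply: M_relation_extend => // tT; apply: Mt; rewrite t0.
- exact: (solves_extend my' mz' eqn).
Qed.

End extended_solutions.

(** * Convergence of the projected free term *)

Section projection.
Context {R : realType} {disp : measure_display} {Omega : measurableType disp}.
Variables (P : probability Omega R) (m d : nat) (W : Omega -> R -> 'cV[R]_d).
Hypothesis P_complete : measure_is_complete P.
Hypothesis W_brownian : is_brownian P W.
Variables (eta : R) (psi : Omega -> R -> 'cV[R]_m).
Implicit Types y : Omega -> R -> 'cV[R]_m.
Hypothesis hpsi : L2_Foo P W eta psi.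
Local Notation TR := (measurableTypeR R).
Local Notation mu := (@lebesgue_measure R).

Let mpsi : jmeas1 psi.
Proof. by have [my _] := hpsi; exact: (jmeas1_filt_oo my P_complete W_brownian). Qed.

Let second_moment (y : Omega -> R -> 'cV[R]_m) (t : TR) : \bar R :=
  (\int[P]_w (wt1 eta y (w, t) ^+ 2)%:E)%E.

Let A := second_moment psi.

Let sqrE0 T' (f : T' -> R) x : (0 <= (f x ^+ 2)%:E)%E.
Proof. by rewrite lee_fin sqr_ge0. Qed.

Let m1 y : jmeas1 y -> measurable_fun setT (fun x => (wt1 eta y x ^+ 2)%:E).
Proof. by move=> my; apply: measurable_sqrE; exact: measurable_wt1. Qed.

Let sm0 y t : (0 <= second_moment y t)%E.
Proof. by apply: integral_ge0 => w _. Qed.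

Let msm y : jmeas1 y -> measurable_fun setT (second_moment y).
Proof. by move=> my; exact: (measurable_fun_fubini_tonelli_G _ (m1 my) (sqrE0 _)). Qed.

Let integral_A_lty : (\int[mu]_t A t < +oo)%E.
Proof. by have [_] := hpsi; rewrite energy1E. Qed.

Let integrable_A : mu.-integrable setT A.
Proof.
apply/integrableP; split; first exact: (msm mpsi).
rewrite (eq_integral A); last by move=> t _; exact: gee0_abs (sm0 psi t).
exact: integral_A_lty.
Qed.

Let A_lty : {ae mu, forall t, (A t < +oo)%E}.
Proof.
apply: (ae_imp (integrable_ae measurableT integrable_A)) => t /(_ I) fin.
by rewrite ltey_eq fin.
Qed.

Section fixed_horizon.
Variables (T : R) (E : Omega -> R -> 'cV[R]_m).
Hypothesis mE : jmeas1 (extend1 T E).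

Let condexp_at t := forall i, is_condexp P (filt P W T)
  (fun w => psi w t i ord0) (fun w => E w t i ord0).

(** The L2 contraction of conditional expectation, coordinate by coordinate; it makes the dominating
    function independent of the horizon. *)
Lemma projection_le t : (A t < +oo)%E -> (0 <= t <= T -> condexp_at t) ->
  (second_moment (extend1 T E) t <= A t)%E.
Proof.
move=> fin ce; have [t0|t0] := leP 0 t; last first.
  rewrite /second_moment integral0_eq; first exact: sm0.
  by move=> w _; rewrite wt1_lt0// expr0n.
have [tT|Tt] := leP t T; last first.
  rewrite /second_moment integral0_eq; first exact: sm0.
  by move=> w _; rewrite wt1E// extend1_out// frob0 mulr0 expr0n.
rewrite /second_moment /A /second_moment !integral_wt1_slice//.
rewrite lee_wpmul2l ?lee_fin ?sqr_ge0// !integral_frob_sqr; last 2 first.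
- by move=> i; exact: jmeas1_slice.
- by move=> i; exact: jmeas1_slice.
apply: lee_sum => i _.
have sX := sqint_coord i mpsi t0 fin.
have t0T : 0 <= t <= T by rewrite t0.
have [_] := condexp_contraction (filt_sigma_algebra P W T)
  (fun B => @measurable_filt _ _ _ _ _ _ P_complete W_brownian T B) (ce t0T i) sX.
apply: le_trans; rewrite le_eqVlt; apply/orP; left; apply/eqP.
by apply: eq_integral => w _; rewrite extend1_in// t0.
Qed.

Lemma projection_error_le t : (A t < +oo)%E -> (0 <= t <= T -> condexp_at t) ->
  (second_moment (fun w t => psi w t - extend1 T E w t)%R t <= 2%:E * A t + 2%:E * A t)%E.
Proof.
move=> fin ce.
have ms y : jmeas1 y -> measurable_fun setT (fun w => (wt1 eta y (w, t) ^+ 2)%:E).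
  by move=> my; exact: (measurableT_comp (m1 my)).
apply: (@le_trans _ _ (2%:E * A t + 2%:E * second_moment (extend1 T E) t)%E).
  apply: (le_integral_2D P (ms _ (jmeas1B mpsi mE)) (ms _ mpsi) (ms _ mE)) => // w.
  by rewrite -!EFinM -EFinD lee_fin wt1B_le.
by rewrite leeD2l// lee_wpmul2l ?lee_fin// projection_le.
Qed.

Lemma projection_errorE t : 0 <= t <= T ->
  second_moment (fun w t => psi w t - extend1 T E w t) t =
  ((expR (eta * t) ^+ 2)%:E *
     \sum_i \int[P]_w ((psi w t i ord0 - E w t i ord0) ^+ 2)%:E)%E.
Proof.
move=> /andP[t0 tT]; have me := jmeas1B mpsi mE.
rewrite /second_moment integral_wt1_slice// integral_frob_sqr; last first.
  by move=> i; exact: (jmeas1_slice t0 me).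
congr (_ * _)%E; apply: eq_bigr => i _; apply: eq_integral => w _.
by rewrite extend1_in ?t0// !mxE.
Qed.

End fixed_horizon.

Section sequence_of_horizons.
Variables (T_ : nat -> R) (E_ : nat -> Omega -> R -> 'cV[R]_m).
Hypothesis T_ge : forall n, n.+1%:R <= T_ n.
Hypothesis mE : forall n, jmeas1 (extend1 (T_ n) (E_ n)).
Hypothesis ceE : forall n, {ae mu, forall t, 0 <= t <= T_ n -> forall i,
  is_condexp P (filt P W (T_ n)) (fun w => psi w t i ord0) (fun w => E_ n w t i ord0)}.

Let F n := second_moment (fun w t => psi w t - extend1 (T_ n) (E_ n) w t).

Lemma projection_error_cvg t : (A t < +oo)%E ->
  (forall n, 0 <= t <= T_ n -> forall i,
    is_condexp P (filt P W (T_ n)) (fun w => psi w t i ord0) (fun w => E_ n w t i ord0)) ->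
  F n t @[n --> \oo] --> 0%E.
Proof.
move=> fin ce; apply: ereal_cvg0 => [n|e e0]; first exact: sm0.
have [t0|t0] := leP 0 t; last first.
  near=> n; rewrite /F /second_moment integral0_eq ?lee_fin ?ltW//.
  by move=> w _; rewrite wt1_lt0// expr0n.
pose c := expR (eta * t) ^+ 2; have c0 : 0 < c by rewrite exprn_gt0// expR_gt0.
(* Tolerance per coordinate: [c] is the squared weight at [t], and [m.+1] is a positive bound on the
   number of coordinates. *)
pose e' := e / (c * m.+1%:R).
have e'0 : 0 < e' by rewrite divr_gt0// mulr_gt0.
have cvg_i i : exists2 s, 0 <= s & forall n, s <= T_ n -> t <= T_ n ->
    (\int[P]_w ((psi w t i ord0 - E_ n w t i ord0) ^+ 2)%:E <= e'%:E)%E.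
  have [my _] := hpsi.
  have mX := @jmeas1_slice _ _ (g_sigma_algebraType (filt_oo P W)) _ _ _ t0 my i.
  have sX := sqint_coord i mpsi t0 fin.
  have [s s0 Hs] := condexp_cvg P_complete W_brownian mX sX e'0.
  by exists s => // n sT tT; apply: (Hs (T_ n)) => //; apply: ce; rewrite t0.
have [s s0 Hs] : exists2 s : 'I_m -> R, (forall i, 0 <= s i) & forall i n,
    s i <= T_ n -> t <= T_ n ->
    (\int[P]_w ((psi w t i ord0 - E_ n w t i ord0) ^+ 2)%:E <= e'%:E)%E.
  have /choice[s Hs] : forall i, exists s, 0 <= s /\ forall n, s <= T_ n -> t <= T_ n ->
    (\int[P]_w ((psi w t i ord0 - E_ n w t i ord0) ^+ 2)%:E <= e'%:E)%E.
    by move=> i; have [s ? ?] := cvg_i i; exists s.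
  by exists s => i; have [] := Hs i.
(* All summands are nonnegative, so the sum serves as an upper bound for [t] and for every threshold
   [s i]. *)
pose N := t + \sum_i s i.
near=> n; have NT : N <= T_ n.
  apply: le_trans (T_ge n); apply: (@le_trans _ _ n%:R); last by rewrite ler_nat.
  by near: n; exact: nbhs_infty_ger.
have tT : t <= T_ n by apply: le_trans NT; rewrite lerDl sumr_ge0.
have t0T : 0 <= t <= T_ n by rewrite t0.
rewrite /F (projection_errorE (mE n) t0T).
apply: (@le_trans _ _ (c%:E * \sum_(i < m) e'%:E)%E).
  apply: lee_wpmul2l; first by rewrite lee_fin ltW.
  apply: lee_sum => i _; apply: Hs => //.
  apply: le_trans NT; rewrite /N (bigD1 i)//= addrCA lerDl addr_ge0//.
  by rewrite sumr_ge0.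
rewrite sumEFin -EFinM lee_fin sumr_const card_ord -mulr_natr /e'.
have kM : m%:R <= m.+1%:R :> R by rewrite ler_nat.
have M0 : 0 < m.+1%:R :> R by [].
move: kM M0; set M : R := m.+1%:R; set k : R := m%:R => kM M0.
rewrite (_ : c * (e / (c * M) * k) = e * (k / M)); last by field; rewrite !gt_eqF.
by rewrite ler_piMr ?(ltW e0)// ler_pdivrMr// mul1r.
Unshelve. all: by end_near. Qed.

(** Dominated convergence in [t] with dominating function 4 A. Along a sequence the exceptional null
    sets of times form a countable union; the growth condition on [T_] is what the contradiction
    argument of the theorem supplies. *)
Lemma projection_energy_cvg :
  energy1 P eta (fun w t => psi w t - extend1 (T_ n) (E_ n) w t) @[n --> \oo] --> 0%E.
Proof.
have ce : {ae mu, forall t, forall n, 0 <= t <= T_ n -> forall i,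
    is_condexp P (filt P W (T_ n)) (fun w => psi w t i ord0) (fun w => E_ n w t i ord0)}.
  exact: ae_foralln.
have mF n : measurable_fun setT (F n) by apply: msm; exact: jmeas1B.
pose G t := (2%:E * A t + 2%:E * A t)%E.
have iG : mu.-integrable setT G.
  by apply: integrableD => //; apply: integrableZl.
have cvgF : {ae mu, forall t, setT t -> F n t @[n --> \oo] --> cst 0%E t}.
  by apply: (ae_imp2 A_lty ce) => t fin ct _; exact: projection_error_cvg.
have domF : {ae mu, forall t n, setT t -> (`|F n t| <= G t)%E}.
  apply: (ae_imp2 A_lty ce) => t fin ct n _; rewrite gee0_abs; last exact: sm0.
  by apply: projection_error_le => //; exact: ct.
have [_ _] := dominated_convergence measurableT mF (measurable_cst 0%E) cvgF iG domF.
by rewrite integral0.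
Qed.

End sequence_of_horizons.

End projection.

(** * Convergence of the truncated solutions *)

Theorem theorem3p9 (R : realType) (disp : measure_display)
    (Omega : measurableType disp) (P : probability Omega R)
    (m d : nat) (m_gt0 : (0 < m)%N) (d_gt0 : (0 < d)%N)
    (W : Omega -> R -> 'cV[R]_d)
    (P_complete : measure_is_complete P)
    (W_brownian : is_brownian P W)
    (g : Omega -> R -> R -> 'cV[R]_m -> 'M[R]_(m, d) -> 'M[R]_(m, d) -> 'cV[R]_m)
    (Ky Kz1 Kz2 : R -> R)
    (hB : assumption_B P W g Ky Kz1 Kz2)
    (eta lambda : R)
    (hK : (bracket 1 Ky (eta + lambda) + bracket 2 Kz1 lambda +
           bracket 2 Kz2 (eta + lambda) < 1)%E)
    (psi : Omega -> R -> 'cV[R]_m)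
    (hpsi : L2_Foo P W eta psi)
    (Y : Omega -> R -> 'cV[R]_m) (Z : Omega -> R -> R -> 'M[R]_(m, d))
    (hYZ : M2_F P W eta Y Z)
    (hYZ_eq : solves_bsvie P W g lambda +oo%E psi Y Z)
    (* for each T > 0, a measurable version of t |-> E_T[psi(t)] *)
    (Epsi : R -> Omega -> R -> 'cV[R]_m)
    (hEpsi_meas : forall T, 0 < T ->
       measurable_fun (setT `*` (`[0, T] : set R))
         ((fun x => Epsi T x.1 x.2) : Omega * R -> mxB R m 1))
    (hEpsi : forall T, 0 < T ->
       {ae (@lebesgue_measure R), forall t, 0 <= t <= T -> forall i,
          is_condexp P (filt P W T)
            (fun w => psi w t i ord0) (fun w => Epsi T w t i ord0)})
    (tY : R -> Omega -> R -> 'cV[R]_m)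
    (tZ : R -> Omega -> R -> R -> 'M[R]_(m, d))
    (htYZ : forall T, 0 < T -> M2_finite P W T (tY T) (tZ T))
    (htYZ_eq : forall T, 0 < T ->
       solves_bsvie P W g lambda T%:E
         (fun w t => \1_(`[0, T] : set R) t *: Epsi T w t) (tY T) (tZ T)) :
  let YT T w t := \1_(`[0, T] : set R) t *: tY T w t in
  let ZT T w t s :=
    \1_(`[0%R, T] `*` `[0%R, T] : set (R * R)) (t, s) *: tZ T w t s in
  (\int[P]_w
     (\int[lebesgue_measure]_(t in `[0%R, +oo[)
        (expR (2 * eta * t) * frob (Y w t - YT T w t) ^+ 2)%:E +
      \int[lebesgue_measure]_(t in `[0%R, +oo[)
        ((expR (2 * eta * t))%:E *
         \int[lebesgue_measure]_(s in `[0%R, +oo[)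
           (frob (Z w t s - ZT T w t s) ^+ 2)%:E)))%E
    @[T --> +oo] --> 0%E.
Proof.
move=> YT ZT.
have [_ _ [K1 K2 K3] _ _] := hB.
have [c [[c10 [c20 c30]] c_lt1 k1c k2c k3c]] := kernel_constants K1 K2 K3 hK.
pose C : R := 2 * (1 - (c.1 + c.2.1 + c.2.2))^-1 ^+ 2.
have C0 : 0 < C by rewrite mulr_gt0// exprn_gt0// invr_gt0 subr_gt0.
have mpsi : jmeas1 psi.
  by have [my _] := hpsi; exact: (jmeas1_filt_oo my P_complete W_brownian).
have solYZ := msol_M2 P_complete W_brownian hYZ hYZ_eq.
have [[mY mZ] _ _ _ _] := solYZ.
have mE T : 0 < T -> jmeas1 (extend1 T (Epsi T)).
  by move=> T0; exact: jmeas1_extend (hEpsi_meas T T0).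
pose err T := energy1 P eta (fun w t => psi w t - extend1 T (Epsi T) w t).
pose A T w := (\int[lebesgue_measure]_(t in `[0%R, +oo[)
  (expR (2 * eta * t) * frob (Y w t - YT T w t) ^+ 2)%:E)%E.
pose B T w := (\int[lebesgue_measure]_(t in `[0%R, +oo[)
  ((expR (2 * eta * t))%:E * \int[lebesgue_measure]_(s in `[0%R, +oo[)
    (frob (Z w t s - ZT T w t s) ^+ 2)%:E))%E.
pose Q T := (\int[P]_w (A T w + B T w))%E.
suff : Q T @[T --> +oo] --> 0%E by [].
(* Stability between the given solution and the extended one; [C] depends on the kernels alone and
   hence not on [T]. *)
have Q_le T : 0 < T -> (Q T <= C%:E * err T)%E.
  move=> T0; have solT := msol_extend eta hB (htYZ T T0) (htYZ_eq T T0).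
  have [[mYT mZT] _ _ _ _] := solT.
  have mD1 := jmeas1B mY mYT; have mD2 := jmeas2B mZ mZT.
  have stab := stability P_complete W_brownian hB (jmeas1B mpsi (mE T T0)) solYZ solT
    c10 c20 c30 c_lt1 k1c k2c k3c.
  apply: le_trans stab; rewrite -(integral_wtD P eta mD1 mD2) le_eqVlt.
  apply/orP; left; apply/eqP/eq_integral => w _; congr (_ + _)%E.
    exact: integral_wt1E.
  exact: (integral_wt2E eta w mD2).
apply: ereal_cvg0 => [T|e e0].
  apply: integral_ge0 => w _; apply: adde_ge0.
    by apply: integral_ge0 => t _; rewrite lee_fin mulr_ge0 ?expR_ge0 ?sqr_ge0.
  apply: integral_ge0 => t _; apply: mule_ge0; first by rewrite lee_fin expR_ge0.
  by apply: integral_ge0 => s _; rewrite lee_fin sqr_ge0.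
have [M HM] : exists M : R, forall T, M <= T -> (Q T <= e%:E)%E.
  (* Otherwise there are horizons [T_ n] of size at least n + 1 at which [Q] exceeds [e], although
     [err] tends to 0 along them. *)
  apply: contrapT => /forallNP noM.
  have /choice[T_ HT] : forall n : nat, exists T, n.+1%:R <= T /\ ~ (Q T <= e%:E)%E.
    move=> n; have /existsNP[T /not_implyP[nT QT]] := noM n.+1%:R.
    by exists T.
  have T_gt0 n : 0 < T_ n by apply: lt_le_trans (HT n).1.
  have := projection_energy_cvg P_complete W_brownian hpsi (fun n => (HT n).1)
    (fun n => mE _ (T_gt0 n)) (fun n => hEpsi (T_ n) (T_gt0 n)).
  move=> /fine_cvgP[fin /cvgrPdist_le /(_ (e / C) (divr_gt0 e0 C0)) small].
  have [n _ /(_ n (leqnn n)) [fn sn]] := filterI fin small.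
  apply: (HT n).2; apply: (le_trans (Q_le _ (T_gt0 n))).
  move: fn sn; rewrite /= -/(err (T_ n)) => fn.
  rewrite sub0r normrN => /(le_trans (ler_norm _)) le_eC.
  by rewrite -(fineK fn) -EFinM lee_fin mulrC -ler_pdivlMr.
by exists M; split; [exact: num_real|move=> T /ltW; exact: HM].
Qed.
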